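(* Let $(X,\sigma_X)$ be a subshift with the weak specification property and let $\mathcal F=\{\log f_n\}_{n=1}^{\infty}$ be a sequence of continuous functions on $X$. For $x\in X$ put $$\underline f(x)=\liminf_{n\to\infty}\log\Big(\frac{f_n(x)}{f_{n-1}(\sigma_X(x))}\Big),\qquad \overline f(x)=\limsup_{n\to\infty}\log\Big(\frac{f_n(x)}{f_{n-1}(\sigma_X(x))}\Big).$$ Suppose that $\underline f(x)=\overline f(x)$ for every $x\in X$ and define $\hat f(x):=\lim_{n\to\infty}\log\big(f_n(x)/f_{n-1}(\sigma_X(x))\big)$. Then the following hold. (i) If $\mathcal F$ is almost additive on $X$, then $\hat f$ is a bounded Borel measurable function satisfying $$\lim_{n\to\infty}\frac1n\|\log f_n-S_n\hat f\|_\infty=0 \qquad (a)$$ and $$\lim_{n\to\infty}\frac1n\int\log f_n\,dm=\int\hat f\,dm\quad\text{for every } m\in M(X,\sigma_X). \qquad (b)$$ If, in addition, $\mathcal F$ has bounded variation on $X$, then the unique equilibrium state for $\mathcal F$, which is also the unique invariant Gibbs measure for $\mathcal F$, is the unique equilibrium state for $\hat f$ and it is the unique invariant Gibbs measure for $\hat f$. (ii) If $\mathcal F$ is merely weakly almost additive on $X$, then $\hat f$ is a bounded Borel measurable function satisfying (a) and (b). If an equilibrium state for $\mathcal F$ is Gibbs for $\mathcal F$, then it is an equilibrium state for $\hat f$ and it is also an invariant weak Gibbs measure for $\hat f$.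
   Context: A subshift $(X,\sigma_X)$ is a closed set $X\subseteq\{1,\dots,k\}^{\mathbb N}$ with $\sigma_X(X)\subseteq X$, where $(\sigma_X(x))_i=x_{i+1}$. $B_n(X)$ is the set of $n$-blocks appearing in points of $X$, $B_0(X)=\{\epsilon\}$ (empty word), $B(X)=\bigcup_{n\ge0}B_n(X)$, and $[x_1\dots x_n]=\{z\in X: z_i=x_i,\ 1\le i\le n\}$. $(X,\sigma_X)$ has the weak specification property if there is $p\in\mathbb N$ such that for all $u,v\in B(X)$ there are $0\le k\le p$ and $w\in B_k(X)$ with $uwv\in B(X)$. $M(X,\sigma_X)$ is the set of $\sigma_X$-invariant Borel probability measures on $X$; $S_ng=\sum_{i=0}^{n-1}g\circ\sigma_X^i$; $\|\cdot\|_\infty$ is the supremum norm; $h_m(\sigma_X)$ is measure-theoretic entropy. A sequence of continuous functions $\mathcal F=\{\log f_n\}_{n\ge1}$ on $X$ means that each $f_n:X\to(0,\infty)$ is continuous. It is almost additive if there is $C>0$ with $e^{-C}f_n(x)f_m(\sigma_X^nx)\le f_{n+m}(x)\le e^{C}f_n(x)f_m(\sigma_X^nx)$ for all $x\in X$, $n,m\in\mathbb N$; weakly almost additive if there are $C_n>0$ with $\lim_{n\to\infty}C_n/n=0$ such that the same inequalities hold with $C$ replaced by $C_n$ ($n$ being the index of $f_n$). It has bounded variation if there is $M>0$ with $\sup\{f_n(x)/f_n(y): x_i=y_i,\ 1\le i\le n\}\le M$ for all $n$. $\mu\in M(X,\sigma_X)$ is an equilibrium state for $\mathcal F$ if it maximizes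 $m\mapsto h_m(\sigma_X)+\lim_{n\to\infty}\frac1n\int\log f_n\,dm$ over $M(X,\sigma_X)$. $\mu\in M(X,\sigma_X)$ is a weak Gibbs measure for $\mathcal F$ if there are $P\in\mathbb R$ and $C_n>0$ with $\lim_{n\to\infty}\frac1n\log C_n=0$ such that $\frac1{C_n}\le \mu[x_1\dots x_n]/(e^{-nP}f_n(x))\le C_n$ for all $x\in X$, $n\in\mathbb N$; it is a Gibbs measure for $\mathcal F$ if one can take $C_n=C$ for all $n$. For a Borel measurable $g$ on $X$, $\mu\in M(X,\sigma_X)$ is an equilibrium state for $g$ if it maximizes $m\mapsto h_m(\sigma_X)+\int g\,dm$ over $M(X,\sigma_X)$, and a (weak) Gibbs measure for $g$ if the (weak) Gibbs condition holds with $f_n(x)$ replaced by $e^{(S_ng)(x)}$. It is known that an almost additive sequence with bounded variation on a subshift with the weak specification property has a unique equilibrium state, which is its unique invariant Gibbs measure. *)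

(* Defs.v *)
From HB Require Import structures.
From mathcomp Require Import all_boot all_order all_algebra.
From mathcomp Require Import all_classical all_reals all_analysis.

Set Implicit Arguments.
Unset Strict Implicit.
Unset Printing Implicit Defensive.

Import Order.TTheory GRing.Theory Num.Theory.
Import numFieldNormedType.Exports.

Local Open Scope classical_set_scope.
Local Open Scope ring_scope.

(* The alphabet {1, ..., k} is encoded as 'I_k.+1, i.e. there are k.+1 symbols
   with k an arbitrary natural number.  Coordinates are numbered from 0, so the
   block x_1 ... x_n is read off the coordinates 0, ..., n.-1. *)
Definition full_shift (k : nat) : Type :=
  prod_topology (fun _ : nat => discrete_topology 'I_k.+1).

HB.instance Definition _ k := Topological.copy (full_shift k)
  (prod_topology (fun _ : nat => discrete_topology 'I_k.+1)).

HB.instance Definition _ k :=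
  isPointed.Build (full_shift k) (fun=> ord0 : 'I_k.+1).

(* Borel sigma-algebra of the product topology. *)
HB.instance Definition _ k := Measurable.copy (full_shift k)
  (g_sigma_algebraType (@open (full_shift k))).

Section Subshifts.
Variable k : nat.
Local Notation T := (full_shift k).
Implicit Types (X : set T) (x y : T).

Definition left_shift x : T := fun i => x i.+1.

Definition subshift X :=
  [/\ closed X, X !=set0 & forall x, X x -> X (left_shift x)].

Definition blocks X n : set (seq 'I_k.+1) :=
  [set u | exists x j, X x /\ u = mkseq (fun i => x (j + i)%N : 'I_k.+1) n].

Definition language X : set (seq 'I_k.+1) := \bigcup_n blocks X n.

Definition weak_specification X := exists p : nat,
  forall u v, language X u -> language X v ->
    exists j w, [/\ (j <= p)%N, blocks X j w & language X (u ++ w ++ v)].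

Definition agree n x y := forall i, (i < n)%N -> x i = y i.

Definition cylinder X n x : set T := [set z | X z /\ agree n z x].

End Subshifts.

Section Sequences_of_functions.
Variables (R : realType) (k : nat).
Local Notation T := (full_shift k).
Implicit Types (X : set T) (f : nat -> T -> R) (g : T -> R).

(* Functions on X are represented by functions on the full shift whose values
   outside X are irrelevant, and a sequence (log f_n)_{n >= 1} by the f_n; the
   value f 0 is never constrained. *)
Definition continuous_sequence X f := forall n, (0 < n)%N ->
  {within X, continuous (f n)} /\ (forall x, X x -> 0 < f n x).

Definition almost_additive X f := exists2 C : R, 0 < C &
  forall x n m, X x -> (0 < n)%N -> (0 < m)%N ->
    expR (- C) * f n x * f m (iter n (@left_shift k) x) <= f (n + m)%N x
      <= expR C * f n x * f m (iter n (@left_shift k) x).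

Definition weakly_almost_additive X f := exists C : nat -> R,
  [/\ forall n, (0 < n)%N -> 0 < C n,
      (fun n => C n / n%:R) @ \oo --> (0 : R) &
      forall x n m, X x -> (0 < n)%N -> (0 < m)%N ->
        expR (- C n) * f n x * f m (iter n (@left_shift k) x) <= f (n + m)%N x
          <= expR (C n) * f n x * f m (iter n (@left_shift k) x)].

Definition bounded_variation_seq X f := exists2 M : R, 0 < M &
  forall n x y, (0 < n)%N -> X x -> X y -> agree n x y -> f n x / f n y <= M.

Definition log_ratio f x n : R := ln (f n x / f n.-1 (left_shift x)).

Definition lower_limit f x : \bar R := limn_einf (fun n => (log_ratio f x n)%:E).

Definition upper_limit f x : \bar R := limn_esup (fun n => (log_ratio f x n)%:E).

Definition limit_function f x : R := limn (log_ratio f x).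

Definition birkhoff n g x : R := \sum_(i < n) g (iter i (@left_shift k) x).

Definition sup_norm X g : \bar R := ereal_sup [set (`|g x|)%:E | x in X].

End Sequences_of_functions.

Section Invariant_measures.
Variables (R : realType) (k : nat).
Local Notation T := (full_shift k).
Implicit Types (X : set T) (f : nat -> T -> R) (g : T -> R)
  (m mu : probability T R).

(* Invariant Borel probability measures on the closed set X, as measures on the
   full shift that are carried by X. *)
Definition invariant_measure X m := m X = 1%E /\
  forall A : set T, measurable A -> m (@left_shift k @^-1` A) = m A.

Definition finite_partition X q (xi : 'I_q -> set T) :=
  [/\ forall i, measurable (xi i), trivIset setT xi & \bigcup_i xi i = X].

(* The atom of xi \/ sigma^-1 xi \/ ... \/ sigma^-(n-1) xi with itinerary w. *)
Definition join_atom q (xi : 'I_q -> set T) n (w : {ffun 'I_n -> 'I_q}) : set T :=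
  [set x | forall i : 'I_n, xi (w i) (iter i (@left_shift k) x)].

(* Here 0 * ln 0 = 0. *)
Definition join_entropy m q (xi : 'I_q -> set T) n : R :=
  - \sum_(w : {ffun 'I_n -> 'I_q})
      fine (m (join_atom xi w)) * ln (fine (m (join_atom xi w))).

Definition partition_entropy m q (xi : 'I_q -> set T) : R :=
  limn (fun n => join_entropy m xi n / n%:R).

Definition entropy X m : \bar R :=
  ereal_sup [set h | exists q (xi : 'I_q -> set T),
    finite_partition X xi /\ h = (partition_entropy m xi)%:E].

Definition mean_log_integral X m f n : \bar R :=
  ((n%:R^-1)%:E * \int[m]_(x in X) (ln (f n x))%:E)%E.

Definition equilibrium_state_seq X f mu := invariant_measure X mu /\
  forall m, invariant_measure X m ->
    (entropy X m + limn (mean_log_integral X m f)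
       <= entropy X mu + limn (mean_log_integral X mu f))%E.

Definition equilibrium_state_fun X g mu := invariant_measure X mu /\
  forall m, invariant_measure X m ->
    (entropy X m + \int[m]_(x in X) (g x)%:E
       <= entropy X mu + \int[mu]_(x in X) (g x)%:E)%E.

Definition gibbs_bounds X f mu (P : R) (C : nat -> R) :=
  forall x n, X x -> (0 < n)%N ->
    (C n)^-1 <= fine (mu (cylinder X n x)) / (expR (- (n%:R * P)) * f n x)
      <= C n.

Definition weak_gibbs_seq X f mu := invariant_measure X mu /\
  exists (P : R) (C : nat -> R),
    [/\ forall n, (0 < n)%N -> 0 < C n,
        (fun n => ln (C n) / n%:R) @ \oo --> (0 : R) &
        gibbs_bounds X f mu P C].

Definition gibbs_seq X f mu := invariant_measure X mu /\
  exists (P C : R), 0 < C /\ gibbs_bounds X f mu P (fun=> C).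

Definition weak_gibbs_fun X g :=
  weak_gibbs_seq X (fun n x => expR (birkhoff n g x)).

Definition gibbs_fun X g := gibbs_seq X (fun n x => expR (birkhoff n g x)).

(* A term of type probability T R also assigns values to non-measurable sets,
   hence uniqueness is stated on measurable sets only. *)
Definition is_unique (Q : probability T R -> Prop) mu :=
  Q mu /\ forall nu : probability T R, Q nu ->
    forall A : set T, measurable A -> nu A = mu A.

(* The pointwise convergence of log_ratio is part of the conclusion: it makes
   limit_function a genuine finite limit. *)
Definition bounded_borel_limit X f :=
  [/\ forall x, X x -> log_ratio f x @ \oo --> limit_function f x,
      exists M : R, forall x, X x -> `|limit_function f x| <= M &
      measurable_fun X (limit_function f)].

Definition uniform_birkhoff_approximation X f g :=
  (fun n => (n%:R^-1)%:E * sup_norm X (fun x => ln (f n x) - birkhoff n g x)%R)%E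
    @ \oo --> (0 : \bar R)%E.

Definition same_integral_limits X f g := forall m, invariant_measure X m ->
  mean_log_integral X m f @ \oo --> (\int[m]_(x in X) (g x)%:E)%E.

End Invariant_measures.

(* Main.v *)
(* Telescoping log (f_N / f_(N-n) o sigma^n) along an orbit and letting N tend to
   infinity gives |log f_n - S_n fhat| <= C_n on X.  Hence the two variational
   problems coincide, Gibbs bounds transfer from f to fhat up to exp C_n, and it
   remains to prove existence and uniqueness for f.

   Bounded variation turns f into a submultiplicative weight phi on words, and
   weak specification gives the reverse inequality up to gaps of length <= p, so
   that the total weight Z_n of the words of length n is comparable to exp (n P).
   Averaging point masses along orbits, weighted by phi, and taking an ultrafilter
   limit on clopen sets yields an invariant measure mu with mu[w] ~ phi(w) / Z_n.
   The gap inequality gives sum_(j <= p) mu(E, sigma^-(n+j) F) >= c mu(E) mu(F), so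
   mu is ergodic, and an invariant nu << mu equals mu.

   For every invariant m and finite partition, Gibbs' inequality bounds the entropy
   of m by H_n(m) / n, where H_n is the entropy of the words of length n.  The
   Gibbs property of mu then gives h(m) + lim 1/n int log f_n dm <= P, with
   equality for mu, and equality for nu forces the relative entropies of nu with
   respect to mu on words of length n to be bounded in n, whence nu << mu. *)

Require Import Defs.
From HB Require Import structures.
From mathcomp Require Import all_boot all_order all_algebra finmap.
From mathcomp Require Import all_classical all_reals all_analysis.
From mathcomp Require Import measurable_realfun.
From mathcomp Require Import ring lra zify.

Set Implicit Arguments.
Unset Strict Implicit.
Unset Printing Implicit Defensive.

Import Order.TTheory GRing.Theory Num.Theory.
Import numFieldNormedType.Exports.

Local Open Scope classical_set_scope.
Local Open Scope ring_scope.

(** * Cylinders and finitary sets *)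

(** The limit [fhat] is only Borel, so no semicontinuity argument applies to it. What it offers is
    additivity: the mean of its Birkhoff sum is exactly [n] times its mean. The entropy estimates
    are therefore run with [fhat], and a Gibbs measure enters them through an error bounded
    independently of [n]. A merely sublinear error would leave the relative entropies on words of
    length [n] unbounded, and absolute continuity would be lost.

    The gap length in weak specification cannot be prescribed, hence the sum over [j <= p] in the
    mixing estimate. This is weaker than mixing but enough for ergodicity: for an invariant set all
    terms of the sum vanish together.

    Measures are compared on sets depending on finitely many coordinates, and Borel sets are reached
    by approximation, for two measures at once. Partitions are treated in the same spirit: an
    arbitrary one is replaced by a finitary one that disagrees with it on a small set, and the
    disagreement is paid for as noise in a channel. *)

Section Cylinders.
Variable k : nat.
Local Notation T := (full_shift k).
Local Notation A := 'I_k.+1.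
Implicit Types (x y z : T) (w : seq A) (E : set T).

Definition word n x : seq A := mkseq (fun i => x i : A) n.

Definition shiftn n x : T := iter n (@left_shift k) x.

Definition cyl w : set T := [set z | word (size w) z = w].

(** These are the clopen sets of the full shift, with the number of relevant coordinates kept
    explicit. *)
Definition finitary n E := forall x y, agree n x y -> E x -> E y.

Lemma shiftE n x i : shiftn n x i = x (n + i)%N.
Proof.
elim: n x i => [//|n IH] x i; rewrite /shiftn iterSr -/(shiftn n _) IH.
by rewrite /left_shift addSn.
Qed.

Lemma shiftD n m x : shiftn (n + m) x = shiftn m (shiftn n x).
Proof. by rewrite /shiftn addnC iterD. Qed.

Lemma size_word n x : size (word n x) = n.
Proof. by rewrite size_mkseq. Qed.

Lemma word_agree n x y : agree n x y <-> word n x = word n y.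
Proof.
split=> [xy|xy i ni].
  apply: (@eq_from_nth _ ord0); rewrite !size_word// => i ni.
  by rewrite !nth_mkseq// xy.
by have := congr1 (fun s => nth ord0 s i) xy; rewrite !nth_mkseq.
Qed.

Lemma wordD n m x : word (n + m) x = word n x ++ word m (shiftn n x).
Proof.
rewrite /word /mkseq iotaD map_cat; congr (_ ++ _).
rewrite add0n -[X in iota X m]addn0 iotaDl -map_comp; apply: eq_map => i /=.
by rewrite shiftE.
Qed.

Lemma cylE n x z : cyl (word n x) z <-> agree n z x.
Proof. by rewrite /cyl /= size_word word_agree. Qed.

Lemma cyl_word n z : cyl (word n z) z.
Proof. by rewrite /cyl /= size_word. Qed.

Lemma cyl_cat u v z : cyl (u ++ v) z <-> cyl u z /\ cyl v (shiftn (size u) z).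
Proof.
rewrite /cyl /= size_cat wordD; split=> [/eqP|[-> ->]//].
by rewrite eqseq_cat ?size_word// => /andP[/eqP -> /eqP ->].
Qed.

(** Prefixes as elements of a finite type: the cylinders of length [n] become the fibres of one map,
    the form in which [mass_sum] and [mean_fin] take a partition. *)
Definition tword n x : n.-tuple A := Tuple (introT eqP (size_word n x)).

Lemma tword_preimage n (t : n.-tuple A) : tword n @^-1` [set t] = cyl t.
Proof.
apply/seteqP; split=> x /=; first by move=> <-; exact: cyl_word.
by rewrite /cyl /= size_tuple => xt; exact: val_inj.
Qed.

Lemma finitaryC n E : finitary n E -> finitary n (~` E).
Proof. by move=> fE x y xy nE /= Ey; apply: nE; apply: fE Ey => i /xy. Qed.

Lemma finitaryW n m E : (n <= m)%N -> finitary n E -> finitary m E.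
Proof.
by move=> nm fE x y xy; apply: fE => i ni; apply: xy; exact: leq_trans nm.
Qed.

Lemma finitaryU n E F : finitary n E -> finitary n F -> finitary n (E `|` F).
Proof. by move=> fE fF x y xy [/(fE _ _ xy)|/(fF _ _ xy)]; [left|right]. Qed.

Lemma finitary_cyl w : finitary (size w) (cyl w).
Proof. by move=> x y /word_agree; rewrite /cyl /= => ->. Qed.

Lemma finitary_shift n E : finitary n E -> finitary n.+1 (@left_shift k @^-1` E).
Proof. by move=> fE x y xy; apply: fE => i ni; exact: (xy i.+1). Qed.

Lemma nbhs_agree x U : nbhs x U -> exists n, [set y | agree n y x] `<=` U.
Proof.
pose F := filter_from [set: nat] (fun n => [set y | agree n y x]).
have FF : Filter F.
  apply: filter_from_filter; first by exists 0%N.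
  move=> i j _ _; exists (maxn i j) => //= y yx.
  by split=> l lt; apply: yx; rewrite leq_max lt ?orbT.
(* The product topology is a supremum of initial topologies, so convergence of [F] can be tested one
   coordinate at a time. *)
suff : F --> x by move=> cv /cv[n _ nU]; exists n.
apply/cvg_sup => i V /=.
have /= -> := @nbhsE (initial_topology (fun f : T => f i)) x.
case=> B [[C oC <-] Cx] BV; exists i.+1 => // y yx; apply: BV => /=.
by rewrite yx.
Qed.

Lemma open_coordinate (i : nat) (C : set A) : open ([set x : T | C (x i)] : set T).
Proof.
have -> : [set x : T | C (x i)] = (fun x : T => x i) @^-1` C by [].
apply: open_comp; last exact: discrete_open.
by move=> x _; exact: (@proj_continuous nat (fun=> discrete_topology A) i).
Qed.

Lemma open_agree n x : open [set y : T | agree n y x].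
Proof.
have -> : [set y : T | agree n y x] =
    \bigcap_(i in `I_n) [set y : T | [set x i] (y i)].
  by apply/seteqP; split=> y xy i; exact: xy.
rewrite bigcap_fset_set//.
by apply: big_ind => //; [exact: openT|exact: openI|move=> i _; exact: open_coordinate].
Qed.

Lemma open_finitary n E : finitary n E -> open E.
Proof.
move=> fE; rewrite openE => x Ex.
have nx : nbhs x [set y : T | agree n y x].
  by apply: open_nbhs_nbhs; split; [exact: open_agree|].
by apply: filterS nx => y yx; apply: fE Ex => i /yx.
Qed.

Lemma closed_finitary n E : finitary n E -> closed E.
Proof. by move=> fE; rewrite -openC; apply: (@open_finitary n); exact: finitaryC. Qed.

Lemma open_bigcup_cyl U : open U ->
  U = \bigcup_(w in [set w | cyl w `<=` U]) cyl w.
Proof.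
move=> oU; apply/seteqP; split=> [x Ux|x [w wU]]; last exact: wU.
have [n nU] := nbhs_agree (open_nbhs_nbhs (conj oU Ux)).
exists (word n x); last exact: cyl_word.
by move=> z /cylE/nU.
Qed.

(** The [n]-th set collects the points whose whole [n]-cylinder lies in [U]. Monotonicity is what
    continuity from below of a measure asks for. *)
Lemma open_exhaustion U : open U -> exists V : nat -> set T,
  [/\ forall n, finitary n (V n), nondecreasing_seq V & U = \bigcup_n V n].
Proof.
move=> oU; exists (fun n => [set x | [set y | agree n y x] `<=` U]); split.
- by move=> n x y xy Vx z zy; apply: Vx => i ni; rewrite zy// xy.
- move=> n m nm; apply/subsetPset => x Vx y yx; apply: Vx => i ni.
  by apply: yx; exact: leq_trans nm.
- apply/seteqP; split=> [x Ux|x [n _]]; last exact.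
  by have [n nU] := nbhs_agree (open_nbhs_nbhs (conj oU Ux)); exists n.
Qed.

Lemma full_shift_compact : compact [set: T].
Proof.
have := @tychonoff nat (fun=> discrete_topology A) (fun=> setT).
rewrite (_ : [set f | _] = setT); last by apply/seteqP; split.
apply => i; apply: finite_compact.
have -> : [set: A] = [set x | x \in enum A].
  by apply/seteqP; split=> // x _ /=; rewrite mem_enum.
exact: finite_seq.
Qed.

Lemma open_measurable E : open E -> measurable E.
Proof. exact: sub_sigma_algebra. Qed.

Lemma closed_measurable E : closed E -> measurable E.
Proof.
move=> cE; rewrite -[E]setCK; apply: measurableC.
by apply: sub_sigma_algebra; rewrite openC.
Qed.

Lemma finitary_measurable n E : finitary n E -> measurable E.
Proof. by move=> /open_finitary/open_measurable. Qed.

Lemma cyl_measurable w : measurable (cyl w).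
Proof. apply: finitary_measurable; exact: finitary_cyl. Qed.

Lemma left_shift_continuous : continuous (@left_shift k : T -> T).
Proof.
apply/continuousP => U oU; rewrite (open_bigcup_cyl oU) preimage_bigcup.
apply: bigcup_open => w _.
by apply: open_finitary; apply: finitary_shift; exact: finitary_cyl.
Qed.

Lemma left_shift_measurable : measurable_fun setT (@left_shift k : T -> T).
Proof.
apply: (@measurability _ _ _ _ _ _ (@open T)) => // _ [U oU <-].
rewrite setTI; apply: open_measurable.
by apply: open_comp oU => x _; exact: left_shift_continuous.
Qed.

Lemma shift_measurable n : measurable_fun setT (shiftn n).
Proof.
elim: n => [|n IH]; first exact: measurable_id.
exact: (measurableT_comp left_shift_measurable IH).
Qed.

Lemma measurable_preimage_shift n E : measurable E -> measurable (shiftn n @^-1` E).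
Proof.
by move=> mE; rewrite -[X in measurable X]setTI; exact: shift_measurable.
Qed.

End Cylinders.

HB.instance Definition _ k := isMeasurableFun.Build _ _ _ _
  (@left_shift k) (@left_shift_measurable k).

(** * Real-valued masses of probability measures *)

Section Mass.
Context d (T : measurableType d) (R : realType).
Implicit Types (m : probability T R) (E F : set T).

Definition mass m E : R := fine (m E).

Lemma massE m E : measurable E -> m E = (mass m E)%:E.
Proof. by move=> mE; rewrite /mass fineK// fin_num_measure. Qed.

Lemma mass_ge0 m E : 0 <= mass m E.
Proof. by rewrite /mass fine_ge0. Qed.

Lemma mass0 m : mass m set0 = 0.
Proof. by rewrite /mass measure0. Qed.

Lemma massT m : mass m setT = 1.
Proof. by rewrite /mass probability_setT. Qed.

Lemma le_mass m E F : measurable E -> measurable F -> E `<=` F ->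
  mass m E <= mass m F.
Proof.
move=> mE mF EF; rewrite -lee_fin -!massE//.
by apply: le_measure; rewrite ?inE.
Qed.

Lemma mass_le1 m E : measurable E -> mass m E <= 1.
Proof. by move=> mE; rewrite -(massT m); exact: le_mass. Qed.

Lemma massU m E F : measurable E -> measurable F -> [disjoint E & F] ->
  mass m (E `|` F) = mass m E + mass m F.
Proof.
move=> mE mF /disj_set2P EF; apply: EFin_inj; rewrite EFinD -!massE//.
  by rewrite measureU.
exact: measurableU.
Qed.

Lemma le_massU m E F : measurable E -> measurable F ->
  mass m (E `|` F) <= mass m E + mass m F.
Proof.
move=> mE mF; rewrite -lee_fin EFinD -!massE//; last exact: measurableU.
exact: measureU2.
Qed.

Lemma mass_splitI m E F : measurable E -> measurable F ->
  mass m E = mass m (E `&` F) + mass m (E `\` F).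
Proof.
move=> mE mF; rewrite -massU ?setUIDK//.
- exact: measurableI.
- exact: measurableD.
- by apply/disj_set2P/seteqP; split=> // x [[_ Fx] []].
Qed.

Lemma massC m E : measurable E -> mass m (~` E) = 1 - mass m E.
Proof.
move=> mE; apply: EFin_inj; rewrite EFinB -!massE//; last exact: measurableC.
exact: probability_setC.
Qed.

Lemma mass_bigcup_cvg m (F : (set T)^nat) :
  (forall i, measurable (F i)) -> nondecreasing_seq F ->
  mass m (F n) @[n --> \oo] --> mass m (\bigcup_n F n).
Proof.
move=> mF ndF; apply: fine_cvg.
have mU : measurable (\bigcup_n F n) by exact: bigcupT_measurable.
by rewrite fineK ?fin_num_measure//; exact: nondecreasing_cvg_mu.
Qed.

Lemma mass_sum m (I : finType) (W : T -> I) E :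
  measurable E -> (forall i, measurable (W @^-1` [set i])) ->
  mass m E = \sum_i mass m (E `&` W @^-1` [set i]).
Proof.
move=> mE mW; pose F (s : seq I) := E `&` W @^-1` [set i | i \in s].
have mF s : measurable (F s).
  elim: s => [|i s IH].
    by rewrite (_ : F _ = set0) ?measurable0//; apply/seteqP; split=> // x [].
  rewrite (_ : F _ = (E `&` W @^-1` [set i]) `|` F s).
    by apply: measurableU => //; apply: measurableI.
  apply/seteqP; split=> x /=; rewrite /F /= ?inE.
    by move=> [Ex /predU1P[|]]; [left|right].
  by move=> [[Ex Wx]|[Ex xs]]; split=> //=; rewrite ?Wx ?eqxx// xs orbT.
suff H s : uniq s -> mass m (F s) = \sum_(i <- s) mass m (E `&` W @^-1` [set i]).
  rewrite -H ?index_enum_uniq//; congr mass.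
  by apply/seteqP; split=> [x Ex|x []//]; split => //=; rewrite mem_index_enum.
elim: s => [_|i s IH /= /andP[nis us]].
  by rewrite big_nil (_ : F _ = set0) ?mass0//; apply/seteqP; split=> // x [].
rewrite big_cons -IH// -massU//; last 2 first.
- exact: measurableI.
- apply/disj_set2P/seteqP; split=> // x [[_ /= Wx] [_ /=]].
  by rewrite Wx (negbTE nis).
congr mass; apply/seteqP; split=> x /=; rewrite /F /= ?inE.
  by move=> [Ex /predU1P[|]]; [left|right].
by move=> [[Ex Wx]|[Ex xs]]; split=> //=; rewrite ?Wx ?eqxx// xs orbT.
Qed.

End Mass.

(** * Approximation of Borel sets by finitary sets *)

Section Approximation.
Variables (R : realType) (k : nat).
Local Notation T := (full_shift k).
Variables m1 m2 : probability T R.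
Implicit Types E F B : set T.

(** Both measures enter one distance because an inequality between [m1] and [m2] passes to a Borel
    set only through a single finitary set that is close to it for both. *)
Let dist E F : R := (mass m1 (E `\` F) + mass m1 (F `\` E)) +
  (mass m2 (E `\` F) + mass m2 (F `\` E)).

Let approximable B := measurable B /\ forall e : R, 0 < e ->
  exists n E, finitary n E /\ dist B E < e.

Let dist_triangle B E F : measurable B -> measurable E -> measurable F ->
  dist B F <= dist B E + dist E F.
Proof.
move=> mB mE mF.
have H (m : probability T R) (C D G : set T) : measurable C -> measurable D ->
    measurable G -> mass m (C `\` D) <= mass m (C `\` G) + mass m (G `\` D).
  move=> mC mD mG; apply: le_trans (le_massU _ _ _); [|exact: measurableD..].
  apply: le_mass; [exact: measurableD|by apply: measurableU; exact: measurableD|].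
  by move=> x [Cx nDx]; have [Gx|nGx] := pselect (G x); [right|left].
have := H m1 B F E mB mF mE; have := H m1 F B E mF mB mE.
have := H m2 B F E mB mF mE; have := H m2 F B E mF mB mE.
by rewrite /dist; lra.
Qed.

Let dist_subset B E : measurable B -> measurable E -> E `<=` B ->
  dist B E = (mass m1 B - mass m1 E) + (mass m2 B - mass m2 E).
Proof.
move=> mB mE EB; have E0 : E `\` B = set0 by rewrite setD_eq0.
have H (m : probability T R) : mass m (B `\` E) = mass m B - mass m E.
  rewrite [mass m B](@mass_splitI _ _ _ _ _ E)//; rewrite setIidr//; ring.
by rewrite /dist E0 !H !mass0; lra.
Qed.

Let approximableU_nd (B : (set T)^nat) : nondecreasing_seq B ->
  (forall n, approximable (B n)) -> approximable (\bigcup_n B n).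
Proof.
move=> ndB aB; have mB n : measurable (B n) by case: (aB n).
have mU : measurable (\bigcup_n B n) by exact: bigcupT_measurable.
split=> // e e0.
have e2 : 0 < e / 2 by lra.
have e4 : 0 < e / 4 by lra.
have H (m : probability T R) :
    \forall n \near \oo, mass m (\bigcup_n B n) - mass m (B n) < e / 4.
  have /cvgrPdist_lt/(_ _ e4) := mass_bigcup_cvg (m := m) mB ndB.
  by apply: filterS => n; apply: le_lt_trans; exact: ler_norm.
have [n [n1 n2]] : exists n, mass m1 (\bigcup_n B n) - mass m1 (B n) < e / 4 /\
   mass m2 (\bigcup_n B n) - mass m2 (B n) < e / 4.
  by near \oo => n; exists n; split; near: n; exact: H.
have [N [E [fE BE]]] := (aB n).2 _ e2.
have mE := finitary_measurable fE.
exists N, E; split=> //.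
apply: le_lt_trans (dist_triangle mU (mB n) mE) _.
rewrite dist_subset//; last by move=> x Bx; exists n.
by lra.
Unshelve. all: by end_near. Qed.

Let approximableU B E : approximable B -> approximable E -> approximable (B `|` E).
Proof.
move=> [mB aB] [mE aE]; split; first exact: measurableU.
move=> e e0; have e2 : 0 < e / 2 by lra.
have [n [F [fF BF]]] := aB _ e2; have [m [G [fG EG]]] := aE _ e2.
exists (maxn n m), (F `|` G); split.
  by apply: finitaryU; [apply: finitaryW fF; exact: leq_maxl
                       |apply: finitaryW fG; exact: leq_maxr].
have mF := finitary_measurable fF; have mG := finitary_measurable fG.
have H (mu : probability T R) (C D C' D' : set T) : measurable C ->
    measurable D -> measurable C' -> measurable D' ->
    mass mu ((C `|` D) `\` (C' `|` D')) <=
      mass mu (C `\` C') + mass mu (D `\` D').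
  move=> mC mD mC' mD'.
  apply: le_trans (le_massU _ _ _); [|exact: measurableD..].
  apply: le_mass; [by apply: measurableD; exact: measurableU
                  |by apply: measurableU; exact: measurableD|].
  by move=> x [[Cx|Dx] /not_orP[nC nD]]; [left|right].
have := H m1 B E F G mB mE mF mG; have := H m1 F G B E mF mG mB mE.
have := H m2 B E F G mB mE mF mG; have := H m2 F G B E mF mG mB mE.
by move: BF EG; rewrite /dist; lra.
Qed.

Let approximableC B : approximable B -> approximable (~` B).
Proof.
move=> [mB aB]; split; first exact: measurableC.
move=> e e0; have [n [E [fE BE]]] := aB _ e0.
exists n, (~` E); split; first exact: finitaryC.
rewrite /dist !setDE !setCK ![~` _ `&` _]setIC -!setDE.
by move: BE; rewrite /dist; lra.
Qed.

Let approximable_finitary n E : finitary n E -> approximable E.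
Proof.
move=> fE; split; first exact: finitary_measurable fE.
by move=> e e0; exists n, E; split=> //; rewrite /dist setDv !mass0 !addr0.
Qed.

(** The approximable sets form a sigma-algebra, by closure under complements, finite unions and
    increasing unions. It contains the open sets, each an increasing union of finitary ones. *)
Lemma finitary_approximation2 B (e : R) : measurable B -> 0 < e ->
  exists n E, [/\ finitary n E,
    mass m1 (B `\` E) < e, mass m1 (E `\` B) < e,
    mass m2 (B `\` E) < e & mass m2 (E `\` B) < e].
Proof.
move=> mB e0.
have : approximable B.
  apply: (@smallest_sub _ _ (@open T) approximable) mB; last first.
    move=> U /open_exhaustion[V [fV ndV ->]].
    by apply: approximableU_nd => // n; exact: approximable_finitary (fV n).
  split; first exact: (@approximable_finitary 0).
    by move=> C aC; rewrite setTD; exact: approximableC.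
  move=> F aF; rewrite -bigcup_bigsetU_bigcup.
  apply: approximableU_nd.
    apply/nondecreasing_seqP => n; rewrite [leRHS]big_ord_recr.
    by apply/subsetPset => x ?; left.
  elim=> [|n IH]; rewrite big_ord_recr ?big_ord0 /=.
    by apply: approximableU => //; exact: (@approximable_finitary 0).
  exact: approximableU.
move=> [_ /(_ _ e0)[n [E [fE]]]]; rewrite /dist => h.
have := mass_ge0 m1 (B `\` E); have := mass_ge0 m1 (E `\` B).
have := mass_ge0 m2 (B `\` E); have := mass_ge0 m2 (E `\` B).
by move=> *; exists n, E; split=> //; lra.
Qed.

Lemma le_mass_cylinders (K : R) : 0 <= K ->
  (forall w, mass m1 (cyl w) <= K * mass m2 (cyl w)) ->
  forall B, measurable B -> mass m1 B <= K * mass m2 B.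
Proof.
move=> K0 cK.
have fK n E : finitary n E -> mass m1 E <= K * mass m2 E.
  move=> fE; have mE := finitary_measurable fE.
  have mW t : measurable (@tword k n @^-1` [set t]).
    by rewrite tword_preimage; exact: cyl_measurable.
  rewrite (mass_sum m1 mE mW) (mass_sum m2 mE mW) mulr_sumr.
  apply: ler_sum => t _; rewrite tword_preimage.
  have [[x [Ex xt]]|nE] := pselect (exists x, E x /\ cyl t x).
    rewrite (_ : E `&` cyl t = cyl t)//.
    apply/seteqP; split=> [y []//|y yt]; split=> //; apply: fE Ex.
    by apply/word_agree; move: xt yt; rewrite /cyl /= size_tuple => -> ->.
  rewrite (_ : E `&` cyl t = set0) ?mass0 ?mulr0//.
  by apply/seteqP; split=> // x Ex; apply: nE; exists x.
move=> B mB; rewrite leNgt; apply/negP => lt.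
(* Replacing [B] by [E] costs [e] for [m1] and [K * e] for [m2], in total less than the assumed
   excess [(K + 2) * e]. *)
pose e : R := (mass m1 B - K * mass m2 B) / (K + 2).
have K2 : 0 < K + 2 by lra.
have e0 : 0 < e by rewrite divr_gt0// subr_gt0.
have [n [E [fE h1 _ _ h2]]] := finitary_approximation2 mB e0.
have mE := finitary_measurable fE.
have le1 : mass m1 B <= mass m1 E + e.
  rewrite (mass_splitI m1 mB mE); apply: lerD; last exact: ltW.
  by apply: le_mass => //; exact: measurableI.
have le2 : mass m2 E <= mass m2 B + e.
  rewrite (mass_splitI m2 mE mB); apply: lerD; last exact: ltW.
  by apply: le_mass => //; exact: measurableI.
have := fK _ _ fE; have : K * mass m2 E <= K * (mass m2 B + e) by exact: ler_wpM2l.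
have : (K + 2) * e = mass m1 B - K * mass m2 B by rewrite mulrC divfK ?gt_eqF.
by move: e0 le1; rewrite mulrDr; lra.
Qed.

End Approximation.

Lemma eq_mass_cylinders (R : realType) k (m1 m2 : probability (full_shift k) R) :
  (forall w, mass m1 (cyl w) = mass m2 (cyl w)) ->
  forall B, measurable B -> mass m1 B = mass m2 B.
Proof.
move=> m12 B mB; apply/eqP; rewrite eq_le; apply/andP; split.
  by rewrite -[leRHS]mul1r; apply: le_mass_cylinders mB => // w; rewrite m12 mul1r.
by rewrite -[leRHS]mul1r; apply: le_mass_cylinders mB => // w; rewrite m12 mul1r.
Qed.

(** * Integrals of bounded measurable functions *)

Section Mean.
Context d (T : measurableType d) (R : realType).
Implicit Types (m : probability T R) (F G : T -> R) (X : set T).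

(** A class closed under all operations used below and integrable for every probability measure, so
    that [mean] is linear on it. *)
Definition bounded_measurable F :=
  measurable_fun setT F /\ exists M : R, forall x, `|F x| <= M.

Definition mean m F : R := Rintegral m setT F.

Lemma bounded_measurable_integrable m F :
  bounded_measurable F -> m.-integrable setT (EFin \o F).
Proof.
move=> [mF [M FM]]; apply: measurable_bounded_integrable => //.
  by apply: le_lt_trans (ltry 1); exact: probability_le1.
exists M; split; first exact: num_real.
by move=> K MK x _; apply: le_trans (FM x) (ltW MK).
Qed.
Local Hint Resolve bounded_measurable_integrable : core.

Lemma bounded_measurable_cst c : bounded_measurable (fun=> c).
Proof. by split; [exact: measurable_cst|exists `|c|]. Qed.

Lemma bounded_measurableD F G : bounded_measurable F -> bounded_measurable G ->
  bounded_measurable (fun x => F x + G x).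
Proof.
move=> [mF [M FM]] [mG [N GN]]; split; first exact: measurable_funD.
by exists (M + N) => x; apply: le_trans (ler_normD _ _) (lerD _ _).
Qed.

Lemma bounded_measurableB F G : bounded_measurable F -> bounded_measurable G ->
  bounded_measurable (fun x => F x - G x).
Proof.
move=> [mF [M FM]] [mG [N GN]]; split; first exact: measurable_funB.
by exists (M + N) => x; apply: le_trans (ler_normB _ _) (lerD _ _).
Qed.

Lemma bounded_measurableZ c F : bounded_measurable F ->
  bounded_measurable (fun x => c * F x).
Proof.
move=> [mF [M FM]]; split.
  by apply: measurable_funM => //; exact: measurable_cst.
by exists (`|c| * M) => x; rewrite normrM ler_wpM2l.
Qed.

Lemma bounded_measurable_sum (I : Type) (s : seq I) (F : I -> T -> R) :
  (forall i, bounded_measurable (F i)) ->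
  bounded_measurable (fun x => \sum_(i <- s) F i x).
Proof.
move=> bF; elim: s => [|i s IH].
  rewrite (_ : (fun _ => _) = fun=> 0); first exact: bounded_measurable_cst.
  by apply/funext => x; rewrite big_nil.
rewrite (_ : (fun _ => _) = fun x => F i x + \sum_(j <- s) F j x).
  exact: bounded_measurableD.
by apply/funext => x; rewrite big_cons.
Qed.

Lemma bounded_measurable_comp F (h : T -> T) : measurable_fun setT h ->
  bounded_measurable F -> bounded_measurable (F \o h).
Proof.
move=> mh [mF [M FM]]; split; first exact: measurableT_comp.
by exists M => x; exact: FM.
Qed.

Lemma bounded_measurable_fin (I : finType) (W : T -> I) (F : I -> R) :
  (forall i, measurable (W @^-1` [set i])) -> bounded_measurable (F \o W).
Proof.
move=> mW; split; last first.
  exists (\sum_i `|F i|) => x; rewrite (bigD1 (W x))//= lerDl.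
  exact: sumr_ge0.
move=> _ Y mY; rewrite setTI.
rewrite (_ : _ @^-1` _ = \bigcup_(i in [set i | Y (F i)]) W @^-1` [set i]).
  by apply: fin_bigcup_measurable => //; exact: finite_finset.
by apply/seteqP; split=> [x Yx|x [i Yi /= Wx]]; [exists (W x)|rewrite /= Wx].
Qed.

Lemma measurable_neq_fin (I : finType) (V W : T -> I) :
  (forall i, measurable (V @^-1` [set i])) ->
  (forall i, measurable (W @^-1` [set i])) -> measurable [set x | V x != W x].
Proof.
move=> mV mW; rewrite (_ : [set _ | _] =
    \bigcup_(i in setT) (V @^-1` [set i] `\` W @^-1` [set i])).
  apply: fin_bigcup_measurable; first exact: finite_finset.
  by move=> i _; apply: measurableD.
apply/seteqP; split=> x /= => [VW|[i _ [/= <- /eqP]]]; last by rewrite eq_sym.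
by exists (V x) => //; split=> //= /esym/eqP; apply/negP.
Qed.

Lemma mean_cst m c : mean m (fun=> c) = c.
Proof. by rewrite /mean Rintegral_cst// -/(mass m setT) massT mulr1. Qed.

Lemma meanD m F G : bounded_measurable F -> bounded_measurable G ->
  mean m (fun x => F x + G x) = mean m F + mean m G.
Proof. by move=> bF bG; rewrite /mean RintegralD//; exact: bounded_measurable_integrable. Qed.

Lemma meanB m F G : bounded_measurable F -> bounded_measurable G ->
  mean m (fun x => F x - G x) = mean m F - mean m G.
Proof. by move=> bF bG; rewrite /mean RintegralB//; exact: bounded_measurable_integrable. Qed.

Lemma meanZ m c F : bounded_measurable F ->
  mean m (fun x => c * F x) = c * mean m F.
Proof. by move=> bF; rewrite /mean RintegralZl//; exact: bounded_measurable_integrable. Qed.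

Lemma mean_sum m (I : Type) (s : seq I) (F : I -> T -> R) :
  (forall i, bounded_measurable (F i)) ->
  mean m (fun x => \sum_(i <- s) F i x) = \sum_(i <- s) mean m (F i).
Proof.
move=> bF; elim: s => [|i s IH].
  rewrite big_nil -[RHS](mean_cst m); congr mean.
  by apply/funext => x; rewrite big_nil.
rewrite big_cons -IH -meanD//; last exact: bounded_measurable_sum.
by congr mean; apply/funext => x; rewrite big_cons.
Qed.

Lemma mean_indic m E : measurable E -> mean m \1_E = mass m E.
Proof. by move=> mE; rewrite /mean /Rintegral integral_indic// setIT. Qed.

Lemma bounded_measurable_indic E : measurable E -> bounded_measurable (\1_E : T -> R).
Proof.
move=> mE; split; first exact: measurable_indic.
by exists 1 => x; rewrite indicE ger0_norm ?ler0n// lern1 leq_b1.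
Qed.

Lemma mean_fin m (I : finType) (W : T -> I) (F : I -> R) :
  (forall i, measurable (W @^-1` [set i])) ->
  mean m (F \o W) = \sum_i mass m (W @^-1` [set i]) * F i.
Proof.
move=> mW.
have -> : F \o W = fun x => \sum_i F i * \1_(W @^-1` [set i]) x.
  apply/funext => x; rewrite (bigD1 (W x))//= big1 => [|i iW].
    by rewrite indicE mem_set//= mulr1 addr0.
  by rewrite indicE memNset ?mulr0//= => Wi; rewrite Wi eqxx in iW.
rewrite mean_sum; last by move=> i; apply/bounded_measurableZ/bounded_measurable_indic.
apply: eq_bigr => i _; rewrite meanZ ?mean_indic 1?mulrC//.
exact: bounded_measurable_indic.
Qed.

Lemma mean_setI m X F : measurable X -> m X = 1%E -> bounded_measurable F ->
  (\int[m]_(x in X) (F x)%:E = (mean m F)%:E)%E.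
Proof.
move=> mX X1 bF.
have C0 : m (~` X) = 0%E by rewrite probability_setC// X1 subee.
rewrite /mean /Rintegral fineK.
  rewrite (@negligible_integral _ _ _ m setT (~` X))//.
  - by rewrite setTD setCK.
  - exact: measurableC.
  - exact: bounded_measurable_integrable.
by apply: integrable_fin_num => //; exact: bounded_measurable_integrable.
Qed.

Lemma le_mean m X F G : measurable X -> m X = 1%E -> bounded_measurable F ->
  bounded_measurable G -> (forall x, X x -> F x <= G x) -> mean m F <= mean m G.
Proof.
move=> mX X1 bF bG FG; rewrite -lee_fin -!(mean_setI mX X1)//.
apply: le_integral => //.
- by apply: integrableS (bounded_measurable_integrable m bF).
- by apply: integrableS (bounded_measurable_integrable m bG).
- by move=> x; rewrite inE lee_fin => /FG.
Qed.

Lemma mean_pushforward m F (h : T -> T) : measurable_fun setT h ->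
  (forall E, measurable E -> m (h @^-1` E) = m E) -> bounded_measurable F ->
  mean m (F \o h) = mean m F.
Proof.
move=> mh inv bF; rewrite /mean /Rintegral; congr fine.
rewrite -[LHS](@integral_pushforward _ _ _ _ _ h mh m setT (EFin \o F))//.
- by apply: eq_measure_integral => E mE _; exact: inv.
- by apply/measurable_EFinP; case: bF.
- exact: (bounded_measurable_integrable m (bounded_measurable_comp mh bF)).
Qed.

End Mean.

(** * Weights on words *)

Section Word_sums.
Variables (R : realType) (k : nat).
Local Notation A := 'I_k.+1.
Implicit Types (F : seq A -> R) (u v w : seq A).

Definition word_sum n F : R := \sum_(t : n.-tuple A) F t.

Lemma eq_word_sum n F G : (forall w, size w = n -> F w = G w) ->
  word_sum n F = word_sum n G.
Proof. by move=> FG; apply: eq_bigr => t _; rewrite FG ?size_tuple. Qed.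

Lemma ler_word_sum n F G : (forall w, size w = n -> F w <= G w) ->
  word_sum n F <= word_sum n G.
Proof. by move=> FG; apply: ler_sum => t _; rewrite FG ?size_tuple. Qed.

Lemma word_sum_ge0 n F : (forall w, 0 <= F w) -> 0 <= word_sum n F.
Proof. by move=> F0; exact: sumr_ge0. Qed.

Lemma word_sumZ n c F : word_sum n (fun w => c * F w) = c * word_sum n F.
Proof. by rewrite /word_sum mulr_sumr. Qed.

Lemma word_sumZr n c F : word_sum n (fun w => F w * c) = word_sum n F * c.
Proof. by rewrite /word_sum mulr_suml. Qed.

Lemma word_sum_cst n c : word_sum n (fun=> c) = (k.+1 ^ n)%:R * c.
Proof. by rewrite /word_sum sumr_const card_tuple card_ord mulr_natl. Qed.

Lemma word_sum_exchange n m (F : seq A -> seq A -> R) :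
  word_sum n (fun u => word_sum m (F u)) =
  word_sum m (fun v => word_sum n (F^~ v)).
Proof. exact: exchange_big. Qed.

Lemma word_sum_sum n q (F : 'I_q -> seq A -> R) :
  word_sum n (fun u => \sum_(i < q) F i u) = \sum_(i < q) word_sum n (F i).
Proof. exact: exchange_big. Qed.

Lemma word_sum0 F : word_sum 0 F = F [::].
Proof.
rewrite /word_sum (bigD1 [tuple])//= big1 ?addr0// => t /eqP[].
by rewrite [t]tuple0.
Qed.

Lemma word_sumD n m F :
  word_sum (n + m) F = word_sum n (fun u => word_sum m (fun v => F (u ++ v))).
Proof.
rewrite /word_sum pair_bigA /=.
pose h (p : n.-tuple A * m.-tuple A) : (n + m).-tuple A := cat_tuple p.1 p.2.
rewrite (reindex h)//=; exists (fun t : (n + m).-tuple A =>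
    (tcast (minn_idPl (leq_addr m n)) (take_tuple n t),
     tcast (addKn n m) (drop_tuple n t))).
  move=> [u v] _; congr (_, _); apply: val_inj; rewrite /= val_tcast /=.
    by rewrite take_size_cat ?size_tuple.
  by rewrite drop_size_cat ?size_tuple.
by move=> t _; apply: val_inj; rewrite /= !val_tcast /= cat_take_drop.
Qed.

Lemma ler_word_sum1 n F w : (forall u, 0 <= F u) -> size w = n -> F w <= word_sum n F.
Proof.
move=> F0 /eqP wn; rewrite /word_sum (bigD1 (Tuple wn))//= lerDl.
exact: sumr_ge0.
Qed.

Lemma word_sum_take n m F :
  word_sum (n + m) (fun w => F (take m w)) = (k.+1 ^ n)%:R * word_sum m F.
Proof.
rewrite addnC word_sumD -word_sumZ; apply: eq_word_sum => u um.
by rewrite -word_sum_cst; apply: eq_word_sum => v _; rewrite take_size_cat.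
Qed.

Lemma word_sum_drop n m F :
  word_sum (n + m) (fun w => F (drop n w)) = (k.+1 ^ n)%:R * word_sum m F.
Proof.
rewrite word_sumD -word_sum_cst; apply: eq_word_sum => u un.
by apply: eq_word_sum => v _; rewrite drop_size_cat.
Qed.

End Word_sums.

(* A nonnegative weight on words which is submultiplicative and which satisfies
   the reverse inequality up to inserting a connecting word of length <= p. *)
Record specified_weight (R : realType) k (phi : seq 'I_k.+1 -> R) (K : R) p := {
  weight_ge0 : forall w, 0 <= phi w ;
  weight_nil : phi [::] = 1 ;
  weight_sub : forall u v, phi (u ++ v) <= K * (phi u * phi v) ;
  weight_glue : forall u v, phi u * phi v <= K *
    \sum_(j < p.+1) word_sum j (fun w => phi (u ++ w ++ v)) ;
  weight_sum_gt0 : forall n, 0 < word_sum n phi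
}.

Section Weights.
Variables (R : realType) (k : nat) (phi : seq 'I_k.+1 -> R) (K : R) (p : nat).
Hypothesis phiP : specified_weight phi K p.
Local Notation A := 'I_k.+1.
Local Notation Z n := (word_sum n phi).
Implicit Types (u v w : seq A).

Let phi0 := weight_ge0 phiP.
Let Z0 := weight_sum_gt0 phiP.

Lemma weight_ge1 : 1 <= K.
Proof.
by have := weight_sub phiP [::] [::]; rewrite /= (weight_nil phiP) !mulr1.
Qed.

Let K0 : 0 <= K. Proof. exact: le_trans ler01 weight_ge1. Qed.

(** One number dominating both the weight of every word of length at most [p] and every [Z j] with
    [j <= p]. *)
Definition gap_bound : R := \sum_(j < p.+1) Z j.
Local Notation B := gap_bound.

Let B0 : 0 <= B.
Proof. by apply: sumr_ge0 => i _; exact: ltW. Qed.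

Lemma weight_gap w : (size w <= p)%N -> phi w <= B.
Proof.
move=> wp; rewrite /gap_bound (bigD1 (Ordinal (wp : size w < p.+1)%N))//=.
apply: le_trans (ler_word_sum1 phi0 (erefl _)) _.
by rewrite lerDl; apply: sumr_ge0 => i _; exact: ltW.
Qed.

(** The outer [K] pays for gluing, [K * B] for cutting off a piece of length at most [p], and the
    sum counts the words that become equal after the cut. *)
Definition ext_const : R :=
  K * (K * B * \sum_(j < p.+1) (k.+1 ^ j)%:R).
Local Notation C := ext_const.

(* Connect v to each word b of length m by a gap word w and cut v ++ w ++ b back
   to length size v + m: every word is obtained from boundedly many b. *)
Lemma weight_extr v m : phi v * Z m <= C * word_sum m (fun t => phi (v ++ t)).
Proof.
rewrite -word_sumZ.
apply: le_trans (ler_word_sum (fun b _ => weight_glue phiP v b)) _.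
rewrite word_sumZ /ext_const -mulrA ler_wpM2l// word_sum_sum.
rewrite mulrAC [leRHS]mulr_sumr; apply: ler_sum => j _.
rewrite word_sum_exchange.
rewrite -(@word_sumD _ _ j m (fun t => phi (v ++ t))).
rewrite -[leRHS]mulrA (mulrC (word_sum _ _)).
rewrite -(word_sum_take j m (fun t => phi (v ++ t))) -word_sumZ.
apply: ler_word_sum => w wjm.
rewrite -{1}[w](cat_take_drop m) catA.
apply: le_trans (weight_sub phiP _ _) _; rewrite -mulrA ler_wpM2l// mulrC.
by rewrite ler_wpM2r// weight_gap// size_drop wjm addnK -ltnS.
Qed.

(** Mirror image of [weight_extr]: the gap word now stands between [b] and [v], and the first [j]
    letters are cut off. *)
Lemma weight_extl v m : phi v * Z m <= C * word_sum m (fun t => phi (t ++ v)).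
Proof.
rewrite -word_sumZ.
have h b : size b = m -> phi v * phi b <= K *
    \sum_(j < p.+1) word_sum j (fun w => phi (b ++ w ++ v)).
  by move=> _; rewrite mulrC; exact: (weight_glue phiP).
apply: le_trans (ler_word_sum h) _.
rewrite word_sumZ /ext_const -mulrA ler_wpM2l// word_sum_sum.
rewrite mulrAC [leRHS]mulr_sumr; apply: ler_sum => j _.
under eq_word_sum => u _ do under eq_word_sum => w _ do rewrite catA.
rewrite -(@word_sumD _ _ m j (fun t => phi (t ++ v))) addnC.
rewrite -[leRHS]mulrA (mulrC (word_sum _ _)).
rewrite -(word_sum_drop j m (fun t => phi (t ++ v))) -word_sumZ.
apply: ler_word_sum => w wjm.
rewrite -{1}[w](cat_take_drop j) -catA.
apply: le_trans (weight_sub phiP _ _) _; rewrite -mulrA ler_wpM2l//.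
rewrite ler_wpM2r// weight_gap// size_takel ?wjm ?leq_addr//.
by rewrite -ltnS.
Qed.

Let C0 : 0 <= C.
Proof. by rewrite /ext_const !mulr_ge0//; apply: sumr_ge0. Qed.

Lemma ext_const_gt0 : 0 < C.
Proof.
rewrite lt_neqAle C0 andbT; apply/eqP => C00.
have := weight_extr [::] 0; rewrite -C00 mul0r (weight_nil phiP) mul1r.
by rewrite leNgt Z0.
Qed.

Lemma weight_sumM_le n m : Z n * Z m <= C * Z (n + m).
Proof.
rewrite word_sumD -word_sumZr -word_sumZ; apply: ler_word_sum => v _.
exact: weight_extr.
Qed.

Lemma weight_sumD_le n m : Z (n + m) <= K * (Z n * Z m).
Proof.
rewrite word_sumD -word_sumZr -word_sumZ; apply: ler_word_sum => u _.
by rewrite -!word_sumZ; apply: ler_word_sum => v _; exact: (weight_sub phiP).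
Qed.

(** A word inside a longer one has two sides, and each side costs one cut, [K], and one extension,
    [C]. *)
Definition quasi_bernoulli_const : R := K ^+ 2 * C ^+ 2.
Local Notation Q := quasi_bernoulli_const.

Lemma quasi_bernoulli_const_gt0 : 0 < Q.
Proof.
by rewrite mulr_gt0 ?exprn_gt0// ?ext_const_gt0// (lt_le_trans ltr01 weight_ge1).
Qed.

(** Together with [weight_middle_le]: under the law on words of length [i + size v + j] proportional
    to [phi], the word [v] stands at position [i] with probability comparable to
    [phi v / Z (size v)], uniformly in [i] and [j]. *)
Lemma weight_middle_ge i j v :
  phi v * Z (i + size v + j) <=
  Q * Z (size v) * word_sum i (fun a => word_sum j (fun b => phi (a ++ v ++ b))).
Proof.
set S := word_sum i _.
have h1 : phi v * Z i * Z j <= C ^+ 2 * S.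
  have := weight_extl v i; rewrite -(ler_pM2r (Z0 j)) => /le_trans; apply.
  rewrite -[leLHS]mulrA expr2 -[leRHS]mulrA ler_wpM2l// /S -word_sumZr -word_sumZ.
  apply: ler_word_sum => a _; apply: le_trans (weight_extr _ _) _.
  by rewrite ler_wpM2l//; apply: ler_word_sum => b _; rewrite catA.
have h2 : Z (i + size v + j) <= K ^+ 2 * (Z i * Z (size v) * Z j).
  apply: le_trans (weight_sumD_le _ _) _; rewrite expr2 -mulrA ler_wpM2l//.
  rewrite [leRHS]mulrA; apply: ler_wpM2r; [exact: ltW|exact: weight_sumD_le].
apply: le_trans (ler_wpM2l (phi0 v) h2) _.
rewrite [leLHS](_ : _ = K ^+ 2 * Z (size v) * (phi v * Z i * Z j)); last by ring.
rewrite /Q [leRHS](_ : _ = K ^+ 2 * Z (size v) * (C ^+ 2 * S)); last by ring.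
by rewrite ler_wpM2l// mulr_ge0 ?exprn_ge0// ltW.
Qed.

Lemma weight_middle_le i j v :
  Z (size v) * word_sum i (fun a => word_sum j (fun b => phi (a ++ v ++ b))) <=
  Q * phi v * Z (i + size v + j).
Proof.
set S := word_sum i _.
have h1 : S <= K ^+ 2 * (Z i * phi v * Z j).
  rewrite /S -!word_sumZr -word_sumZ; apply: ler_word_sum => a _.
  rewrite -!word_sumZ; apply: ler_word_sum => b _.
  apply: le_trans (weight_sub phiP _ _) _; rewrite expr2 -!mulrA ler_wpM2l//.
  by rewrite [leRHS]mulrCA ler_wpM2l// (weight_sub phiP).
have h2 : Z i * Z (size v) * Z j <= C ^+ 2 * Z (i + size v + j).
  rewrite expr2 -[leRHS]mulrA.
  apply: le_trans (ler_wpM2l C0 (weight_sumM_le _ _)).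
  rewrite [leRHS]mulrA; apply: ler_wpM2r; [exact: ltW|exact: weight_sumM_le].
apply: le_trans (ler_wpM2l (ltW (Z0 (size v))) h1) _.
rewrite [leLHS](_ : _ = K ^+ 2 * phi v * (Z i * Z (size v) * Z j)); last by ring.
rewrite /Q [leRHS](_ : _ = K ^+ 2 * phi v * (C ^+ 2 * Z (i + size v + j))); last by ring.
by rewrite ler_wpM2l// mulr_ge0 ?exprn_ge0.
Qed.

(** [weight_glue] after normalisation. The gap has length at most [p], so [Z] of the glued length is
    at most [K ^+ 2 * B] times [Z (size u) * Z (size v)]; gluing supplies the third [K]. *)
Lemma weight_mixing u v :
  phi u / Z (size u) * (phi v / Z (size v)) <=
  K ^+ 3 * B * \sum_(j < p.+1) word_sum j
    (fun w => phi (u ++ w ++ v) / Z (size (u ++ w ++ v))).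
Proof.
have -> : phi u / Z (size u) * (phi v / Z (size v)) =
   (Z (size u) * Z (size v))^-1 * (phi u * phi v) by rewrite invfM; ring.
have V0 : 0 <= (Z (size u) * Z (size v))^-1 by rewrite invr_ge0 mulr_ge0// ltW.
apply: le_trans (ler_wpM2l V0 (weight_glue phiP u v)) _.
rewrite [leLHS]mulrA [leLHS]mulr_sumr [leRHS]mulr_sumr; apply: ler_sum => j _.
rewrite -[leLHS]word_sumZ -[leRHS]word_sumZ; apply: ler_word_sum => w wj.
have Zle : Z (size (u ++ w ++ v)) <= K ^+ 2 * B * (Z (size u) * Z (size v)).
  rewrite !size_cat; apply: le_trans (weight_sumD_le _ _) _.
  have h : Z (size w + size v) <= K * (B * Z (size v)).
    apply: le_trans (weight_sumD_le _ _) _; rewrite ler_wpM2l//.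
    apply: ler_wpM2r; first exact: ltW.
    rewrite wj /gap_bound (bigD1 j)//= lerDl.
    by apply: sumr_ge0 => i _; exact: ltW.
  rewrite [leRHS](_ : _ = K * (Z (size u) * (K * (B * Z (size v))))); last by ring.
  by rewrite ler_wpM2l// ler_wpM2l// ltW.
move: Zle; set a := phi (u ++ w ++ v); set z := Z _; set y := Z _ * Z _ => Zle.
rewrite [leLHS](_ : _ = K * a * y^-1); last by ring.
rewrite [leRHS](_ : _ = K * a * (K ^+ 2 * B / z)); last by ring.
apply: ler_wpM2l; first by apply: mulr_ge0 => //; exact: phi0.
have z0 : 0 < z by exact: Z0.
have y0 : 0 < y by apply: mulr_gt0; exact: Z0.
by rewrite ler_pdivlMr// mulrC ler_pdivrMr.
Qed.

End Weights.

(* Fekete-type argument: all quotients (a n - c) / n lie below all quotients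
   (a m + c) / m, and P separates the two families. *)
Lemma almost_additive_linear (R : realType) (a : nat -> R) (c : R) :
  (forall n m, `|a (n + m)%N - a n - a m| <= c) ->
  exists P, forall n, `|a n - n%:R * P| <= c.
Proof.
move=> ac.
have mul n m : `|a (m.+1 * n)%N - m.+1%:R * a n| <= m%:R * c.
  elim: m => [|m IH]; first by rewrite mul1n !mul1r mul0r subrr normr0.
  have := ac n (m.+1 * n)%N; move: IH; rewrite mulSn -[m.+2%:R]natr1 -![m.+1%:R]natr1.
  by rewrite !ler_norml; lra.
(* Both sides estimate [a] at the product [n.+1 * m.+1], cut once into blocks of length [n.+1] and
   once into blocks of length [m.+1]. The instance at 0 gives [0 <= c]. *)
have cross n m : m.+1%:R * (a n.+1 - c) <= n.+1%:R * (a m.+1 + c).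
  have := mul n.+1 m; have := mul m.+1 n; rewrite mulnC !ler_norml.
  rewrite -[n.+1%:R]natr1 -[m.+1%:R]natr1.
  have := normr_ge0 (a (0 + 0)%N - a 0%N - a 0%N); have := ac 0%N 0%N.
  by lra.
pose S := [set (a n.+1 - c) / n.+1%:R | n in [set: nat]].
have ubS m : ubound S ((a m.+1 + c) / m.+1%:R).
  by move=> _ [n _ <-]; rewrite ler_pdivlMr// mulrAC ler_pdivrMr// mulrC [leRHS]mulrC.
have S0 : S !=set0 by exists ((a 1%N - c) / 1%:R); exists 0%N.
exists (sup S) => -[|n].
  by have := ac 0%N 0%N; rewrite mul0r subr0 addn0 subrr sub0r normrN.
have h1 : (a n.+1 - c) / n.+1%:R <= sup S.
  by apply: sup_upper_bound; [split=> //; exists ((a 1%N + c) / 1%:R); exact: ubS|exists n].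
have h2 : sup S <= (a n.+1 + c) / n.+1%:R by apply: ge_sup => //; exact: ubS.
by move: h1 h2; rewrite ler_pdivrMr// ler_pdivlMr// mulrC ler_norml; lra.
Qed.

(** * Existence of Gibbs measures *)

Section Finitary_content.
Variable k : nat.

(* The full shift carrying the algebra of finitary sets instead of its Borel
   sigma-algebra; by compactness a content on it is sigma-additive. *)
Definition finitary_space : Type := full_shift k.

HB.instance Definition _ := Pointed.on finitary_space.

Let fin_sets : set (set finitary_space) := [set E | exists n, @finitary k n E].

Let fin_sets0 : fin_sets set0.
Proof. by exists 0%N. Qed.

Let fin_setsU : setU_closed fin_sets.
Proof.
move=> E F [n nE] [m mF]; exists (maxn n m); apply: finitaryU.
  by apply: finitaryW nE; exact: leq_maxl.
by apply: finitaryW mF; exact: leq_maxr.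
Qed.

Let fin_setsC : setC_closed fin_sets.
Proof. by move=> E [n nE]; exists n; exact: finitaryC. Qed.

HB.instance Definition _ := @isAlgebraOfSets.Build default_measure_display
  finitary_space fin_sets fin_sets0 fin_setsU fin_setsC.

End Finitary_content.

Section Extension.
Variables (R : realType) (k : nat).
Local Notation T := (full_shift k).
Variable nu : set T -> R.
Hypothesis nu_ge0 : forall E, 0 <= nu E.
Hypothesis nuT : nu setT = 1.
Hypothesis nuU : forall E F, E `&` F = set0 -> nu (E `|` F) = nu E + nu F.

Let nu0 : nu set0 = 0.
Proof. by have := @nuU set0 set0; rewrite setI0 setU0 => /(_ erefl); lra. Qed.

Let le_nu E F : E `<=` F -> nu E <= nu F.
Proof.
move=> EF; rewrite -(setDUK EF) nuU ?lerDl// setDE setIA.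
by apply/seteqP; split=> // x [[Ex _] /(_ Ex)].
Qed.

Let le_nu_bigsetU (F : nat -> set T) N :
  nu (\big[setU/set0]_(i < N) F i) <= \sum_(i < N) nu (F i).
Proof.
elim: N => [|N IH]; first by rewrite !big_ord0 nu0.
rewrite !big_ord_recr /=; set U := \big[setU/set0]_(i < N) F i.
have -> : U `|` F N = U `|` (F N `\` U).
  by apply/seteqP; split=> x; rewrite /setU /setD /=; have [] := pselect (U x); tauto.
rewrite nuU; last by apply/seteqP; split=> // x [Ux []].
by rewrite lerD// le_nu// => x [].
Qed.

Definition finitary_content (E : set (finitary_space k)) : \bar R := (nu E)%:E.

Let content_ge0 E : (0 <= finitary_content E)%E.
Proof. by rewrite lee_fin. Qed.

Let content_semi_additive : measure_function.semi_additive finitary_content.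
Proof.
move=> F n _ tF _; elim: n => [|n IH].
  by rewrite !big_ord0 /finitary_content nu0.
rewrite !big_ord_recr /= -IH /finitary_content -EFinD nuU//.
apply/seteqP; split=> // x; rewrite -bigcup_mkord => -[[i /= ilt Fi] Fn].
have /trivIsetP/(_ i n Logic.I Logic.I (negbT (ltn_eqF ilt))) := tF.
by move=> /seteqP[/(_ x) + _]; apply.
Qed.

HB.instance Definition _ := isContent.Build _ (finitary_space k) R
  finitary_content content_ge0 content_semi_additive.

(** Finitary sets are compact and open, so a countable cover of one by others has a finite subcover,
    and finite subadditivity is enough. *)
Let content_subadditive : measurable_subset_sigma_subadditive finitary_content.
Proof.
move=> A F mF [n fA] AF.
have cA : compact (A : set T).
  apply: (subclosed_compact _ (@full_shift_compact k)) => //.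
  exact: closed_finitary fA.
have oF i : open (F i : set T) by have [m /open_finitary] := mF i.
have [D _ AD] : finite_subset_cover setT (F : nat -> set T) A.
  by move: cA; rewrite compact_cover; apply.
have [N DN] : exists N, forall i, i \in D -> (i < N)%N.
  exists (\sum_(i <- D) i.+1)%N => i iD; rewrite (big_rem i)//=.
  exact: leq_trans (leq_addr _ _).
have AN : A `<=` \big[setU/set0]_(i < N) F i.
  by move=> x /AD[i /= iD Fi]; rewrite -bigcup_mkord; exists i => //; exact: DN.
apply: (@le_trans _ _ (\sum_(0 <= i < N) finitary_content (F i))%E).
  rewrite big_mkord sumEFin lee_fin.
  by apply: le_trans (le_nu_bigsetU F N); exact: le_nu.
by apply: nneseries_lim_ge.
Qed.

HB.instance Definition _ := Content_SigmaSubAdditive_isMeasure.Build _ R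
  (finitary_space k) finitary_content content_subadditive.

Let S := g_sigma_algebraType (@measurable _ (finitary_space k)).

Let ext : {measure set S -> \bar R} := measure_extension finitary_content.

(** Open sets are countable unions of finitary sets, so Borel sets lie in the sigma-algebra that
    carries the Caratheodory extension. *)
Let id_measurable : measurable_fun setT (id : S -> T).
Proof.
apply: (@measurability _ _ _ _ _ _ (@open T)) => // _ [U oU <-].
rewrite setTI preimage_id.
have [V [fV _ ->]] := open_exhaustion oU.
by apply: bigcupT_measurable => n; apply: sub_sigma_algebra; exists n.
Qed.

Let measurable_ext E : measurable (E : set T) -> measurable (E : set S).
Proof. by move=> /(id_measurable measurableT); rewrite setTI preimage_id. Qed.

Definition extended_content (E : set T) : \bar R := ext E.
Local Notation mu := extended_content.

Let mu0 : mu set0 = 0%E.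
Proof. exact: measure0. Qed.

Let mu_ge0 E : (0 <= mu E)%E.
Proof. exact: measure_ge0. Qed.

Let mu_sigma_additive : semi_sigma_additive mu.
Proof.
move=> F mF tF mU; apply: (measure_semi_sigma_additive (s := ext)) => //.
  by move=> i; exact: measurable_ext.
exact: measurable_ext.
Qed.

HB.instance Definition _ := isMeasure.Build _ T R mu mu0 mu_ge0 mu_sigma_additive.

Let muE n E : finitary n E -> mu E = (nu E)%:E.
Proof.
move=> fE; rewrite /mu /ext /= /measure_extension/=.
by rewrite measurable_mu_extE//; exists n.
Qed.

Let muT : mu setT = 1%E.
Proof. by rewrite (@muE 0)// nuT. Qed.

HB.instance Definition _ := Measure_isProbability.Build _ T R mu muT.

(** An ultrafilter limit of averages of point masses is finitely additive on all sets but need not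
    be sigma-additive. The measure obtained from it therefore keeps its values on finitary sets
    only. *)
Lemma finitary_extension : exists P : probability T R,
  forall n E, finitary n E -> mass P E = nu E.
Proof. by exists mu => n E fE; rewrite /mass /= (muE fE). Qed.

End Extension.

(** By compactness of the interval the image has a cluster point, and an ultrafilter converges to
    each of its cluster points. One ultrafilter serves all sets [E] at once, whereas a subsequence
    would serve countably many. *)
Lemma ultra_cvg_bounded (R : realType) (U : set_system nat) (g : nat -> R) :
  UltraFilter U -> (forall n, 0 <= g n <= 1) -> exists l : R, g @ U --> l.
Proof.
move=> UU g01.
have gU : (g @ U) `[0, 1]%classic.
  by apply: (@filterS _ U _ setT) => [n _|]; [rewrite /= in_itv; exact: g01|exact: filterT].
have [p [_ gp]] := @segment_compact R 0 1 (g @ U) _ gU.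
exists (p : R) => V pV; have [//|nV] := in_ultra_setVsetC (g @^-1` V) UU.
by have [x [nVx Vx]] := gp (~` V) V nV pV.
Qed.

Lemma cvg_ge0 (R : realType) (U : set_system nat) {UU : ProperFilter U}
  (g : nat -> R) (l : R) : (forall n, 0 <= g n) -> g @ U --> l -> 0 <= l.
Proof.
move=> g0 gl; apply: (@closed_cvg _ _ U _ g (fun x => 0 <= x) _ _ l gl).
  exact: closed_ge.
by apply: filterS (@filterT _ U _) => n _.
Qed.

(** * The invariant Gibbs measure as a limit of orbit averages *)

Section Gibbs_construction.
Variables (R : realType) (k : nat) (X : set (full_shift k)).
Variables (phi : seq 'I_k.+1 -> R) (K : R) (p : nat).
Variable pt : seq 'I_k.+1 -> full_shift k.
Hypothesis phiP : specified_weight phi K p.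
Hypothesis X_closed : closed X.
Hypothesis X_shift : forall x, X x -> X (left_shift x).
Hypothesis ptX : forall w, 0 < phi w -> X (pt w) /\ cyl w (pt w).
Local Notation T := (full_shift k).
Local Notation A := 'I_k.+1.
Local Notation Z n := (word_sum n phi).
Local Notation Q := (quasi_bernoulli_const phi K p).
Implicit Types (u v w : seq A) (E F : set T).

Let phi0 := weight_ge0 phiP.
Let Z0 := weight_sum_gt0 phiP.

Definition occurrence E i N : R :=
  word_sum N (fun u => phi u * \1_E (shiftn i (pt u))).

(* Cesaro average of the distribution on the points pt u in which u, of length
   N.+1, has probability phi u / Z. *)
Definition empirical N E : R :=
  (\sum_(i < N.+1) occurrence E i N.+1) / (N.+1%:R * Z N.+1).

Lemma shift_X n x : X x -> X (shiftn n x).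
Proof. by move=> Xx; elim: n => //= n IH; exact: X_shift. Qed.

Let ind01 E x : 0 <= (\1_E x : R) <= 1.
Proof. by rewrite indicE ler0n lern1 leq_b1. Qed.

Lemma occurrence_ge0 E i N : 0 <= occurrence E i N.
Proof.
apply: word_sum_ge0 => u; apply: mulr_ge0; first exact: phi0.
by case/andP: (ind01 E (shiftn i (pt u))).
Qed.

Lemma occurrence_le E i N : occurrence E i N <= Z N.
Proof.
apply: ler_word_sum => u _; rewrite -[leRHS]mulr1; apply: ler_wpM2l; first exact: phi0.
by case/andP: (ind01 E (shiftn i (pt u))).
Qed.

Let den_gt0 N : 0 < N.+1%:R * Z N.+1.
Proof. by rewrite mulr_gt0. Qed.

Lemma empirical01 N E : 0 <= empirical N E <= 1.
Proof.
rewrite divr_ge0 ?(ltW (den_gt0 _))//=; last first.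
  by apply: sumr_ge0 => i _; exact: occurrence_ge0.
rewrite ler_pdivrMr// mul1r mulr_natl -[X in _ *+ X]card_ord -sumr_const.
by apply: ler_sum => i _; exact: occurrence_le.
Qed.

Lemma empiricalT N : empirical N setT = 1.
Proof.
rewrite /empirical (eq_bigr (fun=> Z N.+1)) => [|i _].
  by rewrite sumr_const card_ord -[X in X / _]mulr_natl divff// gt_eqF.
by apply: eq_word_sum => u _; rewrite indicT mulr1.
Qed.

Lemma empiricalU N E F : E `&` F = set0 ->
  empirical N (E `|` F) = empirical N E + empirical N F.
Proof.
move=> EF; rewrite /empirical -mulrDl -big_split /=; congr (_ / _).
apply: eq_bigr => i _; rewrite /occurrence /word_sum -big_split /=.
apply: eq_bigr => u _; rewrite -mulrDr; congr (_ * _); set x := shiftn _ _.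
rewrite !indicE in_setU; have [xE|] /= := boolP (x \in E); last by rewrite add0r.
suff /negbTE -> : x \notin F by rewrite addr0.
by apply/negP => xF; move: EF => /seteqP[/(_ x) + _]; apply; split; exact: set_mem.
Qed.

(** Taking the preimage moves every visit one step in time, so the two sums differ in their end
    terms only. *)
Lemma empirical_shift N E :
  `|empirical N (@left_shift k @^-1` E) - empirical N E| <= N.+1%:R^-1.
Proof.
have occS i : occurrence (@left_shift k @^-1` E) i N.+1 = occurrence E i.+1 N.+1.
  by apply: eq_word_sum => u _; rewrite !indicE.
rewrite /empirical -mulrBl.
rewrite (eq_bigr (fun i : 'I_N.+1 => occurrence E i.+1 N.+1)); last by move=> i _.
rewrite big_ord_recr [in X in _ - X]big_ord_recl /=.
set S := \sum_(i < N) _.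
rewrite (_ : S + _ - _ = occurrence E N.+1 N.+1 - occurrence E 0 N.+1); last by ring.
rewrite normrM [X in _ * X]ger0_norm ?invr_ge0 ?(ltW (den_gt0 _))//.
rewrite ler_pdivrMr// mulrA mulVf ?pnatr_eq0// mul1r ler_norml.
have := occurrence_ge0 E N.+1 N.+1; have := occurrence_ge0 E 0 N.+1.
have := occurrence_le E N.+1 N.+1; have := occurrence_le E 0 N.+1.
by move=> *; apply/andP; split; lra.
Qed.

Lemma empirical_disjoint N E : E `&` X = set0 -> empirical N E = 0.
Proof.
move=> EX; rewrite /empirical big1 ?mul0r// => i _.
rewrite /occurrence /word_sum big1// => u _.
have := phi0 u; rewrite le_eqVlt => /predU1P[<-|u0]; first by rewrite mul0r.
rewrite indicE memNset ?mulr0// => Eu.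
have [Xu _] := ptX u0; move: EX => /seteqP[/(_ (shiftn i (pt u))) + _]; apply.
by split=> //; exact: shift_X.
Qed.

(** Where [phi u > 0] the point [pt u] begins with [u], so its visit to [cyl v] at time [i] can be
    read off the letters of [u]. Words of weight 0 contribute nothing to either side. *)
Lemma occurrence_cyl v i j :
  occurrence (cyl v) i (i + size v + j) =
  word_sum i (fun a => word_sum j (fun b => phi (a ++ v ++ b))).
Proof.
rewrite /occurrence -addnA word_sumD; apply: eq_word_sum => a ai.
rewrite word_sumD {1}/word_sum.
rewrite (bigD1 (in_tuple v))//= big1 ?addr0 => [|t tv]; last first.
  rewrite /word_sum big1// => b _.
  have := phi0 (a ++ t ++ b); rewrite le_eqVlt => /predU1P[<-|u0]; first by rewrite mul0r.
  rewrite indicE memNset ?mulr0//= => vP.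
  have [_ /cyl_cat[_ /cyl_cat[tP _]]] := ptX u0.
  move: tP; rewrite ai /cyl /= size_tuple => tE.
  by move/eqP: tv; apply; apply: val_inj; rewrite /= -tE.
apply: eq_word_sum => b _.
have := phi0 (a ++ v ++ b); rewrite le_eqVlt => /predU1P[<-|u0]; first by rewrite mul0r.
rewrite indicE mem_set ?mulr1//.
by have [_ /cyl_cat[_ /cyl_cat[]]] := ptX u0; rewrite ai.
Qed.

Lemma occurrence_cyl_bounds v i N : (i + size v <= N)%N ->
  Q^-1 * (phi v / Z (size v)) <= occurrence (cyl v) i N / Z N <=
  Q * (phi v / Z (size v)).
Proof.
move=> ivN; rewrite -(subnKC ivN) occurrence_cyl; set j := (N - _)%N.
have Q0 := quasi_bernoulli_const_gt0 phiP.
have := weight_middle_ge phiP i j v; have := weight_middle_le phiP i j v.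
set S := word_sum i _ => h1 h2.
rewrite ler_pdivlMr// ler_pdivrMr//; apply/andP; split.
  rewrite -mulrA ler_pdivrMl// mulrAC ler_pdivrMr//.
  by apply: le_trans h2 _; rewrite mulrAC.
by rewrite mulrA mulrAC ler_pdivlMr// mulrC.
Qed.

(** Counts the positions whose window of length [n] sticks out of the word, where
    [occurrence_cyl_bounds] says nothing. *)
Let count_boundary N n : \sum_(i < N) (N < i + n)%N%:R <= n%:R :> R.
Proof.
rewrite -natr_sum ler_nat (reindex_inj rev_ord_inj)/=.
apply: (@leq_trans (\sum_(i < N) (i < n))%N).
  by apply: leq_sum => i _; have := ltn_ord i; do 2!case: ltnP => //=; lia.
suff -> : (\sum_(i < N) (i < n) = minn N n)%N by exact: geq_minr.
elim: N => [|N IH]; first by rewrite big_ord0 min0n.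
by rewrite big_ord_recr /= IH; case: ltnP; lia.
Qed.

Let empiricalE N E :
  empirical N E = (\sum_(i < N.+1) occurrence E i N.+1 / Z N.+1) / N.+1%:R.
Proof. by rewrite /empirical -mulr_suml invfM; ring. Qed.

Lemma empirical_cyl_le N v : empirical N (cyl v) <=
  Q * (phi v / Z (size v)) + (size v)%:R / N.+1%:R.
Proof.
set g := phi v / _; have Q0 := quasi_bernoulli_const_gt0 phiP.
have g0 : 0 <= g by apply: divr_ge0; [exact: phi0|exact: ltW].
rewrite empiricalE ler_pdivrMr// mulrDl divfK ?pnatr_eq0//.
apply: le_trans (lerD (lexx _) (count_boundary N.+1 (size v))).
rewrite mulr_natr -[X in _ *+ X]card_ord -sumr_const -big_split /=.
apply: ler_sum => i _; have [/ltnW|iv] := ltnP N.+1 (i + size v).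
  move=> _; apply: (@le_trans _ _ 1); first by rewrite ler_pdivrMr// mul1r occurrence_le.
  by rewrite lerDr mulr_ge0// ltW.
by rewrite addr0; have /andP[_] := occurrence_cyl_bounds iv.
Qed.

Lemma empirical_cyl_ge N v : Q^-1 * (phi v / Z (size v)) *
  (1 - (size v)%:R / N.+1%:R) <= empirical N (cyl v).
Proof.
set g := _ * (phi v / _); have Q0 := quasi_bernoulli_const_gt0 phiP.
have g0 : 0 <= g.
  by apply: mulr_ge0; [rewrite invr_ge0 ltW|apply: divr_ge0; [exact: phi0|exact: ltW]].
rewrite empiricalE ler_pdivlMr// -mulrA mulrBl mul1r divfK ?pnatr_eq0//.
have := count_boundary N.+1 (size v); rewrite -subr_ge0 => h.
apply: (@le_trans _ _ (g * (N.+1%:R - \sum_(i < N.+1) (N.+1 < i + size v)%N%:R))).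
  by apply: ler_wpM2l => //; rewrite lerB// -subr_ge0.
rewrite -[X in X%:R - _]card_ord -sumr_const -sumrB mulr_sumr.
apply: ler_sum => i _; have [_|iv] := ltnP N.+1 (i + size v).
  by rewrite subrr mulr0 divr_ge0 ?occurrence_ge0// ltW.
by rewrite subr0 mulr1; have /andP[] := occurrence_cyl_bounds iv.
Qed.

Let to_ge0 (v : seq A) (U : set_system nat) : UltraFilter U -> \oo `<=` U ->
  (size v)%:R / N.+1%:R @[N --> U] --> (0 : R).
Proof.
move=> UU oU; have h : (size v)%:R / N.+1%:R @[N --> \oo] --> (0 : R).
  rewrite -[X in _ --> X](mulr0 (size v)%:R); apply: cvgMr.
  exact: cvg_harmonic.
by move=> V /h; exact: oU.
Qed.

Lemma ex_gibbs_measure : exists mu : probability T R, invariant_measure X mu /\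
  forall v, Q^-1 * (phi v / Z (size v)) <= mass mu (cyl v) <=
            Q * (phi v / Z (size v)).
Proof.
have [U [UU oU]] := ultraFilterLemma (F := \oo) _.
have [nu nuP] : exists nu : set T -> R,
    forall E, empirical N E @[N --> U] --> nu E.
  exists (fun E => lim (empirical N E @[N --> U])) => E.
  by have [l /cvgP] := ultra_cvg_bounded UU (fun N => empirical01 N E).
have const E c : (forall N, empirical N E = c) -> nu E = c.
  move=> Ec; apply: (cvg_unique _ (nuP E)) => //.
  by rewrite (_ : empirical^~ E = fun=> c); [exact: cvg_cst|exact/funext].
have nu0 E : 0 <= nu E.
  by apply: cvg_ge0 (nuP E) => N; have /andP[] := empirical01 N E.
have nuU E F : E `&` F = set0 -> nu (E `|` F) = nu E + nu F.
  move=> EF; apply: (cvg_unique _ (nuP _)) => //.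
  rewrite (_ : empirical^~ _ = fun N => empirical N E + empirical N F).
    by apply: cvgD; exact: nuP.
  by apply/funext => N; exact: empiricalU.
have [mu muE] := finitary_extension nu0 (const _ _ empiricalT) nuU.
exists mu; split; last first.
  move=> v; rewrite (muE _ _ (@finitary_cyl _ v)); set g := phi v / _.
  apply/andP; split.
    have cv : Q^-1 * g * (1 - (size v)%:R / N.+1%:R) @[N --> U] --> Q^-1 * g.
      rewrite -[X in _ --> X](_ : Q^-1 * g * (1 - 0) = _); last first.
        by rewrite subr0 mulr1.
      apply: cvgMr; by apply: cvgB; [exact: cvg_cst|exact: to_ge0].
    rewrite -subr_ge0; apply: cvg_ge0 (cvgB (nuP (cyl v)) cv) => N.
    by rewrite subr_ge0; exact: empirical_cyl_ge.
  have cv : Q * g + (size v)%:R / N.+1%:R @[N --> U] --> Q * g.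
    rewrite -[X in _ --> X]addr0; apply: cvgD; [exact: cvg_cst|exact: to_ge0].
  rewrite -subr_ge0; apply: cvg_ge0 (cvgB cv (nuP (cyl v))) => N.
  by rewrite subr_ge0; exact: empirical_cyl_le.
have mX : measurable X by exact: closed_measurable.
split.
  (* [mu] is tied to the averages on finitary sets only, so the open complement of [X] is exhausted
     by finitary sets, which the averages do not charge. *)
  have nX0 : mass mu (~` X) = 0.
    have [V [fV ndV XV]] : exists V : nat -> set T, [/\ forall n, finitary n (V n),
        nondecreasing_seq V & ~` X = \bigcup_n V n].
      by apply: open_exhaustion; rewrite openC.
    have mV n : measurable (V n) by exact: finitary_measurable (fV n).
    rewrite XV.
    have cv := mass_bigcup_cvg (m := mu) mV ndV.
    rewrite -(cvg_lim _ cv)//; apply: cvg_lim => //.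
    rewrite (_ : (fun _ => _) = fun=> 0); first exact: cvg_cst.
    apply/funext => n; rewrite (muE _ _ (fV n)); apply: const => N.
    apply: empirical_disjoint; apply/seteqP; split=> // x [Vx Xx].
    by have : (~` X) x by rewrite XV; exists n.
  rewrite massE//; congr (_%:E).
  by have := massC mu mX; rewrite nX0 => /eqP; rewrite eq_sym subr_eq0 => /eqP <-.
have inv n E : finitary n E -> mass mu (@left_shift k @^-1` E) = mass mu E.
  move=> fE; rewrite (muE _ _ (finitary_shift fE)) (muE _ _ fE).
  have cv : empirical N (@left_shift k @^-1` E) - empirical N E @[N --> U] -->
      nu (@left_shift k @^-1` E) - nu E by apply: cvgB; exact: nuP.
  apply/eqP; rewrite -subr_eq0 -(cvg_lim _ cv)//; apply/eqP; apply: cvg_lim => //.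
  have h : N.+1%:R^-1 @[N --> U] --> (0 : R) by move=> V /(@cvg_harmonic R); exact: oU.
  apply: norm_cvg0; apply: (squeeze_cvgr _ (@cvg_cst _ 0 _ U _) h).
  by apply: nearW => N; rewrite normr_ge0 empirical_shift.
move=> E mE; have mE' : measurable (@left_shift k @^-1` E).
  exact: (measurable_preimage_shift 1).
rewrite !massE//; congr (_%:E).
(* Invariance on finitary sets extends to Borel sets by comparing [mu] with its image under the
   shift on cylinders. *)
pose mu' : probability T R := distribution mu (@left_shift k).
have mu'E F : mass mu' F = mass mu (@left_shift k @^-1` F) by [].
rewrite -mu'E; apply: eq_mass_cylinders mE => w.
by rewrite mu'E; exact: inv (@finitary_cyl _ w).
Qed.

End Gibbs_construction.

(** * Uniqueness of invariant measures dominated by a Gibbs measure *)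

Section Domination.
Context d (T : measurableType d) (R : realType).
Variables mu nu : probability T R.

(* B = {dnu/dmu > 1}; a general Hahn set of nu - mu would lack the last clause. *)
Lemma strict_hahn_decomposition :
  (forall E, measurable E -> mass mu E = 0 -> mass nu E = 0) ->
  exists B, [/\ measurable B,
    forall E, measurable E -> E `<=` B -> mass mu E <= mass nu E,
    forall E, measurable E -> E `<=` ~` B -> mass nu E <= mass mu E &
    forall E, measurable E -> E `<=` B -> mass nu E <= mass mu E ->
      mass mu E = 0].
Proof.
move=> dom; have numu : nu `<< mu.
  apply/null_content_dominatesP => E mE muE; rewrite massE// dom// /mass.
  by rewrite muE.
pose f := Radon_Nikodym_SigmaFinite.f nu mu.
have f0 x : (0 <= f x)%E by exact: Radon_Nikodym_SigmaFinite.f_ge0.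
have fI E : measurable E -> nu E = (\int[mu]_(x in E) f x)%E.
  by move=> mE; exact: Radon_Nikodym_SigmaFinite.f_integral.
have fint := Radon_Nikodym_SigmaFinite.f_integrable numu.
have mf : measurable_fun setT f by exact: measurable_int fint.
have mf' E : measurable_fun E f by exact: measurable_funTS.
have one E : measurable E -> mu E = (\int[mu]_(x in E) (cst 1 x))%E.
  by move=> mE; rewrite integral_cst// mul1e.
exists (f @^-1` `]1%E, +oo[%classic); split.
- by rewrite -[X in measurable X]setTI; apply: mf => //; exact: emeasurable_itv.
- move=> E mE EB; rewrite -lee_fin -!massE// fI// one//.
  apply: ge0_le_integral => //.
  by move=> x /EB /=; rewrite in_itv /= andbT => /ltW.
- move=> E mE EB; rewrite -lee_fin -!massE// fI// one//.
  apply: ge0_le_integral => //.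
  by move=> x /EB /=; rewrite in_itv /= andbT => /negP; rewrite -leNgt.
- move=> E mE EB nuE.
  have f1 x : E x -> (1 <= f x)%E by move=> /EB /=; rewrite in_itv /= andbT => /ltW.
  have le1 : mass mu E <= mass nu E.
    rewrite -lee_fin -!massE// fI// one//; exact: ge0_le_integral.
  have fE : mu.-integrable E f by exact: integrableS fint.
  have oE : mu.-integrable E (cst 1%E).
    by apply/integrableP; split=> //=; rewrite (eq_integral (cst 1%E)) ?normr1 //
      -?one ?massE ?ltry// => x _ /=; rewrite normr1.
  (* The integral of [f - 1] over [E] vanishes, so [f = 1] almost everywhere on [E]. As [f > 1] on
     [B], the set [E] is null. *)
  have : (\int[mu]_(x in E) `|f x - 1| = 0)%E.
    rewrite (eq_integral (fun x => f x - 1)%E) => [|x]; last first.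
      by rewrite inE => /f1 fx; rewrite gee0_abs// sube_ge0// f1.
    rewrite integralB// -fI// -one// !massE// -EFinB; congr (_%:E).
    by apply/eqP; rewrite subr_eq0 eq_le nuE le1.
  move/ae_eq_integral_abs => /(_ mE) [].
    by apply: emeasurable_funB.
  move=> N [mN N0 EN]; apply/eqP; rewrite eq_le mass_ge0 andbT.
  have -> : 0 = mass mu N by rewrite /mass N0.
  apply: le_mass => // x Ex; apply: EN => /= /(_ Ex).
  have := EB _ Ex; rewrite /= in_itv /= andbT => fx h.
  by move: fx; rewrite -sube_gt0 h ltxx.
Qed.

End Domination.

(** * Ergodicity from the gluing inequality *)

Section Mixing.
Variables (R : realType) (k : nat).
Local Notation T := (full_shift k).
Local Notation A := 'I_k.+1.
Variables (mu nu : probability T R) (phi : seq A -> R) (K D : R) (p : nat).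
Hypothesis phiP : specified_weight phi K p.
Local Notation Z n := (word_sum n phi).
Hypothesis D_gt0 : 0 < D.
Hypothesis mu_gibbs : forall v, D^-1 * (phi v / Z (size v)) <= mass mu (cyl v) <=
  D * (phi v / Z (size v)).
Hypothesis mu_inv : forall E : set T, measurable E ->
  mass mu (@left_shift k @^-1` E) = mass mu E.
Hypothesis nu_inv : forall E : set T, measurable E ->
  mass nu (@left_shift k @^-1` E) = mass nu E.

(** Two factors [D] pass from the masses of [u] and [v] to their weights, the third returns from the
    weight of the glued word to its mass. *)
Definition mixing_const : R := D ^+ 3 * (K ^+ 3 * gap_bound phi p).
Local Notation M := mixing_const.

Let mass_inv_shift n (E : set T) : measurable E -> mass mu (shiftn n @^-1` E) = mass mu E.
Proof.
elim: n => [//|n IH] mE; rewrite -IH// -[RHS]mu_inv; last exact: measurable_preimage_shift.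
by congr mass; apply/seteqP; split=> x; rewrite /= /shiftn -iterSr.
Qed.

Let measurable_shift_cyl n (v : seq A) : measurable (shiftn n @^-1` cyl v).
Proof. by apply: measurable_preimage_shift; exact: cyl_measurable. Qed.

Lemma mixing_const_ge0 : 0 <= M.
Proof.
have K0 : 0 <= K by exact: le_trans ler01 (weight_ge1 phiP).
apply: mulr_ge0; first by rewrite exprn_ge0// ltW.
apply: mulr_ge0; first exact: exprn_ge0.
by apply: sumr_ge0 => i _; apply: ltW; exact: (weight_sum_gt0 phiP i).
Qed.

(** Summing over the gap word of length [j] forgets it and leaves the event that [v] is seen at time
    [size u + j]. *)
Lemma mixing_cyl u v : mass mu (cyl u) * mass mu (cyl v) <=
  M * \sum_(j < p.+1) mass mu (cyl u `&` shiftn (size u + j) @^-1` cyl v).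
Proof.
have D0 := ltW D_gt0; have phi0 := weight_ge0 phiP.
have Z0 := weight_sum_gt0 phiP.
have mc := @cyl_measurable k.
have step : mass mu (cyl u) * mass mu (cyl v) <=
    D ^+ 2 * (phi u / Z (size u) * (phi v / Z (size v))).
  rewrite [leRHS](_ : _ = D * (phi u / Z (size u)) * (D * (phi v / Z (size v)))); last by ring.
  apply: ler_pM; [exact: mass_ge0|exact: mass_ge0| |].
    by case/andP: (mu_gibbs u).
  by case/andP: (mu_gibbs v).
apply: le_trans step _; apply: le_trans (ler_wpM2l _ (weight_mixing phiP u v)) _.
  exact: exprn_ge0.
rewrite /M [leRHS](_ : _ = D ^+ 2 * (K ^+ 3 * gap_bound phi p * (D * \sum_(j < p.+1)
   mass mu (cyl u `&` shiftn (size u + j) @^-1` cyl v)))); last by ring.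
apply: ler_wpM2l; first exact: exprn_ge0.
apply: ler_wpM2l.
  have K0 : 0 <= K by exact: le_trans ler01 (weight_ge1 phiP).
  by rewrite mulr_ge0 ?exprn_ge0//; apply: sumr_ge0 => i _; exact: ltW.
rewrite mulr_sumr; apply: ler_sum => j _.
have WE (t : j.-tuple A) :
    (tword j \o shiftn (size u)) @^-1` [set t] = shiftn (size u) @^-1` cyl t.
  by rewrite -tword_preimage.
have mW (t : j.-tuple A) : measurable ((tword j \o shiftn (size u)) @^-1` [set t]).
  by rewrite WE; exact: measurable_shift_cyl.
rewrite (mass_sum mu _ mW); last first.
  by apply: measurableI => //; exact: measurable_shift_cyl.
rewrite mulr_sumr; apply: ler_sum => t _; rewrite -ler_pdivrMl//.
have /andP[h _] := mu_gibbs (u ++ t ++ v); apply: le_trans h _.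
rewrite WE.
apply: le_mass => //.
  apply: measurableI; last exact: measurable_shift_cyl.
  by apply: measurableI => //; exact: measurable_shift_cyl.
move=> x /cyl_cat[ux /cyl_cat[tx vx]]; split=> //; split=> //.
by move: vx; rewrite size_tuple /= shiftD.
Qed.

(** Both sides are additive in [E] and in [F], which reduces the claim to pairs of cylinders of
    lengths [n] and [m]. *)
Lemma mixing_finitary n m (E F : set T) : finitary n E -> finitary m F ->
  mass mu E * mass mu F <=
  M * \sum_(j < p.+1) mass mu (E `&` shiftn (n + j) @^-1` F).
Proof.
move=> fE fF; have mE := finitary_measurable fE; have mF := finitary_measurable fF.
have mc := @cyl_measurable k.
have mt q (t : q.-tuple A) : measurable (@tword k q @^-1` [set t]).
  by rewrite tword_preimage.
have fin q (G : set T) (t : q.-tuple A) : finitary q G ->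
    G `&` cyl t = cyl t \/ G `&` cyl t = set0.
  move=> fG; have [[x [Gx xt]]|nG] := pselect (exists x, G x /\ cyl t x).
    left; apply/seteqP; split=> [y []//|y yt]; split=> //; apply: fG Gx.
    by apply/word_agree; move: xt yt; rewrite /cyl /= size_tuple => -> ->.
  by right; apply/seteqP; split=> // x Gx; apply: nG; exists x.
rewrite (mass_sum mu mE (mt n)) (mass_sum mu mF (mt m)) big_distrlr /= pair_bigA /=.
pose W j (x : T) := (tword n x, tword m (shiftn (n + j) x)).
have WE j q : W j @^-1` [set q] = cyl q.1 `&` shiftn (n + j) @^-1` cyl q.2.
  rewrite -!tword_preimage; apply/seteqP; split=> x /=; first by move=> <-.
  by case: q => a b /= [<- <-].
have mW j q : measurable (W j @^-1` [set q]).
  by rewrite WE; apply: measurableI => //; exact: measurable_shift_cyl.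
have mEF j : measurable (E `&` shiftn (n + j) @^-1` F).
  by apply: measurableI => //; exact: measurable_preimage_shift.
rewrite (eq_bigr (fun j : 'I_p.+1 => \sum_q mass mu
    ((E `&` shiftn (n + j) @^-1` F) `&` W j @^-1` [set q]))); last first.
  by move=> j _; rewrite (mass_sum mu (mEF j) (mW j)).
rewrite exchange_big /= mulr_sumr; apply: ler_sum => -[u v] _ /=.
rewrite !tword_preimage.
have S0 : 0 <= M * \sum_(j < p.+1) mass mu
    ((E `&` shiftn (n + j) @^-1` F) `&` W j @^-1` [set (u, v)]).
  by rewrite mulr_ge0 ?mixing_const_ge0//; apply: sumr_ge0 => j _; exact: mass_ge0.
have [Eu|->] := fin _ _ u fE; last by rewrite mass0 mul0r.
have [Fv|->] := fin _ _ v fF; last by rewrite mass0 mulr0.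
rewrite Eu Fv; apply: le_trans (mixing_cyl u v) _.
apply: ler_wpM2l; first exact: mixing_const_ge0.
apply: ler_sum => j _; apply: le_mass.
- by apply: measurableI => //; exact: measurable_shift_cyl.
- exact: measurableI.
rewrite size_tuple WE /= => x [ux vx]; split=> //.
by move: ux vx; rewrite -Eu -Fv => -[Ex _] [Fx _].
Qed.

(** Ergodicity. If finitary [E] and [F] are close to the complement of [B] and to [B], then every
    [E] met with a preimage of [F] is nearly contained in the complement of [B] met with a preimage
    of [B], a null set. The mixing inequality then makes [mu E * mu F] small. *)
Lemma invariant_mod_null_trivial (B : set T) : measurable B ->
  mass mu (B `\` @left_shift k @^-1` B) = 0 ->
  mass mu (@left_shift k @^-1` B `\` B) = 0 ->
  mass mu B = 0 \/ mass mu (~` B) = 0.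
Proof.
move=> mB B1 B2; have mSB n : measurable (shiftn n @^-1` B).
  exact: measurable_preimage_shift.
have nullS n : mass mu (shiftn n @^-1` B `\` B) = 0.
  elim: n => [|n IH].
    by rewrite (_ : _ `\` _ = set0) ?mass0//; apply/seteqP; split=> // x [].
  apply/eqP; rewrite eq_le mass_ge0 andbT.
  have <- : mass mu (shiftn n @^-1` (@left_shift k @^-1` B `\` B)) +
      mass mu (shiftn n @^-1` B `\` B) = 0.
    rewrite IH mass_inv_shift ?B2 ?addr0//.
    by apply: measurableD => //; exact: (mSB 1).
  have mS1 : measurable (shiftn n @^-1` (@left_shift k @^-1` B `\` B)).
    by apply: measurable_preimage_shift; apply: measurableD => //; exact: (mSB 1).
  apply: le_trans (le_massU _ _ _) => //; last exact: measurableD.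
  apply: le_mass; [exact: measurableD|apply: measurableU => //; exact: measurableD|].
  move=> x [Sx nB]; have [Bx|nBx] := pselect (B (shiftn n x)); first by right.
  by left; split.
have mC : measurable (~` B) by exact: measurableC.
(* The 3 pays for replacing [B] and its complement by [F] and [E] in the product of masses. Each of
   the [p.+1] gap terms is at most [2 * e]: one [e] for [E], one for [F]. *)
have small e : 0 < e -> e <= 1 ->
    mass mu B * mass mu (~` B) <= (3 + M * (p.+1%:R * 2)) * e.
  move=> e0 e1.
  have [n [E [fE BE EB _ _]]] := finitary_approximation2 mu mu mC e0.
  have [m [F [fF BF FB _ _]]] := finitary_approximation2 mu mu mB e0.
  have mE := finitary_measurable fE; have mF := finitary_measurable fF.
  have := mixing_finitary fE fF.
  have le1 : mass mu B <= mass mu F + e.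
    rewrite (mass_splitI mu mB mF); apply: lerD; last exact: ltW.
    by apply: le_mass => //; exact: measurableI.
  have le2 : mass mu (~` B) <= mass mu E + e.
    rewrite (mass_splitI mu mC mE); apply: lerD; last exact: ltW.
    by apply: le_mass => //; exact: measurableI.
  have le3 j : mass mu (E `&` shiftn (n + j) @^-1` F) <= 2 * e.
    have mSF : measurable (shiftn (n + j) @^-1` F) by exact: measurable_preimage_shift.
    have mFB : measurable (shiftn (n + j) @^-1` (F `\` B)).
      by apply: measurable_preimage_shift; exact: measurableD.
    have mEB : measurable (E `\` ~` B) by exact: measurableD.
    have mSBB : measurable (shiftn (n + j) @^-1` B `\` B) by exact: measurableD.
    apply: (@le_trans _ _ (mass mu (E `\` ~` B) +
      (mass mu (shiftn (n + j) @^-1` (F `\` B)) + mass mu (shiftn (n + j) @^-1` B `\` B)))).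
      apply: le_trans (lerD (lexx _) (le_massU _ mFB mSBB)).
      apply: le_trans (le_massU _ mEB _); last exact: measurableU.
      apply: le_mass; [exact: measurableI|by apply: measurableU => //; exact: measurableU|].
      move=> x [Ex Fx]; have [Bx|nBx] := pselect (B x); first by left; split=> // /(_ Bx).
      by right; have [Sx|nSx] := pselect (B (shiftn (n + j) x)); [right|left]; split.
    by rewrite nullS mass_inv_shift ?addr0; [move: EB FB; lra|exact: measurableD].
  have : M * (\sum_(j < p.+1) mass mu (E `&` shiftn (n + j) @^-1` F)) <=
      M * (p.+1%:R * (2 * e)).
    apply: ler_wpM2l; first exact: mixing_const_ge0.
    by rewrite mulr_natl -[X in _ *+ X]card_ord -sumr_const; apply: ler_sum => j _.
  have B01 := mass_le1 mu mB; have C01 := mass_le1 mu mC.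
  have B00 := mass_ge0 mu B; have C00 := mass_ge0 mu (~` B).
  have E0 := mass_ge0 mu E; have F0 := mass_ge0 mu F.
  have E1 := mass_le1 mu mE; have F1 := mass_le1 mu mF.
  have : mass mu B * mass mu (~` B) <= (mass mu F + e) * (mass mu E + e).
    by apply: ler_pM.
  have : e * (mass mu E + mass mu F + e) <= e * 3 by apply: ler_wpM2l; lra.
  move=> h1 h2 h3 h4; apply: le_trans h2 _.
  rewrite [leLHS](_ : _ = mass mu E * mass mu F + e * (mass mu E + mass mu F + e)); last by ring.
  have := lerD (le_trans h4 h3) h1; rewrite mulrDl; lra.
suff : mass mu B * mass mu (~` B) = 0.
  by move/eqP; rewrite mulf_eq0 => /orP[/eqP|/eqP]; [left|right].
apply/eqP; rewrite eq_le mulr_ge0 ?mass_ge0// andbT.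
apply/ler_addgt0Pr => e e0; rewrite add0r.
set c := 3 + M * (p.+1%:R * 2) in small *.
have c0 : 0 < c by rewrite ltr_pwDl// mulr_ge0 ?mixing_const_ge0.
have ec0 : 0 < Num.min 1 (e / c) by rewrite lt_min ltr01 divr_gt0.
apply: le_trans (small _ ec0 _) _; first by rewrite ge_min lexx.
by rewrite mulrC -ler_pdivlMr// ge_min lexx orbT.
Qed.

(** Let [B] be the set where the density exceeds 1. By invariance, what leaves [B] under the shift
    and what enters it have equal mass, for [mu] and for [nu]. The first set lies in [B], the second
    outside, so [nu <= mu] on the first, and strictness makes it null. Hence [B] is trivial by
    ergodicity, one measure dominates the other everywhere, and two such probabilities agree. *)
Lemma invariant_dominated_unique :
  (forall E : set T, measurable E -> mass mu E = 0 -> mass nu E = 0) ->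
  forall E : set T, measurable E -> mass nu E = mass mu E.
Proof.
move=> dom; have [B [mB Bge Ble Bstrict]] := strict_hahn_decomposition dom.
have mSB : measurable (@left_shift k @^-1` B) by exact: (measurable_preimage_shift 1).
have mB1 : measurable (B `\` @left_shift k @^-1` B) by exact: measurableD.
have mB2 : measurable (@left_shift k @^-1` B `\` B) by exact: measurableD.
have sym (m : probability T R) : mass m (@left_shift k @^-1` B) = mass m B ->
    mass m (B `\` @left_shift k @^-1` B) = mass m (@left_shift k @^-1` B `\` B).
  by rewrite (mass_splitI m mSB mB) (mass_splitI m mB mSB) setIC => /addrI ->.
have B1 : mass mu (B `\` @left_shift k @^-1` B) = 0.
  apply: (Bstrict _ mB1); first by move=> x [].
  rewrite (sym nu (nu_inv mB)) (sym mu (mu_inv mB)).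
  by apply: Ble => // x [].
have B2 : mass mu (@left_shift k @^-1` B `\` B) = 0 by rewrite -(sym mu (mu_inv mB)).
have mC : measurable (~` B) by exact: measurableC.
have comp (m1 m2 : probability T R) :
    (forall E : set T, measurable E -> mass m1 E <= mass m2 E) ->
    forall E : set T, measurable E -> mass m1 E = mass m2 E.
  move=> le12 E mE; apply/eqP; rewrite eq_le le12//=.
  by have := le12 _ (measurableC mE); rewrite !massC//; lra.
have split0 (m : probability T R) (N E : set T) : measurable N -> measurable E ->
    mass m N = 0 -> mass m E = mass m (E `\` N).
  move=> mN mE N0; rewrite (mass_splitI m mE mN).
  suff -> : mass m (E `&` N) = 0 by rewrite add0r.
  apply/eqP; rewrite eq_le mass_ge0 andbT -N0.
  by apply: le_mass => //; exact: measurableI.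
have [mu0|mu0] := invariant_mod_null_trivial mB B1 B2.
  apply: comp => E mE.
  rewrite (split0 nu B E mB mE (dom _ mB mu0)) (split0 mu B E mB mE mu0).
  by apply: Ble => [|x []//]; exact: measurableD.
move=> E mE; apply/esym; apply: comp mE => F mF.
rewrite (split0 nu _ F mC mF (dom _ mC mu0)) (split0 mu _ F mC mF mu0).
by apply: Bge => [|x [_ /contrapT]//]; exact: measurableD.
Qed.

End Mixing.

(** * Entropy *)

Section Finite_entropy.
Variable R : realType.

Lemma ln_le_subr1 (x : R) : 0 < x -> ln x <= x - 1.
Proof.
move=> x0; have := @le_ln1Dx R (x - 1).
by rewrite (_ : 1 + (x - 1) = x); [apply; lra|ring].
Qed.

Lemma ln_prod n (a : 'I_n -> R) : (forall i, 0 < a i) ->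
  ln (\prod_(i < n) a i) = \sum_(i < n) ln (a i).
Proof.
move=> a0; elim: n a a0 => [|n IH] a a0; first by rewrite !big_ord0 ln1.
rewrite !big_ord_recr /= lnM ?IH ?posrE//.
by apply: prodr_gt0 => i _.
Qed.

(** With [s] the marginal of [p], the inequality [ln x <= x - 1] bounds [p * ln (Q / s)] by
    [p * Q / s - p], which is at most [Q - p] because [p <= s]. The second index lets the entropy of
    an itinerary be estimated through a word that determines it only up to errors. *)
Lemma gibbs_inequality (I J : finType) (p Q : I -> J -> R) :
  (forall i j, 0 <= p i j) -> (forall i j, 0 <= Q i j) ->
  (forall i j, 0 < p i j -> 0 < Q i j) ->
  \sum_i \sum_j Q i j <= \sum_i \sum_j p i j ->
  - \sum_i (\sum_j p i j) * ln (\sum_j p i j) <=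
  - \sum_i \sum_j p i j * ln (Q i j).
Proof.
move=> p0 Q0 pQ le1; rewrite lerN2 -subr_ge0 -sumrB.
have : 0 <= \sum_i \sum_j p i j - \sum_i \sum_j Q i j by rewrite subr_ge0.
move/le_trans; apply; rewrite -sumrB; apply: ler_sum => i _.
rewrite mulr_suml -!sumrB; apply: ler_sum => j _.
have := p0 i j; rewrite le_eqVlt => /predU1P[<-|pij].
  by rewrite !mul0r subr0 sub0r oppr_le0.
have s0 : p i j <= \sum_j p i j.
  by rewrite (bigD1 j)//= lerDl sumr_ge0.
have s1 : 0 < \sum_j p i j by exact: lt_le_trans s0.
have Qij := pQ _ _ pij.
have := @ln_le_subr1 (Q i j / \sum_j p i j).
rewrite divr_gt0// ln_div ?posrE// => /(_ isT) h.
have h1 : p i j * (ln (Q i j) - ln (\sum_j p i j)) <=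
    p i j * (Q i j / \sum_j p i j) - p i j.
  rewrite [leRHS](_ : _ = p i j * (Q i j / \sum_j p i j - 1)).
    by apply: ler_wpM2l => //; exact: ltW.
  by rewrite mulrBr mulr1.
have h2 : p i j * (Q i j / \sum_j p i j) <= Q i j.
  by rewrite mulrCA ler_piMr// ler_pdivrMr// mul1r.
by move: h1; rewrite mulrBr; lra.
Qed.

Lemma gibbs_inequality1 (I : finType) (p Q : I -> R) :
  (forall i, 0 <= p i) -> (forall i, 0 <= Q i) -> (forall i, 0 < p i -> 0 < Q i) ->
  \sum_i Q i <= \sum_i p i -> - \sum_i p i * ln (p i) <= - \sum_i p i * ln (Q i).
Proof.
move=> p0 Q0 pQ le1.
have one (F : R) : \sum_(j : unit) F = F by rewrite sumr_const card_unit.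
have := @gibbs_inequality _ unit (fun i _ => p i) (fun i _ => Q i).
have E1 (F : I -> R) : \sum_i \sum_(j : unit) F i = \sum_i F i.
  by apply: eq_bigr => i _; exact: one.
have E2 : \sum_i (\sum_(j : unit) p i) * ln (\sum_(j : unit) p i) = \sum_i p i * ln (p i).
  by apply: eq_bigr => i _; rewrite !one.
by rewrite E2 !E1 => h; apply: h => // i _; exact: pQ.
Qed.

Lemma small_entropy_cost (q : nat) (e : R) : 0 < e ->
  exists2 dl : R, 0 < dl < 1 &
    - ln (1 - dl) + dl * - ln (dl / q.+1%:R) <= e.
Proof.
move=> e0; have q0 : 0 < q.+1%:R :> R by rewrite ltr0n.
have c0 : 0 < q.+1%:R + 4 :> R by lra.
(* The square [dl = s * s] absorbs the logarithm: [- ln s <= s^-1 - 1] gives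
   [dl * - ln dl <= 2 * s]. All terms together stay below [s * (q.+1 + 4)]. *)
pose s := Num.min (1 / 2) (e / (q.+1%:R + 4)).
have s0 : 0 < s by rewrite lt_min divr_gt0//= divr_gt0.
have s12 : s <= 1 / 2 by rewrite ge_min lexx.
have se : s * (q.+1%:R + 4) <= e by rewrite -ler_pdivlMr// ge_min lexx orbT.
have ss : s * s <= s * (1 / 2) by rewrite ler_wpM2l// ltW.
exists (s * s); first by apply/andP; split; [exact: mulr_gt0|lra].
have d1 : 0 < 1 - s * s by lra.
have h1 : - ln (1 - s * s) <= 2 * (s * s).
  rewrite -lnV ?posrE//; apply: le_trans (ln_le_subr1 _) _; first by rewrite invr_gt0.
  rewrite lerBlDr -[leLHS]mul1r ler_pdivrMr//.
  have : (s * s) * (s * s) <= (s * s) * (1 / 2) by rewrite ler_wpM2l ?mulr_ge0 ?ltW//; lra.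
  by lra.
have h2 : - ln (s * s / q.+1%:R) <= q.+1%:R + 2 * s^-1.
  rewrite ln_div ?posrE ?mulr_gt0// lnM ?posrE//.
  have := ln_le_subr1 q0; have : - ln s <= s^-1 - 1.
    by rewrite -lnV ?posrE// ln_le_subr1// invr_gt0.
  by lra.
have h3 : s * s * - ln (s * s / q.+1%:R) <= s * s * (q.+1%:R + 2 * s^-1).
  by rewrite ler_wpM2l// mulr_ge0 ?ltW.
have h4 : s * s * (q.+1%:R + 2 * s^-1) = s * s * q.+1%:R + 2 * s.
  by field; rewrite gt_eqF.
have h5 : s * s * q.+1%:R <= s * q.+1%:R.
  by rewrite ler_wpM2r ?ltW//; lra.
have h6 : 0 < s * q.+1%:R by rewrite mulr_gt0.
by move: se; rewrite mulrDr; lra.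
Qed.

(** Total mass of a product law on [J] consecutive blocks; it normalises the comparison law in
    [itinerary_entropy_le]. *)
Lemma word_sum_blocks k (b : seq 'I_k.+1 -> R) n J :
  word_sum (J * n) (fun u => \prod_(j < J) b (take n (drop (j * n) u))) =
  word_sum n b ^+ J.
Proof.
elim: J => [|J IH]; first by rewrite mul0n word_sum0 big_ord0.
rewrite mulSn word_sumD exprS -IH -word_sumZr; apply: eq_word_sum => u un.
rewrite -word_sumZ; apply: eq_word_sum => v _.
rewrite big_ord_recl /= mul0n drop0 take_size_cat//; congr (_ * _).
apply: eq_bigr => j _; rewrite /bump /= add1n mulSn drop_cat un.
by rewrite ltnNge leq_addr /= addKn.
Qed.

End Finite_entropy.

(** * Entropy of itineraries against entropy of words *)

Section Entropy_bound.
Variables (R : realType) (k : nat) (X : set (full_shift k)).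
Local Notation T := (full_shift k).
Local Notation A := 'I_k.+1.
Hypothesis X_measurable : measurable X.
Variable m : probability T R.
Hypothesis m_inv : invariant_measure X m.

Lemma invariant_shift n E : measurable E -> mass m (shiftn n @^-1` E) = mass m E.
Proof.
elim: n => [//|n IH] mE; rewrite -IH//.
have mS : measurable (shiftn n @^-1` E) by exact: measurable_preimage_shift.
rewrite -[RHS]/(fine (m _)) -(m_inv.2 _ mS).
by congr mass; apply/seteqP; split=> x; rewrite /= /shiftn -iterSr.
Qed.

Lemma mean_shift n F : bounded_measurable F -> mean m (F \o shiftn n) = mean m F.
Proof.
move=> bF; apply: mean_pushforward => //; first exact: shift_measurable.
move=> E mE.
by rewrite (massE _ (measurable_preimage_shift n mE)) (massE _ mE) invariant_shift.
Qed.

Lemma mass_setIX E : measurable E -> mass m (E `&` X) = mass m E.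
Proof.
move=> mE; rewrite (mass_splitI m mE X_measurable).
suff -> : mass m (E `\` X) = 0 by rewrite addr0.
have X1 : mass m X = 1 by rewrite /mass m_inv.1.
apply/eqP; rewrite eq_le mass_ge0 andbT.
have <- : mass m (~` X) = 0 by rewrite massC// X1 subrr.
by apply: le_mass; [exact: measurableD|exact: measurableC|move=> x []].
Qed.

Definition word_entropy n : R :=
  - word_sum n (fun w => mass m (cyl w) * ln (mass m (cyl w))).

Lemma word_entropy_ge0 n : 0 <= word_entropy n.
Proof.
rewrite /word_entropy /word_sum -sumrN; apply: sumr_ge0 => w _.
rewrite -mulrN mulr_ge0 ?mass_ge0// oppr_ge0 ln_le0// mass_le1//.
exact: cyl_measurable.
Qed.

Lemma mass_word_sum n : word_sum n (fun w => mass m (cyl w)) = 1.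
Proof.
rewrite -(massT m) (@mass_sum _ _ _ m _ (tword n) setT)//.
  by apply: eq_bigr => t _; rewrite setTI tword_preimage.
by move=> t; rewrite tword_preimage; exact: cyl_measurable.
Qed.

Lemma word_function_bounded n (F : n.-tuple A -> R) : bounded_measurable (F \o tword n).
Proof.
apply: bounded_measurable_fin => t.
by rewrite tword_preimage; exact: cyl_measurable.
Qed.

Lemma mean_word n (F : n.-tuple A -> R) :
  mean m (F \o tword n) = \sum_(t : n.-tuple A) mass m (cyl t) * F t.
Proof.
rewrite mean_fin => [|t]; last by rewrite tword_preimage; exact: cyl_measurable.
by apply: eq_bigr => t _; rewrite tword_preimage.
Qed.

Definition itinerary q (c : T -> 'I_q.+1) L (x : T) : {ffun 'I_L -> 'I_q.+1} :=
  [ffun i : 'I_L => c (shiftn i x)].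

Definition itinerary_entropy q (c : T -> 'I_q.+1) L : R := - \sum_w
  mass m (itinerary c L @^-1` [set w]) * ln (mass m (itinerary c L @^-1` [set w])).

Lemma measurable_itinerary q (c : T -> 'I_q.+1) L w :
  (forall i, measurable (c @^-1` [set i])) ->
  measurable (itinerary c L @^-1` [set w]).
Proof.
move=> mc; rewrite (_ : _ @^-1` _ =
    \bigcap_(i in [set: 'I_L]) (shiftn i @^-1` (c @^-1` [set w i]))).
  apply: fin_bigcap_measurable; first exact: finite_finset.
  by move=> i _; exact: measurable_preimage_shift.
apply/seteqP; split=> x /=; first by move=> <- i _ /=; rewrite ffunE.
by move=> h; apply/ffunP => i; rewrite ffunE; exact: h.
Qed.

Section Coding.
Variables (q : nat) (c c' : T -> 'I_q.+1) (N : nat) (dl : R).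
Hypothesis mc : forall i, measurable (c @^-1` [set i]).
Hypothesis fc' : forall i, finitary N (c' @^-1` [set i]).
Hypothesis dl01 : 0 < dl < 1.
Hypothesis disagree : mass m [set x | c x != c' x] <= dl.

(** Transition weights of a noisy channel. Spreading [dl] over all symbols keeps every entry
    positive, hence its logarithm harmless, and the total over the outputs at most 1. *)
Let kap (i j : 'I_q.+1) : R := if i == j then 1 - dl else dl / q.+1%:R.

Let dl0 : 0 < dl. Proof. by case/andP: dl01. Qed.
Let dl1 : 0 < 1 - dl. Proof. by case/andP: dl01; rewrite subr_gt0. Qed.

Let kap_gt0 i j : 0 < kap i j.
Proof. by rewrite /kap; case: ifP => _ //; rewrite divr_gt0. Qed.

Let kap_sum j : \sum_i kap i j <= 1.
Proof.
rewrite (bigD1 j)//= {1}/kap eqxx.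
apply: (@le_trans _ _ (1 - dl + \sum_(i < q.+1) dl / q.+1%:R)).
  rewrite lerD2l [leRHS](bigD1 j)//= -[leLHS]add0r; apply: lerD; first by rewrite divr_ge0// ltW.
  by apply: ler_sum => i /negbTE ij; rewrite /kap ij.
by rewrite sumr_const card_ord -[X in _ + X]mulr_natr divfK ?pnatr_eq0// subrK.
Qed.

Let mc' i : measurable (c' @^-1` [set i]).
Proof. exact: finitary_measurable (@fc' i). Qed.

(** Bounds the mean of [- ln kap]: the first term is charged at every point, the logarithm of the
    second only where [c] and [c'] disagree, a set of mass at most [dl]. *)
Let cost : R := - ln (1 - dl) + dl * - ln (dl / q.+1%:R).

Let m_disagree : measurable [set x | c x != c' x].
Proof. exact: measurable_neq_fin. Qed.

Let pair_meas (p : 'I_q.+1 * 'I_q.+1) :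
  measurable ((fun x => (c x, c' x)) @^-1` [set p]).
Proof.
rewrite (_ : _ @^-1` _ = c @^-1` [set p.1] `&` c' @^-1` [set p.2]).
  exact: measurableI.
by case: p => i j; apply/seteqP; split=> x /= [-> ->].
Qed.

Let lnkap x := - ln (kap (c x) (c' x)).

Let lnkap_bounded : bounded_measurable lnkap.
Proof.
by have := @bounded_measurable_fin _ _ R _ _ (fun p => - ln (kap p.1 p.2)) pair_meas.
Qed.

Let mean_cost : mean m lnkap <= cost.
Proof.
have l1 : 0 <= - ln (1 - dl) by rewrite oppr_ge0 ln_le0// gerBl ltW.
have dq : dl / q.+1%:R <= 1.
  rewrite ler_pdivrMr// mul1r (le_trans (ltW _) (_ : 1 <= _))//.
    by case/andP: dl01.
  by rewrite ler1n.
have l2 : 0 <= - ln (dl / q.+1%:R) by rewrite oppr_ge0 ln_le0.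
apply: (@le_trans _ _ (mean m (fun x => - ln (1 - dl) +
   - ln (dl / q.+1%:R) * \1_[set x | c x != c' x] x))).
  have bI := bounded_measurable_indic R m_disagree.
  apply: (@le_mean _ _ _ m setT) => //; first exact: probability_setT.
    by apply: bounded_measurableD; [exact: bounded_measurable_cst|exact: bounded_measurableZ].
  move=> x _; rewrite /lnkap /kap indicE; case: ifPn => [/eqP cc|cc].
    by rewrite memNset ?mulr0 ?addr0//= cc eqxx.
  by rewrite mem_set//= mulr1 lerDr.
have bI := bounded_measurable_indic R m_disagree.
rewrite meanD; [|exact: bounded_measurable_cst|exact: bounded_measurableZ].
rewrite mean_cst meanZ// mean_indic// /cost lerD2l mulrC.
by rewrite ler_wpM2r.
Qed.

(** The padding by [ord0] is never seen: [c'] looks at [N] letters, and the code at [i] is used only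
    when [i + N] letters are given. *)
Let ext (u : seq A) : T := fun j => nth ord0 u j.

Let ext_agree n x : agree n x (ext (word n x)).
Proof. by move=> i ni; rewrite /ext /word nth_mkseq. Qed.

Let code i (u : seq A) := c' (shiftn i (ext u)).

Let codeE i n x : (i + N <= n)%N -> code i (word n x) = c' (shiftn i x).
Proof.
move=> iN; apply: (@fc' (c' (shiftn i x)) (shiftn i x)) => // j jN.
by rewrite !shiftE (ext_agree (n := n))// (leq_trans _ iN)// ltn_add2l.
Qed.

(* Gibbs' inequality against Q (w, u) = prod_j m(block j of u) * prod_i kap (w i)
   (code i u): the word u is a sequence of independent blocks, and w is read off
   u through a channel that errs with probability dl. *)
Lemma itinerary_entropy_le n J L : (L + N <= J * n)%N ->
  itinerary_entropy c L <= J%:R * word_entropy n + L%:R * cost.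
Proof.
move=> LNJ; pose b (w : seq A) := mass m (cyl w).
have b0 w : 0 <= b w by exact: mass_ge0.
pose blk (j : nat) (u : seq A) := take n (drop (j * n) u).
pose Q (w : {ffun 'I_L -> 'I_q.+1}) (u : (J * n).-tuple A) : R :=
  (\prod_(j < J) b (blk j u)) * \prod_(i < L) kap (w i) (code i u).
pose W x := (itinerary c L x, tword (J * n) x).
have mit w := measurable_itinerary w mc (L := L).
have WE p : W @^-1` [set p] = itinerary c L @^-1` [set p.1] `&` cyl p.2.
  rewrite -tword_preimage; apply/seteqP; split=> x /=; first by move=> <-.
  by case: p => w u /= [<- <-].
have mcyl := @cyl_measurable k.
have mW p : measurable (W @^-1` [set p]).
  by rewrite WE; apply: measurableI.
pose p w u := mass m (W @^-1` [set (w, u)]).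
have marg w : \sum_u p w u = mass m (itinerary c L @^-1` [set w]).
  rewrite (@mass_sum _ _ _ m _ (tword (J * n)) _ (mit w)).
    by apply: eq_bigr => u _; rewrite /p WE tword_preimage.
  by move=> t; rewrite tword_preimage.
have blkE j x : (j < J)%N -> blk j (word (J * n) x) = word n (shiftn (j * n) x).
  move=> jJ; have -> : (J * n = j * n + (n + (J - j.+1) * n))%N.
    by rewrite -mulSn -mulnDl; congr (_ * _)%N; lia.
  rewrite wordD /blk drop_size_cat ?size_word// wordD take_size_cat ?size_word//.
(* By invariance each block of [u], read at its own position, has at least the mass of the joint
   event. *)
have pQ w u : 0 < p w u -> forall j : 'I_J, 0 < b (blk j u).
  move=> p0 j; apply: lt_le_trans p0 _.
  rewrite /b /p -(invariant_shift (j * n) (mcyl (blk j u))).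
  apply: le_mass => //; first by apply: measurable_preimage_shift; exact: mcyl.
  move=> x; rewrite WE => -[_]; rewrite /cyl /= size_tuple => <-.
  by rewrite blkE// size_word.
have lnQ w u : 0 < p w u -> - ln (Q w u) =
    \sum_(j < J) - ln (b (blk j u)) + \sum_(i < L) - ln (kap (w i) (code i u)).
  move=> /pQ b1; rewrite lnM ?posrE; first by rewrite !ln_prod// opprD !sumrN.
    by apply: prodr_gt0 => j _; exact: b1.
  by apply: prodr_gt0 => i _; exact: kap_gt0.
have Q0 w u : 0 <= Q w u.
  by rewrite mulr_ge0//; apply: prodr_ge0 => i _ //; apply: ltW; exact: kap_gt0.
have sumQ : \sum_w \sum_u Q w u <= \sum_w \sum_u p w u.
  apply: (@le_trans _ _ 1); last first.
    under [leRHS]eq_bigr do rewrite marg.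
    rewrite -(massT m) (@mass_sum _ _ _ m _ (itinerary c L) setT)//.
    by apply: ler_sum => w _; rewrite setTI.
  rewrite exchange_big /=.
  have <- : word_sum (J * n) (fun u => \prod_(j < J) b (take n (drop (j * n) u))) = 1.
    by rewrite word_sum_blocks mass_word_sum expr1n.
  apply: ler_sum => u _; rewrite -mulr_sumr ler_piMr//.
    by apply: prodr_ge0.
  rewrite -(bigA_distr_bigA (fun (i : 'I_L) a => kap a (code i u))).
  rewrite [leRHS](_ : 1 = \prod_(i < L) (1 : R)); last by rewrite big1.
  apply: ler_prod => i _; rewrite kap_sum andbT.
  by apply: sumr_ge0 => a _; apply: ltW; exact: kap_gt0.
have := gibbs_inequality (p := p) (Q := Q) _ Q0 _ sumQ.
have Qpos w u : 0 < p w u -> 0 < Q w u.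
  move=> /pQ b1; rewrite mulr_gt0//.
    by apply: prodr_gt0 => j _; exact: b1.
  by apply: prodr_gt0 => i _; exact: kap_gt0.
move=> /(_ (fun _ _ => mass_ge0 _ _) Qpos) h.
rewrite /itinerary_entropy; under eq_bigr do rewrite -marg.
apply: le_trans h _.
pose S (r : {ffun 'I_L -> 'I_q.+1} * (J * n).-tuple A) : R :=
  \sum_(j < J) - ln (b (blk j r.2)) + \sum_(i < L) - ln (kap (r.1 i) (code i r.2)).
(* As an integral, the cross entropy is a sum of shifted copies of [G] and [lnkap], and invariance
   removes the shifts. *)
have -> : - (\sum_w \sum_u p w u * ln (Q w u)) = mean m (S \o W).
  rewrite mean_fin// pair_bigA -sumrN; apply: eq_bigr => -[w u] _ /=.
  rewrite -mulrN -/(p w u); have := mass_ge0 m (W @^-1` [set (w, u)]).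
  rewrite -/(p w u) le_eqVlt => /predU1P[<-|p0]; first by rewrite !mul0r.
  by rewrite lnQ.
pose G x := - ln (b (word n x)).
have bG : bounded_measurable G.
  exact: (@word_function_bounded n (fun t => - ln (b t))).
have meanG : mean m G = word_entropy n.
  rewrite /word_entropy /word_sum -sumrN.
  have -> : G = (fun t : n.-tuple A => - ln (b t)) \o tword n by [].
  by rewrite mean_word; apply: eq_bigr => t _; rewrite mulrN.
have bshift j F : bounded_measurable F -> bounded_measurable (F \o shiftn j : T -> R).
  by move=> bF; apply: bounded_measurable_comp => //; exact: shift_measurable.
have -> : S \o W = fun x => \sum_(j < J) (G \o shiftn (j * n)) x +
    \sum_(i < L) (lnkap \o shiftn i) x.
  apply/funext => x; rewrite /S /=; congr (_ + _); apply: eq_bigr => i _.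
    by rewrite blkE.
  by rewrite ffunE codeE// (leq_trans _ LNJ)// leq_add2r ltnW.
rewrite meanD; [|exact: bounded_measurable_sum (fun j => bshift _ _ bG)
                |exact: bounded_measurable_sum (fun j => bshift _ _ lnkap_bounded)].
rewrite !mean_sum; [|by move=> i; exact: bshift|by move=> i; exact: bshift].
apply: lerD.
  rewrite mulr_natl -[X in _ *+ X](card_ord J) -sumr_const; apply: ler_sum => j _.
  by rewrite mean_shift// meanG.
rewrite mulr_natl -[X in _ *+ X](card_ord L) -sumr_const; apply: ler_sum => j _.
by rewrite mean_shift.
Qed.

End Coding.
End Entropy_bound.

(** * Entropy of finite partitions *)

Section Partition_entropy.
Variables (R : realType) (k : nat) (X : set (full_shift k)).
Local Notation T := (full_shift k).
Local Notation A := 'I_k.+1.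
Hypothesis X_measurable : measurable X.
Hypothesis X_shift : forall x, X x -> X (left_shift x).
Variable m : probability T R.
Hypothesis m_inv : invariant_measure X m.

(** Each atom is approximated by a finitary set, and [c'] picks an index whose set contains the
    point. Where [c] and [c'] differ, the point lies in one of the [q.+1] symmetric differences,
    each of mass below [2 * e]. *)
Lemma finitary_coding q (c : T -> 'I_q.+1) (dl : R) : 0 < dl ->
  (forall i, measurable (c @^-1` [set i])) ->
  exists N (c' : T -> 'I_q.+1), (forall i, finitary N (c' @^-1` [set i])) /\
    mass m [set x | c x != c' x] <= dl.
Proof.
move=> dl0 mc; pose e := dl / (q.+1%:R * 2).
have e0 : 0 < e by rewrite divr_gt0// mulr_gt0.
have approx i : exists r : nat * set T, [/\ finitary r.1 r.2,
    mass m (c @^-1` [set i] `\` r.2) < e & mass m (r.2 `\` c @^-1` [set i]) < e].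
  by have [n [E [fE h1 h2 _ _]]] := finitary_approximation2 m m (mc i) e0; exists (n, E).
have [f fP] := fin_all_exists approx.
have mE i : measurable (f i).2 by have [/finitary_measurable] := fP i.
pose N := (\sum_i (f i).1)%N.
have fN i : finitary N (f i).2.
  by have [fE _ _] := fP i; apply: finitaryW fE; rewrite /N (bigD1 i)//= leq_addr.
pose c' x : 'I_q.+1 := odflt ord0 [pick i | `[< (f i).2 x >]].
have c'E x y : agree N x y -> c' x = c' y.
  move=> xy; congr odflt; apply: eq_pick => i /=.
  by apply/asboolP/asboolP; apply: fN => // j jN; rewrite xy.
exists N, c'; split; first by move=> i x y /c'E /= ->.
pose D i := (c @^-1` [set i] `\` (f i).2) `|` ((f i).2 `\` c @^-1` [set i]).
have mD i : measurable (D i) by apply: measurableU; exact: measurableD.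
have sub : [set x | c x != c' x] `<=` \big[setU/set0]_i D i.
  move=> x /= cx; rewrite -bigcup_seq.
  have [Ex|nEx] := pselect ((f (c x)).2 x); last first.
    by exists (c x); rewrite /= ?mem_index_enum//; left.
  exists (c' x); rewrite /= ?mem_index_enum//; right; split; last first.
    by move=> /= cc; rewrite cc eqxx in cx.
  rewrite /c'; case: pickP => [i /asboolP//|/(_ (c x))/asboolP//].
have mDU : measurable (\big[setU/set0]_i D i) by exact: bigsetU_measurable.
have le_big (s : seq 'I_q.+1) : mass m (\big[setU/set0]_(i <- s) D i) <=
    \sum_(i <- s) (e + e).
  elim: s => [|i s IH]; first by rewrite !big_nil mass0.
  rewrite !big_cons; apply: le_trans (le_massU _ _ _) _ => //.
    exact: bigsetU_measurable.
  apply: lerD IH; apply: le_trans (le_massU _ _ _) _; [exact: measurableD..|].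
  by have [_ h1 h2] := fP i; rewrite lerD// ltW.
have mdis : measurable [set x | c x != c' x].
  apply: measurable_neq_fin => // i; apply: (@finitary_measurable _ N).
  by move=> x y /c'E /= ->.
apply: le_trans (le_mass _ mdis mDU sub) _; apply: le_trans (le_big _) _.
rewrite sumr_const card_ord -[leLHS]mulr_natr /e.
have : q.+1%:R != 0 :> R by rewrite pnatr_eq0.
by move: (q.+1%:R : R) => Q Q0; rewrite [leLHS](_ : _ = dl)//; field.
Qed.

Lemma cvg_const_div_succ (a : R) : a / n.+1%:R @[n --> \oo] --> 0.
Proof.
rewrite -[X in _ --> X](mulr0 a); apply: cvgMr; exact: cvg_harmonic.
Qed.

(** The block length [n] stays fixed while [L] grows. The order of choices is [dl] from [e], then
    [N] from [dl], then [L] to infinity, so that [N] costs nothing in the limit. *)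
Lemma itinerary_entropy_limit q (c : T -> 'I_q.+1) n l : (0 < n)%N ->
  (forall i, measurable (c @^-1` [set i])) ->
  itinerary_entropy m c L / L%:R @[L --> \oo] --> l -> l <= word_entropy m n / n%:R.
Proof.
move=> n0 mc cv; have n0R : 0 < n%:R :> R by rewrite ltr0n.
apply/ler_addgt0Pr => e e0.
have [dl dl01 le_e] := small_entropy_cost q e0.
have [N [c' [fc' dis]]] := finitary_coding (proj1 (andP dl01)) mc.
set h := word_entropy m n.
have cvS : itinerary_entropy m c L.+1 / L.+1%:R @[L --> \oo] --> l.
  by have := cv; rewrite -cvg_shiftS.
have cv2 : (h / n%:R + e) + (h / n%:R * (N + n)%:R) / L.+1%:R @[L --> \oo] -->
   h / n%:R + e.
  rewrite -[X in _ --> X]addr0; apply: cvgD; first exact: cvg_cst.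
  exact: cvg_const_div_succ.
rewrite -subr_ge0; apply: cvg_ge0 (cvgB cv2 cvS) => L.
rewrite subr_ge0 ler_pdivrMr//.
(* Enough blocks to cover [L.+1 + N] letters, with an excess of at most [n]. *)
pose J := ((L.+1 + N) %/ n).+1.
have LNJ : (L.+1 + N <= J * n)%N by rewrite ltnW// ltn_ceil.
apply: le_trans (itinerary_entropy_le m_inv mc fc' dl01 dis LNJ) _.
have h0 : 0 <= h by exact: word_entropy_ge0.
have JnR : J%:R * n%:R <= (L.+1 + N + n)%:R :> R.
  by rewrite -natrM ler_nat mulSn addnC leq_add2r leq_trunc_div.
have h1 : J%:R * h <= (L.+1 + N + n)%:R * (h / n%:R).
  rewrite mulrA ler_pdivlMr// mulrAC; exact: ler_wpM2r.
have h2 : L.+1%:R * (- ln (1 - dl) + dl * - ln (dl / q.+1%:R)) <= L.+1%:R * e.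
  exact: ler_wpM2l.
apply: le_trans (lerD h1 h2) _.
rewrite -addnA natrD !mulrDl divfK ?pnatr_eq0//.
by rewrite [leLHS](_ : _ = h / n%:R * L.+1%:R + e * L.+1%:R + h / n%:R * (N + n)%:R)//; ring.
Qed.

Lemma partition_entropy_le n q (xi : 'I_q -> set T) : (0 < n)%N ->
  finite_partition X xi -> partition_entropy m xi <= word_entropy m n / n%:R.
Proof.
move=> n0 [mxi txi Uxi].
case: q xi mxi txi Uxi => [|q] xi mxi txi Uxi.
  have := m_inv.1; rewrite -Uxi (_ : \bigcup_i _ = set0) ?measure0.
    by move=> /eqP; rewrite eq_sym onee_eq0.
  by apply/seteqP; split=> // x [[]].
(* The atoms cover only [X]. Points outside get the default [ord0], which changes no mass since [m]
   is carried by [X]. *)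
pose c x : 'I_q.+1 := odflt ord0 [pick i | `[< xi i x >]].
have cX x : X x -> forall i, xi i x <-> c x = i.
  rewrite -Uxi => -[i _ xix] j; rewrite /c.
  case: pickP => [i' /asboolP xi'x|/(_ i)/asboolP//].
  have E a b : xi a x -> xi b x -> a = b.
    move=> xa xb; apply/eqP/negP => /negP ab.
    have /trivIsetP/(_ a b Logic.I Logic.I ab)/seteqP[/(_ x) + _] := txi.
    by apply.
  by split=> [xj|/= <-//]; exact: E.
have mc i : measurable (c @^-1` [set i]).
  have -> : c @^-1` [set i] = xi i `|` (if i == ord0 then ~` X else set0).
    apply/seteqP; split=> x /=.
      move=> ci; have [Xx|nXx] := pselect (X x); first by left; apply/(cX x Xx).
      right; suff -> : i = ord0 by rewrite eqxx.
      rewrite -ci /c; case: pickP => [j /asboolP xj|//].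
      by case: nXx; rewrite -Uxi; exists j.
    move=> [xix|]; first by apply/(cX x) => //; rewrite -Uxi; exists i.
    case: ifPn => [/eqP -> nXx|//]; rewrite /c; case: pickP => [j /asboolP xj|//].
    by case: nXx; rewrite -Uxi; exists j.
  apply: measurableU => //; case: ifP => _ //; exact: measurableC.
have joinE n' : join_entropy m xi n' = itinerary_entropy m c n'.
  congr (- _); apply: eq_bigr => w _.
  suff -> : fine (m (join_atom xi w)) = mass m (itinerary c n' @^-1` [set w]) by [].
  have mj : measurable (join_atom xi w).
    rewrite (_ : join_atom _ _ = \bigcap_(i in [set: 'I_n']) (shiftn i @^-1` xi (w i))).
      apply: fin_bigcap_measurable; first exact: finite_finset.
      by move=> i _; exact: measurable_preimage_shift.
    by apply/seteqP; split=> x h i; [move=> _; exact: h|exact: h].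
  have mi := measurable_itinerary w mc (L := n').
  rewrite -[LHS]/(mass m _) -(mass_setIX X_measurable m_inv mj).
  rewrite -[RHS](mass_setIX X_measurable m_inv mi); congr mass.
  have Xs i x : X x -> X (shiftn i x) by move=> Xx; elim: i => //= i; exact: X_shift.
  apply/seteqP; split=> x [/= h Xx]; split=> //.
    by apply/ffunP => i; rewrite ffunE; apply/(cX _ (Xs i _ Xx)); exact: h.
  by move=> i; apply/(cX _ (Xs i _ Xx)); rewrite -h ffunE.
rewrite /partition_entropy.
(* A divergent sequence has limn = 0, so subadditivity is never needed. *)
have [cv|ncv] := pselect (cvgn (fun n => join_entropy m xi n / n%:R)); last first.
  rewrite (dvgP ncv) [leLHS](_ : _ = 0)// divr_ge0//.
  exact: word_entropy_ge0.
apply: (itinerary_entropy_limit n0 mc).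
rewrite (_ : (fun L => _) = fun n => join_entropy m xi n / n%:R)//.
by apply/funext => L; rewrite joinE.
Qed.

(** The partition by the first letter has the cylinders, cut down to [X], as its joins. It attains
    the entropy of a Gibbs measure and so supplies the lower bound in [entropy_gibbs]. *)
Lemma cylinder_partition : exists q (xi : 'I_q -> set T),
  finite_partition X xi /\ forall n, join_entropy m xi n = word_entropy m n.
Proof.
pose xi (a : A) : set T := X `&` cyl [:: a].
exists k.+1, xi; split.
  split.
  - by move=> i; apply: measurableI => //; exact: cyl_measurable.
  - apply/trivIsetP => i j _ _ /eqP ij; apply/seteqP; split=> // x [[_ xi'] [_ xj]].
    by apply: ij; move: xi' xj; rewrite /cyl /= => -[<-] [<-].
  - apply/seteqP; split=> [x [i _ []]//|x Xx]; exists (x 0%N) => //; split=> //.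
move=> n; rewrite /join_entropy /word_entropy; congr (- _).
rewrite /word_sum (reindex (fun t : n.-tuple A => [ffun i => tnth t i])) /=; last first.
  exists (fun f => [tuple f i | i < n]) => t _.
    by apply: eq_from_tnth => i; rewrite tnth_mktuple ffunE.
  by apply/ffunP => i; rewrite ffunE tnth_mktuple.
apply: eq_bigr => t _; set J := join_atom _ _.
suff -> : fine (m J) = mass m (cyl t) by [].
have JE : J = [set x | forall i : 'I_n, xi (tnth t i) (shiftn i x)].
  by apply/seteqP; split=> x h i; have := h i; rewrite ffunE.
have mJ : measurable J.
  rewrite JE (_ : [set _ | _] = \bigcap_(i in [set: 'I_n]) (shiftn i @^-1` xi (tnth t i))).
    apply: fin_bigcap_measurable; first exact: finite_finset.
    move=> i _; apply: measurable_preimage_shift; apply: measurableI => //.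
    exact: cyl_measurable.
  by apply/seteqP; split=> x h i; [move=> _; exact: h|exact: h].
rewrite -[LHS]/(mass m _) -(mass_setIX X_measurable m_inv mJ).
rewrite -[RHS](mass_setIX X_measurable m_inv (cyl_measurable t)); congr mass.
have Xs i x : X x -> X (shiftn i x) by move=> Xx; elim: i => //= i; exact: X_shift.
have tE x : cyl t x <-> forall i : 'I_n, x i = tnth t i :> A.
  rewrite /cyl /= size_tuple; split=> [xt i|h].
    by rewrite (tnth_nth ord0) -xt nth_mkseq.
  apply: (@eq_from_nth _ ord0); rewrite ?size_word ?size_tuple// => i ni.
  by rewrite nth_mkseq// (h (Ordinal ni)) (tnth_nth ord0).
rewrite JE; apply/seteqP; split=> x [/= h Xx]; split=> //.
  apply/tE => i; have [_] := h i; rewrite /cyl /= /word /= => -[<-].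
  by rewrite shiftE addn0.
move=> i; split; first exact: Xs.
by rewrite /cyl /= /word /mkseq /= shiftE addn0 ((tE x).1 h).
Qed.

End Partition_entropy.

(** * Variational principle for a measure with the Gibbs property *)

Section Gibbs_equilibrium.
Variables (R : realType) (k : nat) (X : set (full_shift k)).
Local Notation T := (full_shift k).
Local Notation A := 'I_k.+1.
Hypothesis X_measurable : measurable X.
Hypothesis X_shift : forall x, X x -> X (left_shift x).
Variables (g : T -> R) (P c : R) (mu : probability T R).
Hypothesis g_bounded : bounded_measurable g.
Hypothesis mu_inv : invariant_measure X mu.
Hypothesis mu_gibbs : forall n x, (0 < n)%N -> X x ->
  0 < mass mu (cyl (word n x)) /\
  `|ln (mass mu (cyl (word n x))) - (birkhoff n g x - n%:R * P)| <= c.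
Implicit Types m nu : probability T R.

Let charged m w : invariant_measure X m -> 0 < mass m (cyl w) ->
  exists2 x, X x & cyl w x.
Proof.
move=> m_inv mw; apply/not_exists2P => h.
have : cyl w `&` X = set0.
  by apply/seteqP; split=> // x [wx Xx]; have [] := h x.
move=> h0; move: mw.
by rewrite -(mass_setIX X_measurable m_inv (cyl_measurable w)) h0 mass0 ltxx.
Qed.

Let gibbs_pos m w : (0 < size w)%N -> invariant_measure X m ->
  0 < mass m (cyl w) -> 0 < mass mu (cyl w).
Proof.
move=> w0 m_inv /(charged m_inv)[x Xx wx].
by have [+ _] := mu_gibbs w0 Xx; rewrite wx.
Qed.

Lemma birkhoff_bounded n : bounded_measurable (birkhoff n g).
Proof.
rewrite (_ : birkhoff n g = fun x => \sum_(i < n) (g \o shiftn i) x)//.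
have bg (i : 'I_n) : bounded_measurable (g \o shiftn i).
  by apply: bounded_measurable_comp => //; exact: shift_measurable.
exact: (bounded_measurable_sum (index_enum _) bg).
Qed.

Lemma mean_birkhoff m n : invariant_measure X m ->
  mean m (birkhoff n g) = n%:R * mean m g.
Proof.
move=> m_inv.
rewrite (_ : birkhoff n g = fun x => \sum_(i < n) (g \o shiftn i) x)//.
have bg (i : 'I_n) : bounded_measurable (g \o shiftn i).
  by apply: bounded_measurable_comp => //; exact: shift_measurable.
rewrite (mean_sum _ _ bg).
rewrite mulr_natl -[X in _ *+ X](card_ord n) -sumr_const.
by apply: eq_bigr => i _; rewrite (mean_shift m_inv).
Qed.

(** The Gibbs estimate is integrated against [m]. The Birkhoff sum contributes exactly [n] times the
    mean of [g], so the error is [c] for every [n]. *)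
Lemma cross_entropy_bound m n : invariant_measure X m -> (0 < n)%N ->
  `|word_sum n (fun w => mass m (cyl w) * ln (mass mu (cyl w))) -
    n%:R * (mean m g - P)| <= c.
Proof.
move=> m_inv n0.
pose G x := ln (mass mu (cyl (word n x))).
have bG : bounded_measurable G.
  exact: (@word_function_bounded R k n (fun t => ln (mass mu (cyl t)))).
have -> : word_sum n (fun w => mass m (cyl w) * ln (mass mu (cyl w))) = mean m G.
  have -> : G = (fun t : n.-tuple A => ln (mass mu (cyl t))) \o tword n by [].
  by rewrite mean_word.
have bS := birkhoff_bounded n.
have bH : bounded_measurable (fun x => birkhoff n g x - n%:R * P).
  by apply: bounded_measurableB => //; exact: bounded_measurable_cst.
have -> : n%:R * (mean m g - P) = mean m (fun x => birkhoff n g x - n%:R * P).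
  by rewrite meanB ?mean_cst ?mean_birkhoff ?mulrBr//; exact: bounded_measurable_cst.
have X1 := m_inv.1.
have bc e := bounded_measurable_cst T (e : R).
rewrite ler_norml; apply/andP; split.
  rewrite lerBrDr addrC -(mean_cst m c) -meanB//.
  apply: (le_mean X_measurable X1) => //; first exact: bounded_measurableB.
  by move=> x Xx; have [_] := mu_gibbs n0 Xx; rewrite -/(G x) ler_norml; lra.
rewrite lerBlDr -(mean_cst m c) -meanD//.
apply: (le_mean X_measurable X1) => //; first exact: bounded_measurableD.
by move=> x Xx; have [_] := mu_gibbs n0 Xx; rewrite -/(G x) ler_norml; lra.
Qed.

Lemma word_entropy_cross m n (b : seq A -> R) : invariant_measure X m ->
  (forall w, size w = n -> 0 <= b w) ->
  (forall w, size w = n -> 0 < mass m (cyl w) -> 0 < b w) ->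
  word_sum n b <= 1 ->
  word_entropy m n <= - word_sum n (fun w => mass m (cyl w) * ln (b w)).
Proof.
move=> m_inv b0 mb b1.
rewrite /word_entropy /word_sum.
apply: (gibbs_inequality1 (p := fun t : n.-tuple A => mass m (cyl t))
  (Q := fun t : n.-tuple A => b t)).
- by move=> t; exact: mass_ge0.
- by move=> t; apply: b0; rewrite size_tuple.
- by move=> t; apply: mb; rewrite size_tuple.
- by have := mass_word_sum m n; rewrite /word_sum => ->.
Qed.

Lemma word_entropy_upper m n : invariant_measure X m -> (0 < n)%N ->
  word_entropy m n <= n%:R * (P - mean m g) + c.
Proof.
move=> m_inv n0; have := cross_entropy_bound m_inv n0.
have := @word_entropy_cross m n (fun w => mass mu (cyl w)) m_inv.
have h : word_sum n (fun w => mass mu (cyl w)) <= 1 by rewrite mass_word_sum.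
move=> /(_ _ _ h); rewrite ler_norml mulrBr [in X in _ -> X]mulrBr => h1.
have : word_entropy m n <= - word_sum n (fun w => mass m (cyl w) * ln (mass mu (cyl w))).
  apply: h1 => w wn; first exact: mass_ge0.
  by apply: gibbs_pos => //; rewrite wn.
by lra.
Qed.

Lemma word_entropy_lower n : (0 < n)%N ->
  n%:R * (P - mean mu g) - c <= word_entropy mu n.
Proof.
move=> n0; have := cross_entropy_bound mu_inv n0.
by rewrite /word_entropy ler_norml !mulrBr; lra.
Qed.

Let limit_le (a b d : R) : (forall n, (0 < n)%N -> a <= b + d / n%:R) -> a <= b.
Proof.
move=> h; have cv : b + d / n.+1%:R @[n --> \oo] --> b.
  rewrite -[X in _ --> X]addr0; apply: cvgD; [exact: cvg_cst|exact: cvg_const_div_succ].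
rewrite -subr_ge0; apply: cvg_ge0 (cvgB cv (cvg_cst a)) => n.
by rewrite subr_ge0; exact: h.
Qed.

Lemma entropy_le_word m n : invariant_measure X m -> (0 < n)%N ->
  (entropy X m <= (word_entropy m n / n%:R)%:E)%E.
Proof.
move=> m_inv n0; apply: ge_ereal_sup => _ [q [xi [xiP ->]]].
by rewrite lee_fin; exact: (partition_entropy_le X_measurable X_shift m_inv n0 xiP).
Qed.

Lemma entropy_le m : invariant_measure X m -> (entropy X m <= (P - mean m g)%:E)%E.
Proof.
move=> m_inv; apply: ge_ereal_sup => _ [q [xi [xiP ->]]]; rewrite lee_fin.
apply: (limit_le (d := c)) => n n0.
apply: le_trans (partition_entropy_le X_measurable X_shift m_inv n0 xiP) _.
have n0R : 0 < n%:R :> R by rewrite ltr0n.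
rewrite ler_pdivrMr// mulrDl divfK ?gt_eqF// mulrC.
exact: word_entropy_upper.
Qed.

Lemma entropy_gibbs : entropy X mu = (P - mean mu g)%:E.
Proof.
apply/eqP; rewrite eq_le entropy_le//=.
have [q [xi [xiP joinE]]] := cylinder_partition X_measurable X_shift mu_inv.
apply: (@le_trans _ _ (partition_entropy mu xi)%:E); last first.
  by apply: ereal_sup_ubound; exists q, xi.
rewrite lee_fin /partition_entropy.
suff cv : join_entropy mu xi n / n%:R @[n --> \oo] --> P - mean mu g.
  by rewrite (cvg_lim _ cv).
rewrite -cvg_shiftS /=.
have cv1 : (P - mean mu g) + (- c) / n.+1%:R @[n --> \oo] --> P - mean mu g.
  rewrite -[X in _ --> X]addr0; apply: cvgD; [exact: cvg_cst|exact: cvg_const_div_succ].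
have cv2 : (P - mean mu g) + c / n.+1%:R @[n --> \oo] --> P - mean mu g.
  rewrite -[X in _ --> X]addr0; apply: cvgD; [exact: cvg_cst|exact: cvg_const_div_succ].
apply: squeeze_cvgr cv1 cv2; apply: nearW => n; rewrite joinE.
have := word_entropy_lower (ltn0Sn n); have := word_entropy_upper mu_inv (ltn0Sn n).
rewrite ler_pdivlMr// ler_pdivrMr// ![(_ + _ / _) * _]mulrDl !divfK ?pnatr_eq0//.
by move=> h1 h2; apply/andP; split; lra.
Qed.

(* Donsker-Varadhan inequality for the function t * 1_E. *)
Lemma relative_entropy_set nu n E (t : R) : invariant_measure X nu -> (0 < n)%N ->
  ((P - mean nu g)%:E <= entropy X nu)%E -> finitary n E ->
  0 < t -> expR t * mass mu E <= 1 -> t * mass nu E <= c + ln 2.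
Proof.
move=> nu_inv n0 nu_eq fE t0 muE.
have n0R : 0 < n%:R :> R by rewrite ltr0n.
have mE := finitary_measurable fE.
(* Entropy lies below [word_entropy nu n / n] for every [n], which turns maximality, a statement
   about limits, into a bound at each finite length. *)
have Hn : n%:R * (P - mean nu g) <= word_entropy nu n.
  have := le_trans nu_eq (entropy_le_word nu_inv n0).
  by rewrite lee_fin ler_pdivlMr// mulrC.
pose inE (w : seq A) := `[< cyl w `<=` E >].
have inP w : size w = n -> inE w = false -> E `&` cyl w = set0.
  move=> wn /asboolP nE; apply/seteqP; split=> // x [Ex wx]; apply: nE => y wy.
  apply: fE Ex; apply/word_agree; rewrite -wn; move: wx wy; rewrite /cyl /=.
  by move=> -> ->.
have sumE m : mass m E = word_sum n (fun w => mass m (cyl w) * (inE w)%:R).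
  rewrite (@mass_sum _ _ _ m _ (tword n) E)//; last first.
    by move=> w; rewrite tword_preimage; exact: cyl_measurable.
  apply: eq_bigr => w _; rewrite tword_preimage.
  case Ew : (inE w); last by rewrite mulr0 inP ?size_tuple// mass0.
  by rewrite mulr1 setIidr//; exact/asboolP.
(* Since [expR t * mass mu E <= 1], tilting [mu] by [expR t] on [E] at most doubles its total mass.
   Hence the division by 2, the source of [ln 2]. *)
pose b (w : seq A) := mass mu (cyl w) * expR (t * (inE w)%:R) / 2.
have b0 w : 0 <= b w by rewrite /b divr_ge0// mulr_ge0 ?mass_ge0// expR_ge0.
have bpos w : size w = n -> 0 < mass nu (cyl w) -> 0 < b w.
  move=> wn nuw; rewrite /b divr_gt0// mulr_gt0 ?expR_gt0//.
  by apply: gibbs_pos nuw => //; rewrite wn.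
have b1 : word_sum n b <= 1.
  have le w : b w <= (mass mu (cyl w) + expR t * (mass mu (cyl w) * (inE w)%:R)) / 2.
    rewrite /b ler_wpM2r//; case: (inE w).
      by rewrite !mulr1 mulrC lerDr mass_ge0.
    by rewrite !mulr0 expR0 mulr1 addr0.
  apply: le_trans (ler_word_sum (fun w _ => le w)) _.
  rewrite word_sumZr (_ : word_sum n _ = 1 + expR t * mass mu E).
    by move: muE; lra.
  by rewrite sumE -word_sumZ -(mass_word_sum mu n) /word_sum -big_split.
have := word_entropy_cross nu_inv (fun w _ => b0 w) bpos b1.
have -> : word_sum n (fun w => mass nu (cyl w) * ln (b w)) =
   word_sum n (fun w => mass nu (cyl w) * ln (mass mu (cyl w))) + t * mass nu E - ln 2.
  rewrite sumE -word_sumZ -[ln 2]mul1r -[X in _ - X * _](mass_word_sum nu n) -word_sumZr.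
  rewrite /word_sum -big_split -sumrB /=; apply: eq_bigr => w _.
  have := mass_ge0 nu (cyl w); rewrite le_eqVlt => /predU1P[<-|nuw].
    by rewrite !mul0r mulr0 addr0 subr0.
  have muw : 0 < mass mu (cyl w) by apply: gibbs_pos nuw; rewrite ?size_tuple.
  rewrite /b ln_div ?posrE ?mulr_gt0 ?expR_gt0// lnM ?posrE ?expR_gt0// expRK.
  by ring.
have := cross_entropy_bound nu_inv n0; rewrite ler_norml.
by move: Hn; rewrite !mulrBr; lra.
Qed.

(** For [mu]-null [E] choose a finitary [F] within [expR (- n)] of it for both measures. With
    [t = n], [relative_entropy_set] bounds [n * nu F] by [c + ln 2], however many letters [F]
    depends on. The remaining 1 covers [n * nu (E \ F) <= n * expR (- n)]. *)
Lemma equilibrium_dominated nu : invariant_measure X nu ->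
  ((P - mean nu g)%:E <= entropy X nu)%E ->
  forall E : set T, measurable E -> mass mu E = 0 -> mass nu E = 0.
Proof.
move=> nu_inv nu_eq E mE muE; apply/eqP; rewrite eq_le mass_ge0 andbT.
apply: (limit_le (d := c + ln 2 + 1)) => n n0; rewrite add0r.
have n0R : 0 < n%:R :> R by rewrite ltr0n.
pose e : R := expR (- n%:R).
have e0 : 0 < e by exact: expR_gt0.
have [N [F [fF _ FE nuEF _]]] := finitary_approximation2 mu nu mE e0.
(* [relative_entropy_set] asks for a positive number of letters, and [N] may be 0. *)
have fF1 : finitary N.+1 F by exact: finitaryW fF.
have mF := finitary_measurable fF.
have muF : expR n%:R * mass mu F <= 1.
  have ee : expR n%:R * e = 1 by rewrite -expRD subrr expR0.
  rewrite -[leRHS]ee; apply: ler_wpM2l; first exact: expR_ge0.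
  apply: le_trans (ltW FE); rewrite (mass_splitI mu mF mE) gerDr -muE.
  by apply: le_mass => //; exact: measurableI.
have nuF := relative_entropy_set nu_inv (ltn0Sn N) nu_eq fF1 n0R muF.
have ne : n%:R * e <= 1.
  rewrite /e expRN ler_pdivrMr ?expR_gt0// mul1r.
  by apply: le_trans (expR_ge1Dx _); rewrite lerDr.
rewrite ler_pdivlMr// mulrC (mass_splitI nu mE mF) mulrDr; apply: lerD.
  apply: le_trans nuF; apply: ler_wpM2l => //.
  by apply: le_mass => //; exact: measurableI.
by apply: le_trans ne; apply: ler_wpM2l => //; exact: ltW.
Qed.

End Gibbs_equilibrium.

(** * The limit function *)

Lemma cvg_sum_ord (R : realType) n (u : 'I_n -> nat -> R) (l : 'I_n -> R) :
  (forall i, u i @ \oo --> l i) ->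
  \sum_(i < n) u i M @[M --> \oo] --> \sum_(i < n) l i.
Proof.
elim: n u l => [|n IH] u l ul.
  rewrite big_ord0 (_ : (fun _ => _) = fun=> 0); first exact: cvg_cst.
  by apply/funext => M; rewrite big_ord0.
rewrite big_ord_recr (_ : (fun _ => _) = fun M =>
    \sum_(i < n) u (widen_ord (leqnSn n) i) M + u ord_max M).
  by apply: cvgD (ul _); exact: IH.
by apply/funext => M; rewrite big_ord_recr.
Qed.

Lemma cvg_shift2 (U : ptopologicalType) (u : nat -> U) (l : U) :
  u @ \oo --> l -> u n.+2 @[n --> \oo] --> l.
Proof. by move=> ul; rewrite (cvg_shiftS (fun n => u n.+1)) cvg_shiftS. Qed.

Section Limit_function.
Variables (R : realType) (k : nat) (X : set (full_shift k)).
Local Notation T := (full_shift k).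
Variables (f : nat -> T -> R) (C : nat -> R).
Hypothesis X_subshift : subshift X.
Hypothesis f_cont : continuous_sequence X f.
Hypothesis f_lim : forall x, X x -> lower_limit f x = upper_limit f x.
Hypothesis f_waa : forall x n m, X x -> (0 < n)%N -> (0 < m)%N ->
  expR (- C n) * f n x * f m (iter n (@left_shift k) x) <= f (n + m)%N x
    <= expR (C n) * f n x * f m (iter n (@left_shift k) x).

Let X_closed : closed X. Proof. by case: X_subshift. Qed.
Let X_shift : forall x, X x -> X (left_shift x). Proof. by case: X_subshift. Qed.

Lemma subshift_measurable : measurable X.
Proof. exact: closed_measurable. Qed.

Lemma f_gt0 n x : (0 < n)%N -> X x -> 0 < f n x.
Proof. by move=> n0; have [_] := f_cont n0; apply. Qed.

Lemma ln_f_split n m x : X x -> (0 < n)%N -> (0 < m)%N ->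
  `|ln (f (n + m)%N x) - ln (f n x) - ln (f m (shiftn n x))| <= C n.
Proof.
move=> Xx n0 m0; have Xs := shift_X X_shift n Xx.
have fn := f_gt0 n0 Xx; have fm := f_gt0 m0 Xs.
have nm0 : (0 < n + m)%N by rewrite addn_gt0 n0.
have fnm := f_gt0 nm0 Xx.
have pos c : 0 < expR c * f n x * f m (shiftn n x) by rewrite !mulr_gt0// expR_gt0.
have lnE c : ln (expR c * f n x * f m (shiftn n x)) = c + ln (f n x) + ln (f m (shiftn n x)).
  by rewrite !lnM ?posrE ?mulr_gt0 ?expR_gt0// expRK.
have /andP[h1 h2] := f_waa Xx n0 m0.
rewrite -/(shiftn n x) in h1 h2.
have := h1; rewrite -ler_ln ?posrE// lnE => l1.
have := h2; rewrite -ler_ln ?posrE// lnE => l2.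
by rewrite ler_norml; apply/andP; split; lra.
Qed.

Lemma log_ratioE N x : X x -> log_ratio f x N.+2 =
  ln (f N.+2 x) - ln (f N.+1 (left_shift x)).
Proof. by move=> Xx; rewrite /log_ratio ln_div ?posrE ?f_gt0//; exact: X_shift. Qed.

Lemma ln_f1_bounded : exists B, forall x, X x -> `|ln (f 1%N x)| <= B.
Proof.
have cf : {within X, continuous (fun x => ln (f 1%N x))}.
  apply/subspace_continuousP => x Xx.
  have [/subspace_continuousP/(_ x Xx) c1 _] := f_cont (ltn0Sn 0).
  apply: (cvg_comp (f 1%N) (@ln R) c1).
  by apply: continuous_ln; exact: f_gt0.
have cX : compact X.
  apply: (subclosed_compact X_closed (@full_shift_compact k)) => //.
have [M [_ HM]] := compact_bounded (continuous_compact cf cX).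
exists (`|M| + 1) => x Xx; apply: (HM (`|M| + 1)).
  by rewrite ltr_pwDr// ler_norm.
by exists x.
Qed.

(** Splitting off one letter shows that the ratio differs from [ln (f 1 x)] by at most [C 1]. The
    index starts at 2 so that [f 0] never occurs. *)
Lemma log_ratio_bounded : exists B, forall N x, X x -> `|log_ratio f x N.+2| <= B.
Proof.
have [B HB] := ln_f1_bounded; exists (B + C 1%N) => N x Xx.
have := ln_f_split Xx (ltn0Sn 0) (ltn0Sn N); have := HB _ Xx.
by rewrite log_ratioE// !ler_norml add1n /shiftn /=; lra.
Qed.

(** Equality of the lower and upper limits squeezes the sequence in the extended reals;
    [log_ratio_bounded] then excludes an infinite limit. *)
Lemma log_ratio_cvg x : X x -> log_ratio f x @ \oo --> limit_function f x.
Proof.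
move=> Xx; suff [l cv] : exists l : R, log_ratio f x @ \oo --> l.
  by rewrite /limit_function (cvg_lim _ cv).
have [B HB] := log_ratio_bounded.
pose u n := (log_ratio f x n)%:E.
have cu : u @ \oo --> limn_esup u.
  have h2 : esups u @ \oo --> limn_esup u by rewrite limn_esup_lim; exact: is_cvg_esups.
  have h1 : einfs u @ \oo --> limn_esup u.
    rewrite -[limn_esup u]/(upper_limit f x) -f_lim// /lower_limit limn_einf_lim.
    exact: is_cvg_einfs.
  apply: (@squeeze_cvge _ _ _ _ (einfs u) u (esups u)) h1 h2.
  apply: nearW => n; apply/andP; split.
    by apply: ereal_inf_lbound; exists n => /=.
  by apply: ereal_sup_ubound; exists n => /=.
have le1 : (limn_esup u <= B%:E)%E.
  have cu2 : u n.+2 @[n --> \oo] --> limn_esup u by exact: (@cvg_shift2 _ u).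
  rewrite -(cvg_lim _ cu2)//; apply: lime_le; first by apply/cvg_ex; eexists; exact: cu2.
  by apply: nearW => n; rewrite lee_fin; have := HB n x Xx; rewrite ler_norml => /andP[].
have le2 : ((- B)%:E <= limn_esup u)%E.
  have cu2 : u n.+2 @[n --> \oo] --> limn_esup u by exact: (@cvg_shift2 _ u).
  rewrite -(cvg_lim _ cu2)//; apply: lime_ge; first by apply/cvg_ex; eexists; exact: cu2.
  by apply: nearW => n; rewrite lee_fin; have := HB n x Xx; rewrite ler_norml => /andP[].
have fin : limn_esup u \is a fin_num.
  rewrite fin_numE; apply/andP; split; apply/eqP => h.
    by move: le2; rewrite h.
  by move: le1; rewrite h.
by exists (fine (limn_esup u)); apply: (@fine_cvg R nat \oo _ u); rewrite fineK.
Qed.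

Lemma limit_function_bounded : exists B, forall x, X x -> `|limit_function f x| <= B.
Proof.
have [B HB] := log_ratio_bounded; exists B => x Xx.
have cv := log_ratio_cvg Xx.
have cv2 : log_ratio f x n.+2 @[n --> \oo] --> limit_function f x.
  exact: (@cvg_shift2 _ (log_ratio f x)).
have b n : - B <= log_ratio f x n.+2 <= B by rewrite -ler_norml; exact: HB.
rewrite ler_norml; apply/andP; split; rewrite -subr_ge0.
  have cv3 : log_ratio f x n.+2 - - B @[n --> \oo] --> limit_function f x - - B.
    by apply: cvgB cv2 _; exact: cvg_cst.
  by apply: cvg_ge0 cv3 => n; rewrite subr_ge0; case/andP: (b n).
have cv3 : B - log_ratio f x n.+2 @[n --> \oo] --> B - limit_function f x.
  by apply: cvgB _ cv2; exact: cvg_cst.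
by apply: cvg_ge0 cv3 => n; rewrite subr_ge0; case/andP: (b n).
Qed.

Lemma f_measurable n : (0 < n)%N -> measurable_fun X (f n).
Proof.
move=> n0; have [/continuousP cf _] := f_cont n0.
apply: (measurability _ (RGenOpens.measurableE R)).
move=> _ [_ [a [b ->] <-]].
have /cf/open_subspaceP[V oV VX] : open `]a, b[%classic.
  exact: interval_open.
rewrite setIC -VX; apply: measurableI; last exact: subshift_measurable.
exact: open_measurable.
Qed.

Lemma f_shift_measurable n : (0 < n)%N -> measurable_fun X (f n \o @left_shift k).
Proof.
move=> n0; apply: (@measurable_comp _ _ _ _ _ _ X).
- exact: subshift_measurable.
- by move=> _ [x Xx <-]; exact: X_shift.
- exact: f_measurable.
- apply: measurable_funTS; exact: left_shift_measurable.
Qed.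

Lemma limit_function_measurable : measurable_fun X (limit_function f).
Proof.
apply: (@measurable_fun_cvg _ _ _ X
   (fun n x => ln (f n.+2 x) - ln (f n.+1 (left_shift x)))).
  move=> n; apply: measurable_funB.
    apply: measurableT_comp; [exact: measurable_ln|exact: f_measurable].
  exact: (measurableT_comp (@measurable_ln R) (f_shift_measurable (ltn0Sn n))).
move=> x Xx; have cv := cvg_shift2 (log_ratio_cvg Xx).
rewrite (_ : (fun n => log_ratio f x n.+2) =
  fun n => ln (f n.+2 x) - ln (f n.+1 (left_shift x))) in cv => //.
by apply/funext => n; rewrite log_ratioE.
Qed.

(* The sum over i < n of log_ratio f (shiftn i x) (M + n - i).+1 telescopes to
   ln (f (M + n).+1 x) - ln (f M.+1 (shiftn n x)); let M tend to infinity. *)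
Lemma birkhoff_approximation n x : X x -> (0 < n)%N ->
  `|ln (f n x) - birkhoff n (limit_function f) x| <= C n.
Proof.
move=> Xx n0.
have Xs i := shift_X X_shift i Xx.
have tele q y M : X y -> \sum_(i < q) log_ratio f (shiftn i y) (M + (q - i)).+1 =
    ln (f (M + q).+1 y) - ln (f M.+1 (shiftn q y)).
  elim: q y => [|q IH] y Xy; first by rewrite big_ord0 addn0 subrr.
  rewrite big_ord_recl /= subn0 addnS log_ratioE//.
  rewrite (eq_bigr (fun i : 'I_q => log_ratio f (shiftn i (left_shift y)) (M + (q - i)).+1)).
    rewrite (IH _ (X_shift Xy)) [X in _ + (_ - ln (f _ X))](_ : _ = shiftn q.+1 y).
      by rewrite -addnS; ring.
    by rewrite /shiftn -iterSr.
  by move=> i _; rewrite /shiftn -iterSr.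
(* The error in [f_waa] is indexed by the length of the first block, so it stays [C n] while the
   second block [M.+1] grows. *)
have bound M : `|ln (f n x) - \sum_(i < n) log_ratio f (shiftn i x) (M + (n - i)).+1| <= C n.
  have := ln_f_split Xx n0 (ltn0Sn M); rewrite tele// addnS [(n + M)%N]addnC.
  by rewrite !ler_norml => /andP[h1 h2]; apply/andP; split; lra.
have cv : \sum_(i < n) log_ratio f (shiftn i x) (M + (n - i)).+1 @[M --> \oo] -->
    birkhoff n (limit_function f) x.
  apply: cvg_sum_ord => i.
  have := log_ratio_cvg (Xs i); rewrite -(cvg_shiftn (n - i).+1).
  by rewrite (_ : [sequence _]_M = fun M => log_ratio f (shiftn i x) (M + (n - i)).+1)//;
    apply/funext => M; rewrite /mk_sequence addnS.
rewrite ler_norml; apply/andP; split; rewrite -subr_ge0.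
  have cv3 : ln (f n x) - (\sum_(i < n) log_ratio f (shiftn i x) (M + (n - i)).+1) - - C n
      @[M --> \oo] --> ln (f n x) - birkhoff n (limit_function f) x - - C n.
    by apply: cvgB; [apply: cvgB cv; exact: cvg_cst|exact: cvg_cst].
  by apply: cvg_ge0 cv3 => M; have := bound M; rewrite ler_norml => /andP[]; rewrite subr_ge0.
have cv3 : C n - (ln (f n x) - (\sum_(i < n) log_ratio f (shiftn i x) (M + (n - i)).+1))
    @[M --> \oo] --> C n - (ln (f n x) - birkhoff n (limit_function f) x).
  by apply: cvgB; [exact: cvg_cst|apply: cvgB cv; exact: cvg_cst].
by apply: cvg_ge0 cv3 => M; have := bound M; rewrite ler_norml => /andP[]; rewrite subr_ge0.
Qed.

Lemma bounded_borel_limitP : bounded_borel_limit X f.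
Proof.
split; [exact: log_ratio_cvg| |exact: limit_function_measurable].
exact: limit_function_bounded.
Qed.

(** Extension by 0 makes the limit bounded and measurable on the whole full shift, as [mean]
    requires. *)
Definition limit_function0 : T -> R := limit_function f \_ X.
Local Notation g := limit_function0.

Lemma limit_function0E x : X x -> g x = limit_function f x.
Proof. by move=> Xx; rewrite /g patchE mem_set. Qed.

Lemma limit_function0_bounded : bounded_measurable g.
Proof.
have mX := subshift_measurable; split.
  apply/measurable_restrict => //; rewrite setTI; exact: limit_function_measurable.
have [B HB] := limit_function_bounded; exists `|B| => x.
rewrite /g patchE; case: ifPn => [/set_mem Xx|_]; last by rewrite normr0.
exact: le_trans (HB x Xx) (ler_norm _).
Qed.

Lemma birkhoff0E n x : X x -> birkhoff n g x = birkhoff n (limit_function f) x.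
Proof.
by move=> Xx; apply: eq_bigr => i _; rewrite limit_function0E//; exact: shift_X.
Qed.

Definition log_f n : T -> R := (fun x => ln (f n x)) \_ X.

Lemma log_fE n x : X x -> log_f n x = ln (f n x).
Proof. by move=> Xx; rewrite /log_f patchE mem_set. Qed.

Lemma log_f_bounded n : (0 < n)%N -> bounded_measurable (log_f n).
Proof.
move=> n0; have mX := subshift_measurable; split.
  apply/measurable_restrict => //; rewrite setTI.
  exact: (measurableT_comp (@measurable_ln R) (f_measurable n0)).
have [_ [B HB]] := birkhoff_bounded limit_function0_bounded n.
exists (`|B| + `|C n|) => x.
rewrite /log_f patchE; case: ifPn => [/set_mem Xx|_]; last by rewrite normr0 addr_ge0.
have := HB x; rewrite birkhoff0E// => h1; have h2 := birkhoff_approximation Xx n0.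
rewrite -[ln _](subrK (birkhoff n (limit_function f) x)) addrC.
apply: le_trans (ler_normD _ _) (lerD _ _).
  exact: le_trans h1 (ler_norm _).
exact: le_trans h2 (ler_norm _).
Qed.

Lemma integral_limit_function m : invariant_measure X m ->
  (\int[m]_(x in X) (limit_function f x)%:E = (mean m g)%:E)%E.
Proof.
move=> m_inv; rewrite -(mean_setI subshift_measurable m_inv.1 limit_function0_bounded).
by apply: eq_integral => x; rewrite inE => Xx; rewrite limit_function0E.
Qed.

Lemma mean_log_integralE m n : invariant_measure X m -> (0 < n)%N ->
  mean_log_integral X m f n = (mean m (log_f n) / n%:R)%:E.
Proof.
move=> m_inv n0; rewrite /mean_log_integral.
rewrite (eq_integral (fun x => (log_f n x)%:E)); last first.
  by move=> x; rewrite inE => Xx; rewrite log_fE.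
by rewrite (mean_setI subshift_measurable m_inv.1 (log_f_bounded n0)) -EFinM mulrC.
Qed.

Lemma mean_log_f m n : invariant_measure X m -> (0 < n)%N ->
  `|mean m (log_f n) - n%:R * mean m g| <= C n.
Proof.
move=> m_inv n0; have X1 := m_inv.1; have mX := subshift_measurable.
have bg := limit_function0_bounded; have bS := birkhoff_bounded bg n.
have bL := log_f_bounded n0; have bc e := bounded_measurable_cst T (e : R).
rewrite -(mean_birkhoff bg n m_inv) ler_norml; apply/andP; split.
  rewrite lerBrDr addrC -(mean_cst m (C n)) -meanB//.
  apply: (le_mean mX X1) => //; first exact: bounded_measurableB.
  move=> x Xx; rewrite log_fE// birkhoff0E//.
  by have := birkhoff_approximation Xx n0; rewrite ler_norml => /andP[]; lra.
rewrite lerBlDr -(mean_cst m (C n)) -meanD//.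
apply: (le_mean mX X1) => //; first exact: bounded_measurableD.
move=> x Xx; rewrite log_fE// birkhoff0E//.
by have := birkhoff_approximation Xx n0; rewrite ler_norml => /andP[]; lra.
Qed.

Section Sublinear.
Hypothesis C_sublinear : (fun n => C n / n%:R) @ \oo --> (0 : R).

Lemma same_integral_limitsP : same_integral_limits X f (limit_function f).
Proof.
move=> m m_inv; rewrite integral_limit_function//.
have cv : mean m (log_f n) / n%:R @[n --> \oo] --> mean m g.
  have C0 : C n.+1 / n.+1%:R @[n --> \oo] --> (0 : R).
    by rewrite (cvg_shiftS (fun n => C n / n%:R)).
  rewrite -subr_cvg0 -cvg_shiftS; apply: norm_cvg0.
  apply: (squeeze_cvgr _ (@cvg_cst _ 0 _ \oo _) C0); apply: nearW => n.
  rewrite normr_ge0 /= ler_pdivlMr// -[X in _ * X]ger0_norm// -normrM mulrBl.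
  by rewrite divfK ?pnatr_eq0// [_ * n.+1%:R]mulrC; exact: mean_log_f.
rewrite -cvg_shiftS (_ : (fun n => _) = fun n => (mean m (log_f n.+1) / n.+1%:R)%:E).
  apply: cvg_EFin; first exact: nearW.
  by rewrite (cvg_shiftS (fun n => mean m (log_f n) / n%:R)).
by apply/funext => n; rewrite mean_log_integralE.
Qed.

Lemma uniform_birkhoff_approximationP :
  uniform_birkhoff_approximation X f (limit_function f).
Proof.
have C0 : C n.+1 / n.+1%:R @[n --> \oo] --> (0 : R).
  by rewrite (cvg_shiftS (fun n => C n / n%:R)).
have [x0 Xx0] : X !=set0 by case: X_subshift.
rewrite /uniform_birkhoff_approximation -cvg_shiftS.
have cE : (C n.+1 / n.+1%:R)%:E @[n --> \oo] --> (0 : \bar R)%E.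
  by apply: cvg_EFin; first exact: nearW.
apply: (squeeze_cvge _ (@cvg_cst _ (0 : \bar R)%E _ \oo _) cE).
apply: nearW => n; apply/andP; split.
  apply: mule_ge0; first by rewrite lee_fin invr_ge0.
  apply: (@le_trans _ _ (`|ln (f n.+1 x0) - birkhoff n.+1 (limit_function f) x0|)%:E).
    by rewrite lee_fin.
  by apply: ereal_sup_ubound; exists x0.
rewrite [leRHS](_ : _ = ((n.+1%:R)^-1)%:E * (C n.+1)%:E)%E; last first.
  by rewrite -EFinM mulrC.
apply: lee_wpmul2l; first by rewrite lee_fin invr_ge0.
apply: ge_ereal_sup => _ [x Xx <-]; rewrite lee_fin.
exact: birkhoff_approximation.
Qed.

Lemma limn_mean_log_integral m : invariant_measure X m ->
  limn (mean_log_integral X m f) = (mean m g)%:E.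
Proof.
move=> m_inv; have := same_integral_limitsP m_inv.
by rewrite integral_limit_function// => /cvg_lim ->.
Qed.

Lemma equilibrium_state_seq_fun m :
  equilibrium_state_seq X f m <-> equilibrium_state_fun X (limit_function f) m.
Proof.
split=> -[m_inv max_m]; split=> // m' m'_inv; have := max_m _ m'_inv.
  by rewrite !limn_mean_log_integral// !integral_limit_function.
by rewrite !limn_mean_log_integral// !integral_limit_function.
Qed.

End Sublinear.

End Limit_function.

Lemma cylinder_mass (R : realType) k (X : set (full_shift k)) (m : probability (full_shift k) R)
    n (x : full_shift k) : measurable X -> invariant_measure X m ->
  fine (m (cylinder X n x)) = mass m (cyl (word n x)).
Proof.
move=> mX m_inv; rewrite -(mass_setIX mX m_inv (cyl_measurable _)) /mass; congr (fine (m _)).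
by apply/seteqP; split=> z [h1 h2]; split=> //; apply/cylE.
Qed.

Lemma gibbs_bounds_transfer (R : realType) k (X : set (full_shift k))
    (f1 f2 : nat -> full_shift k -> R) (m : probability (full_shift k) R)
    (P : R) (C K : nat -> R) :
  (forall n, (0 < n)%N -> 0 < C n) ->
  (forall n x, (0 < n)%N -> X x -> [/\ 0 < f1 n x, 0 < f2 n x &
    `|ln (f1 n x) - ln (f2 n x)| <= K n]) ->
  gibbs_bounds X f1 m P C -> gibbs_bounds X f2 m P (fun n => C n * expR (K n)).
Proof.
move=> C0 fK H x n Xx n0; have [f1x f2x] := fK n x n0 Xx.
have := H x n Xx n0; set a := fine _; set e := expR _.
have a0 : 0 <= a by exact: fine_ge0.
have e0 : 0 < e by exact: expR_gt0.
rewrite !ler_pdivlMr ?mulr_gt0// !ler_pdivrMr ?mulr_gt0// => /andP[h1 h2].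
rewrite ler_norml => /andP[k1 k2].
have l1 : f1 n x <= expR (K n) * f2 n x.
  by rewrite -ler_ln ?posrE ?mulr_gt0 ?expR_gt0// lnM ?posrE ?expR_gt0// expRK; lra.
have l2 : f2 n x <= expR (K n) * f1 n x.
  by rewrite -ler_ln ?posrE ?mulr_gt0 ?expR_gt0// lnM ?posrE ?expR_gt0// expRK; lra.
have Cn := C0 n n0; apply/andP; split.
  apply: le_trans h1; rewrite invfM -[leLHS]mulrA.
  apply: ler_wpM2l; first by rewrite invr_ge0 ltW.
  by rewrite ler_pdivrMl ?expR_gt0// mulrCA; apply: ler_wpM2l => //; exact: ltW.
apply: le_trans h2 _; rewrite -[leRHS]mulrA; apply: ler_wpM2l; first exact: ltW.
by rewrite [leRHS]mulrCA; apply: ler_wpM2l => //; exact: ltW.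
Qed.

(** * From an almost additive sequence to a weight on words *)

Section Word_weight.
Variables (R : realType) (k : nat) (X : set (full_shift k)).
Local Notation T := (full_shift k).
Local Notation A := 'I_k.+1.
Variables (f : nat -> T -> R) (C M : R) (p : nat).
Hypothesis X_subshift : subshift X.
Hypothesis f_pos : forall n x, (0 < n)%N -> X x -> 0 < f n x.
Hypothesis C_gt0 : 0 < C.
Hypothesis f_aa : forall x n m, X x -> (0 < n)%N -> (0 < m)%N ->
  expR (- C) * f n x * f m (iter n (@left_shift k) x) <= f (n + m)%N x
    <= expR C * f n x * f m (iter n (@left_shift k) x).
Hypothesis M_gt0 : 0 < M.
Hypothesis f_bv : forall n x y, (0 < n)%N -> X x -> X y -> agree n x y ->
  f n x / f n y <= M.
Hypothesis X_spec : forall u v, language X u -> language X v ->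
  exists j w, [/\ (j <= p)%N, blocks X j w & language X (u ++ w ++ v)].

Let X_closed : closed X. Proof. by case: X_subshift. Qed.
Let X_shift : forall x, X x -> X (left_shift x). Proof. by case: X_subshift. Qed.

Definition word_point (w : seq A) : T := xget point [set x | X x /\ cyl w x].

(* The value of f at one chosen point of the cylinder of w; bounded variation
   makes the choice immaterial up to a factor M. *)
Definition word_weight (w : seq A) : R :=
  if w == [::] then 1
  else if `[< language X w >] then f (size w) (word_point w) else 0.
Local Notation phi := word_weight.

Lemma languageP w : language X w <-> exists x, X x /\ cyl w x.
Proof.
split=> [[n _ [x [j [Xx ->]]]]|[x [Xx wx]]]; last first.
  exists (size w) => //; exists x, 0%N; split=> //.
exists (shiftn j x); split; first exact: shift_X.
rewrite /cyl /= size_mkseq; apply: eq_map => i /=; exact: shiftE.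
Qed.

Lemma word_pointP w : language X w -> X (word_point w) /\ cyl w (word_point w).
Proof.
by move=> /languageP[x wx]; exact: (xgetPex point (ex_intro [set x | X x /\ cyl w x] x wx)).
Qed.

Lemma language_catl u v : language X (u ++ v) -> language X u.
Proof. by move=> /languageP[x [Xx /cyl_cat[ux _]]]; apply/languageP; exists x. Qed.

Lemma language_catr u v : language X (u ++ v) -> language X v.
Proof.
move=> /languageP[x [Xx /cyl_cat[_ vx]]]; apply/languageP.
by exists (shiftn (size u) x); split=> //; exact: shift_X.
Qed.

Lemma word_weight_ge0 w : 0 <= phi w.
Proof.
rewrite /phi; case: eqP => [//|/eqP w0]; case: asboolP => [/word_pointP[Xp _]|//].
by apply: ltW; apply: f_pos => //; rewrite lt0n size_eq0.
Qed.

Lemma word_weight_gt0 w : language X w -> 0 < phi w.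
Proof.
move=> Lw; rewrite /phi; case: eqP => [//|/eqP w0]; rewrite asboolT//.
by apply: f_pos; [rewrite lt0n size_eq0|have [] := word_pointP Lw].
Qed.

Lemma word_weight_lang w : 0 < phi w -> language X w.
Proof.
rewrite /phi; case: eqP => [-> _|_].
  have [x Xx] : X !=set0 by case: X_subshift.
  by apply/languageP; exists x.
by case: asboolP => //; rewrite ltxx.
Qed.

Lemma variation_ge1 : 1 <= M.
Proof.
have [x Xx] : X !=set0 by case: X_subshift.
have := @f_bv 1 x x isT Xx Xx (fun _ _ => erefl).
by rewrite divff// gt_eqF// f_pos.
Qed.

Lemma word_weight_cmp w x : (0 < size w)%N -> X x -> cyl w x ->
  phi w <= M * f (size w) x /\ f (size w) x <= M * phi w.
Proof.
move=> w0 Xx wx; have Lw : language X w by apply/languageP; exists x.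
have [Xp wp] := word_pointP Lw.
have xp : agree (size w) x (word_point w) by apply/word_agree; rewrite wx wp.
have px : agree (size w) (word_point w) x by apply/word_agree; rewrite wx wp.
rewrite /phi ifF; last by apply/negbTE; rewrite -size_eq0 -lt0n.
rewrite asboolT//.
have := f_bv w0 Xp Xx px; have := f_bv w0 Xx Xp xp.
by rewrite !ler_pdivrMr ?f_pos.
Qed.

(** [expR C] for splitting [f], and one [M] for each of the words [u], [v] and [u ++ v]. *)
Let K := expR C * M ^+ 3.

Let K_ge1 : 1 <= K.
Proof.
rewrite /K -[leLHS]mulr1 ler_pM// ?exprn_ege1 ?variation_ge1//.
by apply: le_trans (expR_ge1Dx _); rewrite lerDl ltW.
Qed.

Let K_ge0 : 0 <= K. Proof. exact: le_trans ler01 K_ge1. Qed.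

Let weight_nilE : phi [::] = 1. Proof. by []. Qed.

Lemma word_weight_cat u v : language X (u ++ v) ->
  phi (u ++ v) <= K * (phi u * phi v) /\ phi u * phi v <= K * phi (u ++ v).
Proof.
have triv (a : R) : 0 <= a -> a <= K * a by move=> a0; rewrite ler_peMl.
case: u => [|a u].
  by rewrite weight_nilE mul1r => _; split; apply: triv; exact: word_weight_ge0.
case: v => [|b v].
  by rewrite cats0 weight_nilE mulr1 => _; split; apply: triv; exact: word_weight_ge0.
move: (isT : (0 < size (a :: u))%N) (isT : (0 < size (b :: v))%N).
move: (a :: u) (b :: v) => {a b} {}u {}v u0 v0 Luv.
have [Xx /[dup] uvx /cyl_cat[ux vx]] := word_pointP Luv.
move: (word_point _) Xx uvx ux vx => x Xx uvx ux vx.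
have Xs : X (shiftn (size u) x) by exact: shift_X.
have uv0 : (0 < size (u ++ v))%N by rewrite size_cat addn_gt0 u0.
have [c1 c2] := word_weight_cmp uv0 Xx uvx.
have [u1 u2] := word_weight_cmp u0 Xx ux.
have [v1 v2] := word_weight_cmp v0 Xs vx.
have /andP[a1 a2] := f_aa Xx u0 v0; rewrite -/(shiftn (size u) x) -size_cat in a1 a2.
have fu := f_pos u0 Xx; have fv := f_pos v0 Xs.
have E0 := expR_gt0 C; have M0 := ltW M_gt0.
have pu := word_weight_ge0 u; have pv := word_weight_ge0 v.
split.
  apply: le_trans c1 _.
  rewrite [leRHS](_ : _ = M * (expR C * ((M * phi u) * (M * phi v)))); last by rewrite /K; ring.
  apply: ler_wpM2l => //; apply: le_trans a2 _; rewrite -[leLHS]mulrA.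
  apply: ler_wpM2l; first exact: ltW.
  by apply: ler_pM => //; exact: ltW.
apply: (@le_trans _ _ ((M * f (size u) x) * (M * f (size v) (shiftn (size u) x)))).
  exact: ler_pM.
rewrite [leRHS](_ : _ = M * M * (expR C * (M * phi (u ++ v)))); last by rewrite /K; ring.
rewrite mulrACA ler_wpM2l ?mulr_ge0//.
move: a1; rewrite expRN -mulrA ler_pdivrMl// => a1; apply: le_trans a1 _.
by rewrite ler_wpM2l// ltW.
Qed.

(** Gluing twice gives [phi u * phi v * phi w <= K * K * phi (u ++ w ++ v)], and [B] bounds the
    inverse weight of any gap word. Words outside the language add 0, as the inverse of 0 is 0. *)
Let B : R := \sum_(j < p.+1) word_sum j (fun w => (phi w)^-1).

Lemma word_weightP : exists L, specified_weight phi L p.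
Proof.
have B0 : 0 <= B.
  apply: sumr_ge0 => j _; apply: word_sum_ge0 => w.
  by rewrite invr_ge0; exact: word_weight_ge0.
(* The summand 1 keeps this above [K], so one constant serves for cutting and for gluing. *)
exists (K * K * (1 + B)).
have LK : K <= K * K * (1 + B).
  rewrite -mulrA ler_peMr// -[leLHS]mulr1 ler_pM// lerDl//.
have L0 : 0 <= K * K * (1 + B) by exact: le_trans LK.
split.
- exact: word_weight_ge0.
- by [].
- move=> u v; have [L|nL] := pselect (language X (u ++ v)).
    have [h _] := word_weight_cat L; apply: le_trans h _.
    by rewrite ler_wpM2r// mulr_ge0// word_weight_ge0.
  rewrite {1}/phi ifF; last first.
    apply/negP => /eqP uv; apply: nL; apply: word_weight_lang; rewrite uv.
    exact: ltr01.
  rewrite asboolF//; apply: mulr_ge0 => //.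
  by apply: mulr_ge0; exact: word_weight_ge0.
- move=> u v; set S := \sum_(j < p.+1) _.
  have S0 : 0 <= S.
    by apply: sumr_ge0 => j _; apply: word_sum_ge0 => w; exact: word_weight_ge0.
  have := word_weight_ge0 u; rewrite le_eqVlt => /predU1P[<-|u0].
    by rewrite mul0r; exact: mulr_ge0.
  have := word_weight_ge0 v; rewrite le_eqVlt => /predU1P[<-|v0].
    by rewrite mulr0; exact: mulr_ge0.
  have [j [w [jp Bw Luwv]]] := X_spec (word_weight_lang u0) (word_weight_lang v0).
  have wj : size w = j by move: Bw => [x [i [_ ->]]]; rewrite size_mkseq.
  have Lwv := language_catr Luwv; have w0 := word_weight_gt0 (language_catl Lwv).
  have [_ h1] := word_weight_cat Luwv; have [_ h2] := word_weight_cat Lwv.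
  have jp' : (j < p.+1)%N by [].
  have hS : phi (u ++ w ++ v) <= S.
    rewrite /S (bigD1 (Ordinal jp'))//=.
    apply: (@le_trans _ _ (word_sum j (fun w => phi (u ++ w ++ v)))).
      by apply: (ler_word_sum1 (F := fun w => phi (u ++ w ++ v))) => // z; exact: word_weight_ge0.
    rewrite lerDl; apply: sumr_ge0 => i _; apply: word_sum_ge0 => z; exact: word_weight_ge0.
  have hB : (phi w)^-1 <= 1 + B.
    have i0 z : 0 <= (phi z)^-1 by rewrite invr_ge0; exact: word_weight_ge0.
    rewrite /B (bigD1 (Ordinal jp'))//=.
    have := ler_word_sum1 i0 wj; set s := word_sum j _ => hs.
    have : 0 <= \sum_(i < p.+1 | i != Ordinal jp') word_sum i (fun w => (phi w)^-1).
      by apply: sumr_ge0 => i _; exact: word_sum_ge0.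
    by lra.
  have h3 : phi u * phi v * phi w <= K * K * S.
    rewrite [leLHS](_ : _ = phi u * (phi w * phi v)); last by ring.
    apply: (@le_trans _ _ (phi u * (K * phi (w ++ v)))).
      by rewrite ler_wpM2l// ltW.
    rewrite mulrCA -mulrA ler_wpM2l//; apply: le_trans h1 _.
    by rewrite ler_wpM2l.
  rewrite -[leLHS](mulfK (lt0r_neq0 w0)).
  apply: (@le_trans _ _ (K * K * S * (phi w)^-1)).
    by rewrite ler_wpM2r// invr_ge0 ltW.
  rewrite mulrAC ler_wpM2r// ler_wpM2l// mulr_ge0//.
- move=> n; have [x Xx] : X !=set0 by case: X_subshift.
  apply: lt_le_trans (ler_word_sum1 word_weight_ge0 (size_word n x)).
  apply: word_weight_gt0; apply/languageP; exists x; split=> //; exact: cyl_word.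
Qed.

Lemma ex_mixing_gibbs : exists mu : probability T R, gibbs_seq X f mu /\
  forall nu : probability T R, invariant_measure X nu ->
    (forall E : set T, measurable E -> mass mu E = 0 -> mass nu E = 0) ->
    forall E : set T, measurable E -> nu E = mu E.
Proof.
have [L phiP] := word_weightP.
have ptX w : 0 < phi w -> X (word_point w) /\ cyl w (word_point w).
  by move=> /word_weight_lang/word_pointP.
have [mu [mu_inv mu_cyl]] := ex_gibbs_measure phiP X_closed X_shift ptX.
have mX : measurable X by exact: closed_measurable.
exists mu; split; last first.
  move=> nu nu_inv dom E mE; rewrite !massE//; congr (_%:E).
  apply: (invariant_dominated_unique phiP (quasi_bernoulli_const_gt0 phiP) mu_cyl) => //.
    by move=> F mF; rewrite /mass mu_inv.2.
  by move=> F mF; rewrite /mass nu_inv.2.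
split=> //.
set Q := quasi_bernoulli_const phi L p in mu_cyl.
have Q0 : 0 < Q by exact: quasi_bernoulli_const_gt0 phiP.
have Z0 := weight_sum_gt0 phiP.
have L0 : 0 < L by exact: lt_le_trans ltr01 (weight_ge1 phiP).
have E0 := ext_const_gt0 phiP.
(* [ln Z_n] is additive up to a constant, and its slope [P] is the pressure. *)
pose a n := ln (word_sum n phi).
pose c := `|ln L| + `|ln (ext_const phi L p)|.
have [P HP] : exists P, forall n, `|a n - n%:R * P| <= c.
  apply: almost_additive_linear => n m; rewrite /a.
  have := weight_sumD_le phiP n m; rewrite -ler_ln ?posrE ?mulr_gt0//.
  rewrite lnM ?posrE ?mulr_gt0// lnM ?posrE// => h1.
  have pos1 : 0 < word_sum n phi * word_sum m phi by exact: mulr_gt0.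
  have pos2 : 0 < ext_const phi L p * word_sum (n + m) phi by exact: mulr_gt0.
  have := weight_sumM_le phiP n m; rewrite -ler_ln ?posrE//.
  rewrite lnM ?posrE// lnM ?posrE// => h2.
  have := ler_norm (ln L); have := ler_norm (ln (ext_const phi L p)).
  by rewrite /c ler_norml => h3 h4; have := normr_ge0 (ln L);
    have := normr_ge0 (ln (ext_const phi L p)) => h5 h6; apply/andP; split; lra.
have G0 : 0 < Q * M * expR c.
  by apply: mulr_gt0; [exact: mulr_gt0|exact: expR_gt0].
(* [Q] compares [mu] with [phi / Z], [M] compares [phi] with [f] at the given point, and [expR c]
   compares [Z n] with [expR (n * P)]. *)
exists P, (Q * M * expR c); split=> //.
move=> x n Xx n0; rewrite (cylinder_mass _ _ mX mu_inv).
have fx := f_pos n0 Xx; have eP := expR_gt0 (- (n%:R * P)).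
have /andP[m1 m2] := mu_cyl (word n x); rewrite size_word in m1 m2.
have [|c1 c2] := word_weight_cmp _ Xx (cyl_word n x); first by rewrite size_word.
rewrite size_word in c1 c2.
have Zn := Z0 n; have := HP n; rewrite ler_norml /a => /andP[p1 p2].
have z1 : (word_sum n phi)^-1 <= expR c * expR (- (n%:R * P)).
  rewrite -ler_ln ?posrE ?invr_gt0 ?mulr_gt0 ?expR_gt0// lnV ?posrE// -expRD expRK; lra.
have z2 : expR (- (n%:R * P)) <= expR c * (word_sum n phi)^-1.
  rewrite -ler_ln ?posrE ?mulr_gt0 ?invr_gt0 ?expR_gt0// lnM ?posrE ?invr_gt0 ?expR_gt0//.
  by rewrite lnV ?posrE// !expRK; lra.
have ph0 := word_weight_ge0 (word n x).
apply/andP; split.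
  rewrite ler_pdivlMr ?mulr_gt0// ler_pdivrMl//.
  apply: (@le_trans _ _ ((expR c * (word_sum n phi)^-1) * (M * phi (word n x)))).
    by apply: ler_pM => //; exact: ltW.
  rewrite [leLHS](_ : _ = M * expR c * (phi (word n x) / word_sum n phi)); last by ring.
  rewrite [leRHS](_ : _ = M * expR c * (Q * mass mu (cyl (word n x)))); last by ring.
  apply: ler_wpM2l; first by rewrite mulr_ge0 ?expR_ge0// ltW.
  by move: m1; rewrite ler_pdivrMl.
rewrite ler_pdivrMr ?mulr_gt0//; apply: le_trans m2 _.
rewrite [leRHS](_ : _ = Q * ((M * f n x) * (expR c * expR (- (n%:R * P))))); last by ring.
apply: ler_wpM2l; first exact: ltW.
by apply: ler_pM => //; rewrite invr_ge0 ltW.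
Qed.

End Word_weight.

(** * Gibbs measures and equilibrium states of the limit function *)

Section Gibbs_states.
Variables (R : realType) (k : nat) (X : set (full_shift k)).
Local Notation T := (full_shift k).
Variables (f : nat -> T -> R) (C : nat -> R).
Hypothesis X_subshift : subshift X.
Hypothesis f_cont : continuous_sequence X f.
Hypothesis f_lim : forall x, X x -> lower_limit f x = upper_limit f x.
Hypothesis f_waa : forall x n m, X x -> (0 < n)%N -> (0 < m)%N ->
  expR (- C n) * f n x * f m (iter n (@left_shift k) x) <= f (n + m)%N x
    <= expR (C n) * f n x * f m (iter n (@left_shift k) x).
Implicit Types mu nu : probability T R.

Let fhat := limit_function f.
Let approx := birkhoff_approximation X_subshift f_cont f_lim f_waa.

Lemma log_birkhoff_bound n x : (0 < n)%N -> X x ->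
  [/\ 0 < f n x, 0 < expR (birkhoff n fhat x) &
    `|ln (f n x) - ln (expR (birkhoff n fhat x))| <= C n].
Proof.
move=> n0 Xx; split; [exact: (f_gt0 f_cont)|exact: expR_gt0|].
by rewrite expRK; exact: approx.
Qed.

Lemma gibbs_seq_weak_gibbs_fun mu :
  (fun n => C n / n%:R) @ \oo --> (0 : R) ->
  gibbs_seq X f mu -> weak_gibbs_fun X fhat mu.
Proof.
move=> C_sub [mu_inv [P [D [D0 H]]]]; split=> //.
exists P, (fun n => D * expR (C n)); split.
- by move=> n _; rewrite mulr_gt0// expR_gt0.
- have cv : ln D / n.+1%:R + C n.+1 / n.+1%:R @[n --> \oo] --> 0 + 0.
    apply: cvgD; first exact: cvg_const_div_succ.
    by rewrite (cvg_shiftS (fun n => C n / n%:R)).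
  rewrite addr0 in cv; rewrite -cvg_shiftS.
  rewrite (_ : (fun n => _) = fun n => ln D / n.+1%:R + C n.+1 / n.+1%:R)//.
  by apply/funext => n; rewrite lnM ?posrE ?expR_gt0// expRK mulrDl.
- exact: (gibbs_bounds_transfer (fun _ _ => D0) log_birkhoff_bound H).
Qed.

Lemma gibbs_seq_fun mu c : (forall n, C n = c) ->
  gibbs_seq X f mu <-> gibbs_fun X fhat mu.
Proof.
move=> Cc; split=> -[mu_inv [P [D [D0 H]]]]; split=> //; exists P, (D * expR c);
  split; rewrite ?mulr_gt0 ?expR_gt0//.
  rewrite (_ : (fun=> _) = fun n : nat => D * expR (C n)).
    exact: (gibbs_bounds_transfer (fun _ _ => D0) log_birkhoff_bound H).
  by apply/funext => n; rewrite Cc.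
rewrite (_ : (fun=> _) = fun n : nat => D * expR (C n)).
  apply: (gibbs_bounds_transfer (fun _ _ => D0) _ H) => n x n0 Xx.
  by have [h1 h2 h3] := log_birkhoff_bound n0 Xx; split=> //; rewrite distrC.
by apply/funext => n; rewrite Cc.
Qed.

Lemma gibbs_seq_log_bound mu c : (forall n, C n = c) -> gibbs_seq X f mu ->
  exists P d : R, forall n x, (0 < n)%N -> X x ->
    0 < mass mu (cyl (word n x)) /\
    `|ln (mass mu (cyl (word n x))) -
      (birkhoff n (limit_function0 X f) x - n%:R * P)| <= d.
Proof.
move=> Cc [mu_inv [P [D [D0 H]]]]; exists P, (ln D + c) => n x n0 Xx.
have mX := subshift_measurable X_subshift.
have := H x n Xx n0; rewrite (cylinder_mass _ _ mX mu_inv).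
set a := mass _ _; have fx := f_gt0 f_cont n0 Xx.
have e0 := expR_gt0 (- (n%:R * P)).
rewrite ler_pdivlMr ?mulr_gt0// ler_pdivrMr ?mulr_gt0// => /andP[h1 h2].
have a0 : 0 < a by apply: lt_le_trans h1; rewrite !mulr_gt0// invr_gt0.
split=> //; rewrite (birkhoff0E f X_subshift n Xx).
have := approx Xx n0; rewrite Cc ler_norml => /andP[h3 h4].
have Df : 0 < expR (- (n%:R * P)) * f n x by rewrite mulr_gt0.
move: h1; rewrite -ler_ln ?posrE ?mulr_gt0 ?invr_gt0// lnM ?posrE ?invr_gt0//.
rewrite lnV ?posrE// lnM ?posrE// expRK => l1.
move: h2; rewrite -ler_ln ?posrE ?mulr_gt0// lnM ?posrE// lnM ?posrE// expRK => l2.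
by rewrite ler_norml; apply/andP; split; lra.
Qed.

Lemma is_unique_iff (Q1 Q2 : probability T R -> Prop) mu :
  (forall nu, Q1 nu <-> Q2 nu) -> is_unique Q1 mu -> is_unique Q2 mu.
Proof. by move=> Q12 [Q1mu uniq]; split=> [|nu /Q12]; [exact/Q12|exact: uniq]. Qed.

Lemma unique_equilibrium_gibbs c : 0 < c -> (forall n, C n = c) ->
  weak_specification X -> bounded_variation_seq X f ->
  exists mu : probability T R,
    [/\ is_unique (equilibrium_state_seq X f) mu,
        is_unique (gibbs_seq X f) mu,
        is_unique (equilibrium_state_fun X fhat) mu &
        is_unique (gibbs_fun X fhat) mu].
Proof.
move=> c0 Cc [p spec] [M M0 bv].
have aa x n m : X x -> (0 < n)%N -> (0 < m)%N ->
    expR (- c) * f n x * f m (iter n (@left_shift k) x) <= f (n + m)%N x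
    <= expR c * f n x * f m (iter n (@left_shift k) x).
  by move=> Xx n0 m0; rewrite -(Cc n); exact: f_waa.
have [mu [mu_gibbs mu_unique]] := ex_mixing_gibbs X_subshift
  (fun n x n0 Xx => f_gt0 f_cont n0 Xx) c0 aa M0 bv spec.
have mX := subshift_measurable X_subshift.
have Xs : forall x, X x -> X (left_shift x) by case: X_subshift.
have gb := limit_function0_bounded X_subshift f_cont f_lim f_waa.
have C_sub : (fun n => C n / n%:R) @ \oo --> (0 : R).
  rewrite -cvg_shiftS (_ : (fun n => _) = fun n => c / n.+1%:R).
    exact: cvg_const_div_succ.
  by apply/funext => n; rewrite Cc.
have limE m : invariant_measure X m ->
    limn (mean_log_integral X m f) = (mean m (limit_function0 X f))%:E.
  exact: (limn_mean_log_integral X_subshift f_cont f_lim f_waa C_sub).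
have mu_inv := mu_gibbs.1.
have [P [d Hmu]] := gibbs_seq_log_bound Cc mu_gibbs.
have eq_unique nu : equilibrium_state_seq X f nu ->
    forall A : set T, measurable A -> nu A = mu A.
  move=> [nu_inv nu_max]; apply: mu_unique => //.
  apply: (equilibrium_dominated mX Xs gb Hmu nu_inv).
  have := nu_max _ mu_inv; rewrite !limE// (entropy_gibbs mX Xs gb mu_inv Hmu).
  by rewrite -EFinD subrK EFinB leeBlDr.
have mu_eq : equilibrium_state_seq X f mu.
  split=> // m m_inv; rewrite !limE// (entropy_gibbs mX Xs gb mu_inv Hmu).
  rewrite -EFinD subrK -leeBrDr// -EFinB.
  exact: (entropy_le mX Xs gb Hmu).
(* The entropy estimates apply to any invariant Gibbs measure with its own constants, so each one is
   an equilibrium state and uniqueness carries over. *)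
have gibbs_eq nu : gibbs_seq X f nu -> equilibrium_state_seq X f nu.
  move=> nu_gibbs; have nu_inv := nu_gibbs.1.
  have [P' [d' Hnu]] := gibbs_seq_log_bound Cc nu_gibbs.
  split=> // m m_inv; rewrite !limE// (entropy_gibbs mX Xs gb nu_inv Hnu).
  rewrite -EFinD subrK -leeBrDr// -EFinB.
  exact: (entropy_le mX Xs gb Hnu).
have u1 : is_unique (equilibrium_state_seq X f) mu by split.
have u2 : is_unique (gibbs_seq X f) mu by split=> // nu /gibbs_eq; exact: eq_unique.
exists mu; split=> //.
  apply: is_unique_iff u1 => nu.
  exact: (equilibrium_state_seq_fun X_subshift f_cont f_lim f_waa C_sub).
by apply: is_unique_iff u2 => nu; exact: gibbs_seq_fun Cc.
Qed.

End Gibbs_states.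

Theorem theorem3p1 (R : realType) (k : nat) (X : set (full_shift k))
    (f : nat -> full_shift k -> R)
    (X_subshift : subshift X)
    (X_spec : weak_specification X)
    (f_cont : continuous_sequence X f)
    (f_lim : forall x, X x -> lower_limit f x = upper_limit f x) :
  let fhat := limit_function f in
  (almost_additive X f ->
    [/\ bounded_borel_limit X f,
        uniform_birkhoff_approximation X f fhat,
        same_integral_limits X f fhat &
        bounded_variation_seq X f ->
          exists mu : probability (full_shift k) R,
            [/\ is_unique (equilibrium_state_seq X f) mu,
                is_unique (gibbs_seq X f) mu,
                is_unique (equilibrium_state_fun X fhat) mu &
                is_unique (gibbs_fun X fhat) mu]])
  /\
  (weakly_almost_additive X f ->
    [/\ bounded_borel_limit X f,
        uniform_birkhoff_approximation X f fhat,
        same_integral_limits X f fhat &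
        forall mu : probability (full_shift k) R,
          equilibrium_state_seq X f mu -> gibbs_seq X f mu ->
            equilibrium_state_fun X fhat mu /\ weak_gibbs_fun X fhat mu]).
Proof.
move=> fhat; split.
  move=> [c c0 aa]; pose C (n : nat) : R := c.
  have C_sub : (fun n => C n / n%:R) @ \oo --> (0 : R).
    rewrite -cvg_shiftS; exact: cvg_const_div_succ.
  have waa : forall x n m, X x -> (0 < n)%N -> (0 < m)%N ->
      expR (- C n) * f n x * f m (iter n (@left_shift k) x) <= f (n + m)%N x
      <= expR (C n) * f n x * f m (iter n (@left_shift k) x).
    by move=> x n m; exact: aa.
  split.
  - exact: (bounded_borel_limitP X_subshift f_cont f_lim waa).
  - exact: (uniform_birkhoff_approximationP X_subshift f_cont f_lim waa C_sub).
  - exact: (same_integral_limitsP X_subshift f_cont f_lim waa C_sub).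
  - exact: (unique_equilibrium_gibbs X_subshift f_cont f_lim waa c0).
move=> [C [C0 C_sub waa]]; split.
- exact: (bounded_borel_limitP X_subshift f_cont f_lim waa).
- exact: (uniform_birkhoff_approximationP X_subshift f_cont f_lim waa C_sub).
- exact: (same_integral_limitsP X_subshift f_cont f_lim waa C_sub).
- move=> mu mu_eq mu_gibbs; split.
    exact/(equilibrium_state_seq_fun X_subshift f_cont f_lim waa C_sub).
  exact: (gibbs_seq_weak_gibbs_fun X_subshift f_cont f_lim waa C_sub).
Qed.
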